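(* Let $G$ be a finitely generated group acting by isometries on a geodesic metric space $(X,d)$, suppose that the action admits two independent strongly contracting WPD elements, and fix a base point $o\in X$. Then, for every finite symmetric generating set $S$ of $G$, there exists $\varepsilon=\varepsilon(S,o)>0$ such that the set $$A=\{g\in G: d(o,go)\le\varepsilon\,d_S(1,g)\}$$ has a growth gap in $G$, i.e. $\omega(A,S)<\omega(G,S)$.
   Context: **Counting.** $S=S^{-1}$, $d_S$ is the word metric, $B_n=\{g\in G: d_S(1,g)\le n\}$, and for $A\subseteq G$, $\omega(A,S)=\limsup_{n\to\infty}\frac{\log|A\cap B_n|}{n}$. **Strongly contracting.** For a closed subset $Y\subseteq X$ and $x\in X$, let $\pi_Y(x)=\{y\in Y: d(x,y)=d(x,Y)\}$. The set $Y$ is strongly $C$-contracting if $\mathrm{diam}(\pi_Y(x)\cup\pi_Y(y))\le C$ for all $x,y\in X$ with $d(x,y)\le d(x,Y)$. An infinite order isometry $h$ of $X$ is strongly contracting if it acts by translation on a strongly $C$-contracting quasi-geodesic for some $C$; equivalently, for $o\in X$, the map $\mathbb Z\to X$, $n\mapsto h^no$, is a quasi-isometric embedding whose image is strongly contracting. **WPD.** For $r\ge0$ and $x,y\in X$, $\mathrm{Stab}_r(x,y)=\{g\in G: d(x,gx)\le r,\ d(y,gy)\le r\}$. An element $f\in G$ is WPD if for all $r>0$ and $x\in X$ there exists $L\in\mathbb N$ with $|\mathrm{Stab}_r(x,f^Lx)|<\infty$. **Independence.** Two strongly contracting WPD elements $h,k\in G$ are independent if no nonzero power of $h$ is conjugate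 in $G$ to a nonzero power of $k$. *)

(* Defs.v *)
From HB Require Import structures.
From mathcomp Require Import all_boot all_order all_algebra.
From mathcomp Require Import finmap.
From mathcomp Require Import all_classical all_reals all_analysis.

Set Implicit Arguments.
Unset Strict Implicit.
Unset Printing Implicit Defensive.

Import Order.TTheory GRing.Theory Num.Theory.

Local Open Scope classical_set_scope.
Local Open Scope ring_scope.

(** * Finitely generated groups and word metrics *)

Definition zexpg (G : groupType) (h : G) (n : int) : G :=
  match n with
  | Posz m => (h ^+ m)%g
  | Negz m => (h ^- m.+1)%g
  end.

Definition is_subgroup (G : groupType) (H : set G) : Prop :=
  [/\ H 1%g,
      forall g h, H g -> H h -> H (g * h)%g
    & forall g, H g -> H (g^-1)%g].

Definition generates (G : groupType) (S : set G) : Prop :=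
  forall H : set G, is_subgroup H -> S `<=` H -> H = setT.

Definition symmetric_set (G : groupType) (S : set G) : Prop :=
  forall g, S g -> S (g^-1)%g.

Definition finitely_generated (G : groupType) : Prop :=
  exists S : set G, finite_set S /\ generates S.

Definition is_word_length (G : groupType) (S : set G) (g : G) (n : nat) : Prop :=
  exists w : seq G,
    [/\ size w = n, forall s, s \in w -> S s & g = (\prod_(s <- w) s)%g].

(* The least length of a word in S representing g; the value 0 taken when g is
   not a product of elements of S does not occur for S symmetric and
   generating. *)
Definition word_length (G : groupType) (S : set G) (g : G) : nat :=
  match pselect (exists n, `[< is_word_length S g n >]) with
  | left ex => ex_minn ex
  | right _ => 0%N
  end.

Definition word_metric (G : groupType) (S : set G) (g h : G) : nat :=
  word_length S (g^-1 * h)%g.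

Definition word_ball (G : groupType) (S : set G) (n : nat) : set G :=
  [set g | (word_metric S 1%g g <= n)%N].

(* [lne 0 = -oo], so that subsets missing a ball cause no artefact; the term of
   index 0 is irrelevant to the limit superior.  The cardinal is meaningful
   for finite S, all balls being then finite. *)
Definition growth_rate (R : realType) (G : groupType) (S A : set G) : \bar R :=
  limn_esup (fun n : nat =>
    (lne (#|` fset_set (A `&` word_ball S n)|%:R)%:E * (n%:R^-1)%:E)%E).

(** * Geodesic metric spaces and isometric actions *)

Definition geodesic_space (R : realType) (X : metricType R) : Prop :=
  forall x y : X, exists gamma : R -> X,
    [/\ gamma 0 = x,
        gamma (mdist x y) = y
      & forall s t, s \in `[0, mdist x y] -> t \in `[0, mdist x y] ->
          mdist (gamma s) (gamma t) = `|s - t|].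

Record isometric_action (R : realType) (G : groupType) (X : metricType R)
    (act : G -> X -> X) : Prop := IsometricAction {
  act_one : forall x, act 1%g x = x;
  act_mul : forall g h x, act (g * h)%g x = act g (act h x);
  act_isometry : forall g x y, mdist (act g x) (act g y) = mdist x y
}.

(** * Strong contraction *)

Definition dist_to (R : realType) (X : metricType R) (x : X) (Y : set X) : R :=
  inf [set mdist x y | y in Y].

Definition nearest_points (R : realType) (X : metricType R) (Y : set X)
    (x : X) : set X :=
  [set y | Y y /\ mdist x y = dist_to x Y].

Definition diam (R : realType) (X : metricType R) (A : set X) : \bar R :=
  ereal_sup [set (mdist u v)%:E | u in A & v in A].

Definition strongly_contracting_set (R : realType) (X : metricType R) (C : R)
    (Y : set X) : Prop :=
  closed Y /\
  forall x y : X, mdist x y <= dist_to x Y ->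
    (diam (nearest_points Y x `|` nearest_points Y y) <= C%:E)%E.

Definition quasi_isometric_embedding_int (R : realType) (X : metricType R)
    (f : int -> X) : Prop :=
  exists lambda c : R,
    [/\ 1 <= lambda, 0 <= c
      & forall m n : int,
          `|m - n|%:~R / lambda - c <= mdist (f m) (f n) /\
          mdist (f m) (f n) <= lambda * `|m - n|%:~R + c].

Definition infinite_order_isometry (R : realType) (G : groupType)
    (X : metricType R) (act : G -> X -> X) (h : G) : Prop :=
  forall n : nat, (0 < n)%N -> exists x, act (h ^+ n)%g x <> x.

(* On a geodesic space the last condition does not depend on the point p. *)
Definition strongly_contracting (R : realType) (G : groupType)
    (X : metricType R) (act : G -> X -> X) (h : G) : Prop :=
  infinite_order_isometry act h /\
  exists p : X,
    quasi_isometric_embedding_int (fun n => act (zexpg h n) p) /\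
    exists C : R,
      strongly_contracting_set C (range (fun n => act (zexpg h n) p)).

(** * WPD elements and independence *)

Definition Stab (R : realType) (G : groupType) (X : metricType R)
    (act : G -> X -> X) (r : R) (x y : X) : set G :=
  [set g | mdist x (act g x) <= r /\ mdist y (act g y) <= r].

Definition WPD (R : realType) (G : groupType) (X : metricType R)
    (act : G -> X -> X) (f : G) : Prop :=
  forall (r : R) (x : X), 0 < r ->
    exists L : nat, finite_set (Stab act r x (act (f ^+ L)%g x)).

Definition independent (G : groupType) (h k : G) : Prop :=
  forall (m n : int) (g : G), m != 0 -> n != 0 ->
    ((zexpg h m) ^ g)%g <> zexpg k n.

(* Main.v *)
Require Import Defs.
From mathcomp Require Import all_boot all_order all_algebra.
From mathcomp Require Import all_classical all_reals all_analysis.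
From mathcomp Require Import ring lra zify.

Set Implicit Arguments.
Unset Strict Implicit.
Unset Printing Implicit Defensive.

Import Order.TTheory GRing.Theory Num.Theory.

Local Open Scope classical_set_scope.
Local Open Scope ring_scope.

(** Let [h] and [k] be the two contracting WPD elements, let [o] be a point of the
axis of [k] and let [D g] be the distance from [o] to [g o].  A change of base
point changes displacements by a bounded amount, so it is enough to bound, for
a small multiple [eps] of [n], the number of elements [g] of word length [n]
with [D g <= eps * n + c].  They turn out to be an exponentially small part of
the ball of radius [n] ([slow_sphere]); as the group has exponential growth
([exponential_growth]), the two growth rates differ ([rate_gap],
[gap_of_spheres]).

Walls.  Every translate [v] of the axis of [k] gives a wall: a point is to the
left or to the right of it when its projection to the translate comes before
one index or after a larger one.  Let [T g] be the largest length of a chain of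
walls separating [o] from [g o].  Then [T g <= D g + c], and chains obey a tree
like inequality ([common_chain]): some chain of about half of
[T x y + T x z - T y z] walls separates [x] from both [y] and [z].

Encoding.  A list of letters [w_0 .. w_q] is sent to the product
[w_0 f_0 w_1 f_1 .. w_q], where each [f_j] is one of five conjugates
[a_i k^M a_i^-1] of a large power of [k].  The independence of [h] and [k]
provides translates [a_i] such that any four points project close to the origin
of one of them ([align_family], [exists_ok]), and with a suitable choice of the
[i]'s the path of the product follows each of the inserted pieces.  An inserted piece is
then one of the translates followed by a geodesic to the product, and it is
known as soon as its rank among those is known.  Hence the product together
with a list of codes, made of a rank and a label [i], determines the letters
([encoding]).  With [h] the product of the letters before [w], the code at the
letter [w] is below a number [b h w] which is at most [cT * (1 + T w)] in all
cases, and bounded in terms of [E] alone when [D w + D (h * w) <= D h + E], that is, when [w] heads back towards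
the origin: the translates that have to be told apart then stay in a bounded
region.

Counting.  Give the code [c] a weight [theta c] with total weight at most [W].
By injectivity, the number of lists of [q.+1] letters of total length [n] times
the least weight of their codes is at most the size of the ball of radius
[n + cF * q.+1] times [W ^ q], hence at most [|B_n| * |B_cF| ^ q.+1 * W ^ q]
([weighted_count]).  Lists are produced by cutting a geodesic word for [g] at
one point of each of [m] intervals of length [l], so that [n] is about [m * l]
and there are [l ^ m] ways to cut.
 - If for every way of cutting the pieces have total [T] at most [rho * m],
   geometric weights cost a factor [(C * rho) ^ m], and the [l ^ m] cuts win
   because [l] is a large multiple of [rho] ([case1_count]).
 - Otherwise some way of cutting has large total [T] although [T g] is small.
   The walls entered by the pieces must be left again on the way, which forces
   the path to be at many times at a point lying between the origin and all its
   earlier points on the piece ([low_count]).  Cutting in addition at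
   [bb * m] of these [rho' * m] low positions gives binomially many lists, and
   the codes at low positions are bounded, so that every extra cut costs only a
   constant factor ([case2_count]).
In both cases these elements make up at most a proportion [C * 2 ^- (n / l)] of
the ball of radius [n]. *)

Lemma zexpg0 (G : groupType) (h : G) : zexpg h 0 = 1%g.
Proof. by []. Qed.

Lemma zexpgDn (G : groupType) (h : G) (m : int) (n : nat) :
  zexpg h (m + n%:Z) = (zexpg h m * h ^+ n)%g.
Proof.
elim: n => [|n IH]; first by rewrite addr0 expg0 mulg1.
have -> : m + n.+1%:Z = (m + n%:Z) + 1 by lia.
rewrite expgSr mulgA -IH.
case: (m + n%:Z) => k.
  by rewrite -PoszD addn1 /= expgSr.
case: k => [|k].
  have -> : Negz 0 + 1 = 0 by [].
  by rewrite /= expg1 mulVg.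
have -> : Negz k.+1 + 1 = Negz k by lia.
by rewrite /= [(h ^+ k.+2)%g]expgS invgM mulgVK.
Qed.

Lemma zexpgD (G : groupType) (h : G) (m n : int) :
  zexpg h (m + n) = (zexpg h m * zexpg h n)%g.
Proof.
case: n => n; first exact: zexpgDn.
have := zexpgDn h (m + Negz n) n.+1.
have -> : m + Negz n + n.+1%:Z = m by lia.
by move=> ->; rewrite /= mulgK.
Qed.

Lemma zexpgN (G : groupType) (h : G) (m : int) :
  zexpg h (- m) = ((zexpg h m)^-1)%g.
Proof.
apply: (@mulgI _ (zexpg h m)).
by rewrite -zexpgD subrr mulgV.
Qed.

Lemma choice_ex (A B : Type) (P : A -> B -> Prop) :
  (forall a, exists b, P a b) -> exists f : A -> B, forall a, P a (f a).
Proof. by move=> /choice [f Hf]; exists f. Qed.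

Lemma nat_ub (R : realType) (x : R) : exists N : nat, x <= N%:R.
Proof.
exists (Num.bound x); case: (leP 0 x) => x0.
  by apply: ltW; apply: archi_boundP.
by apply: (le_trans (ltW x0)).
Qed.

(** * Axes of contracting elements *)

Section Axis.
Variables (R : realType) (G : groupType) (X : metricType R) (act : G -> X -> X).
Hypothesis isoact : isometric_action act.

Local Notation d := (@mdist R X).

Lemma tri (x y z : X) : d x z <= d x y + d y z.
Proof. exact: metric_triangle. Qed.

Lemma dsym (x y : X) : d x y = d y x.
Proof. exact: metric_sym. Qed.

Lemma dge0 (x y : X) : 0 <= d x y.
Proof. exact: mdist_ge0. Qed.

Lemma dact g x y : d (act g x) (act g y) = d x y.
Proof. exact: (act_isometry isoact). Qed.

Lemma actM g h x : act (g * h)%g x = act g (act h x).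
Proof. exact: (act_mul isoact). Qed.

Lemma act1 x : act 1%g x = x.
Proof. exact: (act_one isoact). Qed.

Lemma actVK g x : act g^-1%g (act g x) = x.
Proof. by rewrite -actM mulVg act1. Qed.

Lemma actKV g x : act g (act g^-1%g x) = x.
Proof. by rewrite -actM mulgV act1. Qed.

Lemma dactV g x y : d (act g x) y = d x (act g^-1%g y).
Proof. by rewrite -(dact g x) actKV. Qed.

Definition orb (f : G) (p : X) (n : int) : X := act (zexpg f n) p.

Lemma orbD f p m n : orb f p (m + n) = act (zexpg f m) (orb f p n).
Proof. by rewrite /orb zexpgD actM. Qed.

Lemma dorb f p m n : d (orb f p m) (orb f p n) = d p (orb f p (n - m)).
Proof.
have -> : n = m + (n - m) by lia.
rewrite orbD dact; congr (d _ (orb _ _ _)); lia.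
Qed.

Definition nearest_index f p (x : X) (n : int) : Prop :=
  forall m, d x (orb f p n) <= d x (orb f p m).

(** What is used of a contracting quasi-geodesic orbit: [axis_far] is the part
of the quasi-isometry inequality that turns a bound on distances into a bound on
indices, and [axis_contr] expresses contraction by nearest orbit points. *)
Record axis (f : G) (p : X) (C : R) : Prop := Axis {
  axisC : 1 <= C;
  axis_far : forall r : R, exists N : nat, forall m n : int,
      d (orb f p m) (orb f p n) <= r -> `|m - n| <= N%:Z;
  axis_contr : forall x y m n, nearest_index f p x m -> nearest_index f p y n ->
      d x y <= d x (orb f p m) -> d (orb f p m) (orb f p n) <= C
}.

(** Orbit points at distance at most that of [orb f p 0] have bounded indices,
so the minimum is over a finite set. *)
Lemma exists_nearest_index f p C x : axis f p C -> exists n, nearest_index f p x n.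
Proof.
move=> ax.
have [N HN] := axis_far ax (2 * d x (orb f p 0)).
pose F (i : 'I_(N + N).+1) := d x (orb f p (i%:Z - N%:Z)).
have i0P : (N < (N + N).+1)%N by lia.
pose i0 := Ordinal i0P.
case: (@arg_minP _ _ _ i0 xpredT F isT) => i _ Hi.
exists (i%:Z - N%:Z) => m.
have [le0|lt0] := leP (d x (orb f p m)) (d x (orb f p 0)).
  have : d (orb f p m) (orb f p 0) <= 2 * d x (orb f p 0).
    have := tri (orb f p m) x (orb f p 0); rewrite (dsym (orb f p m) x); lra.
  move/HN; rewrite subr0 => mN.
  have jP : (absz (m + N%:Z)%R < (N + N).+1)%N by lia.
  have := Hi (Ordinal jP) isT; rewrite /F /=.
  have -> : (absz (m + N%:Z))%:Z - N%:Z = m by lia.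
  by [].
apply: le_trans (ltW lt0); have := Hi i0 isT; rewrite /F /=.
by rewrite subrr.
Qed.

Lemma axis_of_contracting_orbit f p :
  quasi_isometric_embedding_int (fun n => act (zexpg f n) p) ->
  (exists C : R,
     strongly_contracting_set C (range (fun n => act (zexpg f n) p))) ->
  exists C, axis f p C.
Proof.
move=> [lam [c [lam1 c0 qi]]] [C [_ sc]].
exists (Num.max C 1); split.
- by rewrite le_max lexx orbT.
- move=> r; have [N HN] := nat_ub (lam * (r + c)).
  exists N => m n mn.
  have [+ _] := qi m n.
  rewrite -(ler_int R) -/(orb f p m) -/(orb f p n) => h.
  apply: le_trans HN.
  have : `|m - n|%:~R / lam <= r + c by lra.
  rewrite ler_pdivrMr; last lra.
  by rewrite mulrC.
- have dist_to_near x m : nearest_index f p x m ->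
     dist_to x (range (fun n => act (zexpg f n) p)) = d x (orb f p m).
    move=> xm; apply/eqP; rewrite eq_le; apply/andP; split.
      apply: ge_inf; first by exists 0 => _ [y _ <-]; exact: dge0.
      by exists (orb f p m) => //; exists m.
    apply: lb_le_inf; first by exists (d x (orb f p m)), (orb f p m) => //; exists m.
    by move=> _ [_ [n _ <-] <-]; exact: xm.
  move=> x y m n xm yn xy.
  rewrite le_max; apply/orP; left.
  have := sc x y; rewrite (dist_to_near _ _ xm) => /(_ xy).
  rewrite -lee_fin; apply: le_trans; apply: ereal_sup_ubound => /=.
  exists (orb f p m); first by left; split; [exists m|rewrite (dist_to_near _ _ xm)].
  exists (orb f p n) => //.
  by right; split; [exists n|rewrite (dist_to_near _ _ yn)].
Qed.

End Axis.

(** * Projection to an axis *)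

Section AxisProj.
Variables (R : realType) (G : groupType) (X : metricType R) (act : G -> X -> X).
Hypotheses (geoX : geodesic_space X) (isoact : isometric_action act).
Variables (f : G) (p : X) (C : R) (ax : axis act f p C).
Variable ix : X -> int.
Hypothesis Hix : forall x, nearest_index act f p x (ix x).

Local Notation d := (@mdist R X).
Local Notation orb := (orb act f p).
Local Notation pr x := (orb (ix x)).

Lemma pr_contr x y : d x y <= d x (pr x) -> d (pr x) (pr y) <= C.
Proof. by apply: (axis_contr ax). Qed.

(** Two points with distant projections are joined by geodesics passing near
both projections.  Walk along the geodesic from [x], each time by the current
distance to the orbit: contraction moves the projection by at most [C] per step.
As long as the walk stays at distance [4 * C] from the orbit it moves away from
[x] faster than the projection moves, so it has to come close to the orbit
within three steps, and then [pr x] is within [8 * C] of the geodesic. *)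
Lemma near_projection x y : 16 * C < d (pr x) (pr y) ->
  d x (pr x) + d (pr x) y <= d x y + 16 * C.
Proof.
move=> Dbig.
have C1 := axisC ax.
have [gam [g0 gl giso]] := geoX x y.
set l := d x y in giso gl *.
pose al t := d (gam t) (pr (gam t)).
have al0 t : 0 <= al t by exact: dge0.
pose b := d y (pr y).
(* t i is the time reached after i steps of the walk, and it stops near the
   orbit or near y *)
pose t := fix t (i : nat) : R := if i is j.+1 then t j + al (t j) else 0.
pose stop i := (al (t i) < 4 * C) || (l - t i <= Num.max (al (t i)) b).
have l0 : 0 <= l by exact: dge0.
have walk m : (forall i, (i < m)%N -> ~~ stop i) ->
   [/\ 0 <= t m, t m <= l, d (pr x) (pr (gam (t m))) <= (m%:R + 1) * C &
     (0 < m)%N -> d x (pr x) + (m%:R - 1) * (4 * C) <= t m].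
  elim: m => [|m IH] Hm.
    split=> //=; rewrite g0 add0r mul1r; apply: pr_contr; rewrite mdistxx; exact: dge0.
  have [t0 tl dm tm] := IH (fun i im => Hm i (ltnW im)).
  have := Hm m (ltnSn m); rewrite /stop negb_or -leNgt -ltNge => /andP[alm].
  rewrite gt_max => /andP[lm _].
  have ts0 : 0 <= t m + al (t m) by rewrite addr_ge0.
  have tsl : t m + al (t m) <= l by lra.
  have dstep : d (gam (t m)) (gam (t m + al (t m))) = al (t m).
    rewrite giso ?in_itv /= ?t0 ?tl ?ts0 ?tsl //.
    have -> : t m - (t m + al (t m)) = - al (t m) by lra.
    by rewrite normrN ger0_norm.
  split=> //=.
  - have := tri (pr x) (pr (gam (t m))) (pr (gam (t m + al (t m)))).
    have : d (pr (gam (t m))) (pr (gam (t m + al (t m)))) <= C.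
      by apply: pr_contr; rewrite dstep.
    rewrite -[m.+1%:R]natr1; lra.
  - move=> _; case: m {IH Hm} t0 tl dm tm alm {lm ts0 tsl dstep} => [|m] _ _ _.
      by rewrite /= /al g0 => _ _; lra.
    move=> /(_ isT); rewrite -[m.+2%:R]natr1 -[m.+1%:R]natr1 -/(t m.+1).
    set u := t m.+1; set v := al u => tm alm.
    lra.
have exstop : exists i, stop i.
  apply: contrapT => nst.
  have nst' i : ~~ stop i by apply/negP => si; apply: nst; exists i.
  have [N HN] := nat_ub (l + 1).
  have [_ tl _ /(_ isT)] := walk N.+1 (fun i _ => nst' i).
  rewrite -natr1; have := dge0 x (pr x).
  have : (N%:R : R) * 1 <= N%:R * (4 * C) by apply: ler_wpM2l => //; lra.
  lra.
case: (ex_minnP exstop) => m sm mmin.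
have nst i : (i < m)%N -> ~~ stop i.
  by move=> im; apply/negP => si; have := mmin _ si; rewrite leqNgt im.
have [t0 tl dm tm] := walk m nst.
have dxz : d x (gam (t m)) = t m.
  rewrite -{1}g0 giso ?in_itv /= ?lexx ?t0 ?tl ?l0 //.
  by rewrite sub0r normrN ger0_norm.
have dzy : d (gam (t m)) y = l - t m.
  rewrite -{1}gl giso ?in_itv /= ?lexx ?t0 ?tl ?l0 //.
  by rewrite distrC ger0_norm //; lra.
have [alm|alm] := ltP (al (t m)) (4 * C).
  (* the walk has come close to the orbit *)
  have m3 : (m <= 3)%N.
    rewrite leqNgt; apply/negP => m4.
    have := tm (leq_trans (isT : (0 < 4)%N) m4).
    have := tri x (pr x) (gam (t m)).
    have := tri (pr x) (pr (gam (t m))) (gam (t m)).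
    rewrite (dsym (pr (gam (t m))) (gam (t m))) dxz -/(al _).
    have m4' : (4 : R) <= m%:R by rewrite (ler_nat R 4 m).
    have : 0 <= (m%:R - 4) * C by apply: mulr_ge0; lra.
    lra.
  have m3' : (m%:R : R) <= 3 by rewrite (ler_nat R m 3).
  have zpx : d (pr x) (gam (t m)) <= 8 * C.
    have := tri (pr x) (pr (gam (t m))) (gam (t m)).
    rewrite (dsym (pr (gam (t m))) (gam (t m))) -/(al _).
    have : 0 <= (3 - m%:R) * C by apply: mulr_ge0; lra.
    lra.
  have := tri x (gam (t m)) (pr x); have := tri (pr x) (gam (t m)) y.
  rewrite dxz dzy (dsym (gam _) (pr x)); lra.
(* the walk has come close to the end point: impossible *)
exfalso.
have : l - t m <= Num.max (al (t m)) b.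
  by move: sm; rewrite /stop ltNge alm.
have dzy' : l - t m <= Num.max (al (t m)) b -> d (pr (gam (t m))) (pr y) <= C.
  rewrite le_max => /orP[h|h].
    by apply: pr_contr; rewrite dzy.
  by rewrite dsym; apply: pr_contr; rewrite dsym dzy.
move=> /dzy' {}dzy'.
have Dm : d (pr x) (pr y) <= (m%:R + 2) * C.
  have := tri (pr x) (pr (gam (t m))) (pr y); lra.
have m3 : (m <= 3)%N.
  rewrite leqNgt; apply/negP => m4.
  case: m {sm mmin t0 tl tm dxz dzy dzy' alm} m4 nst dm Dm => // m m3 nst dm Dm.
  have [t0 tl _ /(_ (ltnW (ltnW m3)))] := walk m (fun i im => nst i (ltnW im)).
  have := nst m (ltnSn m); rewrite /stop negb_or -ltNge gt_max => /andP[_ /andP[_ lb]].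
  have := tri x (pr x) y; have := tri (pr x) (pr y) y.
  rewrite (dsym (pr y) y) -/l -/b.
  have m3' : (3 : R) <= m%:R by rewrite (ler_nat R 3 m).
  have : 0 <= (m%:R - 3) * C by apply: mulr_ge0; lra.
  move: Dm; rewrite -[m.+1%:R]natr1; lra.
have m3' : (m%:R : R) <= 3 by rewrite (ler_nat R m 3).
have : 0 <= (3 - m%:R) * C by apply: mulr_ge0; lra.
lra.
Qed.

Lemma pr_lip x y : d (pr x) (pr y) <= 3 * d x y + 32 * C.
Proof.
have C1 := axisC ax.
have d0 := dge0 x y.
have [|big] := leP (d (pr x) (pr y)) (16 * C); first lra.
have h1 := near_projection big; rewrite dsym in big; have h2 := near_projection big.
have := tri (pr x) x (pr y); have := tri x y (pr y).
move: h1 h2; rewrite (dsym (pr x) x) (dsym y x).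
have := dge0 x (pr x); have := dge0 (pr x) y; have := dge0 (pr y) x.
lra.
Qed.

Lemma orb_steps_bounded (N : nat) : exists r, 0 <= r /\
  forall m n : int, `|m - n| <= N%:Z -> d (orb m) (orb n) <= r.
Proof.
exists (N%:R * d p (act f p)); split; first by rewrite mulr_ge0 ?dge0.
have step (k : nat) (m : int) : d (orb m) (orb (m + k%:Z)) <= k%:R * d p (act f p).
  elim: k => [|k IH]; first by rewrite addr0 mdistxx mul0r.
  apply: le_trans (tri _ (orb (m + k%:Z)) _) _.
  have -> : m + k.+1%:Z = (m + k%:Z) + 1 by lia.
  have -> : d (orb (m + k%:Z)) (orb (m + k%:Z + 1)) = d p (act f p).
    rewrite (dorb isoact).
    have -> : m + k%:Z + 1 - (m + k%:Z) = 1 by lia.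
    by rewrite /orb /= expg1.
  by rewrite -natr1 mulrDl mul1r lerD2r.
have scale_le k : (k <= N)%N -> k%:R * d p (act f p) <= N%:R * d p (act f p).
  by move=> kN; rewrite ler_wpM2r ?dge0 // ler_nat.
move=> m n mn.
have [le|lt] := leP m n.
  have -> : n = m + (absz (n - m))%:Z by lia.
  by apply: le_trans (step _ _) _; apply: scale_le; lia.
rewrite dsym; have -> : m = n + (absz (n - m))%:Z by lia.
by apply: le_trans (step _ _) _; apply: scale_le; lia.
Qed.

Lemma ix_lip (r : R) : exists N : nat, forall x y, d x y <= r ->
  `|ix x - ix y| <= N%:Z.
Proof.
have [N HN] := axis_far ax (3 * r + 32 * C).
exists N => x y xy; apply: HN; apply: le_trans (pr_lip x y) _; lra.
Qed.

Lemma ix_orb : exists N : nat, forall n : int, `|ix (orb n) - n| <= N%:Z.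
Proof.
have [N HN] := axis_far ax 0.
exists N => n; apply: HN.
by rewrite dsym; apply: le_trans (Hix (orb n) n) _; rewrite mdistxx.
Qed.

Lemma nearest_index_shift x n m : nearest_index act f p x n ->
  nearest_index act f p (act (zexpg f m) x) (m + n).
Proof.
move=> xn j; rewrite (orbD isoact) (dact isoact).
apply: le_trans (xn (j - m)) _.
have -> : orb j = act (zexpg f m) (orb (j - m)).
  by rewrite -(orbD isoact); congr orb; lia.
by rewrite (dact isoact).
Qed.

Lemma ix_shift : exists N : nat, forall x m,
  `|ix (act (zexpg f m) x) - (m + ix x)| <= N%:Z.
Proof.
have [N HN] := axis_far ax C.
exists N => x m; apply: HN.
apply: (axis_contr ax (Hix _) (nearest_index_shift m (Hix x))).
rewrite mdistxx; exact: dge0.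
Qed.

(** A geodesic whose end points project well before and well after [n] comes
near the orbit point [n]: by [ix_lip] some point [z] of the geodesic projects
close to [n], and [near_projection] applied from [z] to each end point leaves no
room for [z] to be far from its projection. *)
Lemma geodesic_passes : exists (D : nat) (r : R), 0 <= r /\ forall x y gam (n : int),
  gam 0 = x -> gam (d x y) = y ->
  (forall s t, s \in `[0, d x y] -> t \in `[0, d x y] ->
     d (gam s) (gam t) = `|s - t|) ->
  ix x + D%:Z <= n -> n <= ix y - D%:Z ->
  exists2 t, t \in `[0, d x y] & d (gam t) (orb n) <= r.
Proof.
have C1 := axisC ax.
have [J HJ] := ix_lip 1.
have [D' HD'] := axis_far ax (16 * C).
have [r0 [r00 Hr0]] := orb_steps_bounded J.
exists (D' + J).+1, (16 * C + r0); split; first lra.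
move=> x y gam n g0 gl giso nx ny.
set l := d x y in gl giso *.
have l0 : 0 <= l by exact: dge0.
pose q (i : nat) := gam (Num.min i%:R l).
have qin (i : nat) : Num.min i%:R l \in `[0, l].
  by rewrite in_itv /= ge_min lexx orbT le_min l0 ler0n.
have q0 : q 0%N = x by rewrite /q /= (min_idPl l0).
have [N HN] := nat_ub l.
have qN : q N = y by rewrite /q /= (min_idPr HN).
have qstep i : `|ix (q i) - ix (q i.+1)| <= J%:Z.
  apply: HJ; rewrite /q giso // -natr1.
  have [h1|h1] := leP (i%:R : R) l; have [h2|h2] := leP (i%:R + 1) l.
  - rewrite ler_norml; lra.
  - rewrite ler_norml; lra.
  - rewrite ler_norml; lra.
  - rewrite ler_norml; lra.
have exi : exists i, n <= ix (q i) by exists N; rewrite qN; lia.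
case: (ex_minnP exi) => i ni imin.
have ix_q : `|ix (q i) - n| <= J%:Z.
  case: i ni imin => [|i] ni imin; first by rewrite q0 in ni; lia.
  have : ix (q i) < n by rewrite ltNge; apply/negP => /imin; rewrite ltnn.
  have := qstep i; lia.
exists (Num.min i%:R l) => //.
rewrite -/(q i).
set z := q i in ix_q *.
have zin : d x z + d z y <= l.
  rewrite -g0 -gl /z /q !giso // ?qin ?in_itv /= ?lexx ?l0 //.
  have := qin i; rewrite in_itv /= => /andP[h1 h2].
  rewrite sub0r normrN ger0_norm // ler0_norm; lra.
have bx : 16 * C < d (pr z) (pr x).
  by rewrite ltNge; apply/negP => /HD'; lia.
have by_ : 16 * C < d (pr z) (pr y).
  by rewrite ltNge; apply/negP => /HD'; lia.
have := near_projection bx; have := near_projection by_.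
have := tri x (pr z) y; have := tri z (pr z) (orb n).
have := Hr0 _ _ ix_q; rewrite (dsym z x) (dsym x (pr z)) -/l; lra.
Qed.

(** The point [q] is between [x] and [y] up to the defect [r]. *)
Definition btw (r : R) (x q y : X) : Prop := d x q + d q y <= d x y + r.

Lemma btw_sym r x q y : btw r x q y -> btw r y q x.
Proof. by rewrite /btw (dsym y q) (dsym q x) (dsym y x) addrC. Qed.

Lemma orbit_between : exists (D : nat) (r : R), 0 <= r /\ forall x y (n : int),
  ix x + D%:Z <= n -> n <= ix y - D%:Z -> btw r x (orb n) y.
Proof.
have [D [r [r0 H]]] := geodesic_passes.
exists D, (2 * r); split; first lra.
move=> x y n nx ny.
have [gam [g0 gl giso]] := geoX x y.
have [t tin tn] := H x y gam n g0 gl giso nx ny.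
have := giso 0 t; have := giso t (d x y).
rewrite tin !in_itv /= !lexx !dge0 => /(_ isT isT) h2 /(_ isT isT) h1.
move: tin h1 h2; rewrite in_itv /= g0 gl => /andP[t0 tl].
rewrite sub0r normrN ger0_norm // => h1; rewrite ler0_norm; last lra.
move=> h2; rewrite /btw.
have := tri x (gam t) (orb n); have := tri (orb n) (gam t) y.
rewrite (dsym (orb n) (gam t)); lra.
Qed.

(** Otherwise the geodesics from [x] to [q] and from [y] to [q] both pass the
orbit points between [n] and [ix q]; as [q] lies between [x] and [y], it is then
close to all these points, also to those far from its projection. *)
Lemma ix_mono_le (s : R) : exists N : nat, forall x q y (n : int), btw s x q y ->
  ix x <= n -> ix y <= n -> ix q <= n + N%:Z.
Proof.
have [D [r [r0 H]]] := orbit_between.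
have [N HN] := axis_far ax (4 * r + 2 * `|s|).
exists (N + D + D + 1)%N => x q y n xqy xn yn.
rewrite leNgt; apply/negP => big.
have near m : n + D%:Z <= m -> m <= ix q - D%:Z -> d q (orb m) <= r + `|s|.
  move=> nm mq.
  have h1 : btw r x (orb m) q by apply: H; lia.
  have h2 : btw r y (orb m) q by apply: H; lia.
  move: xqy h1 h2; rewrite /btw (dsym (orb m) q) (dsym q y).
  have := tri x (orb m) y; rewrite (dsym (orb m) y).
  have := ler_norm s; have := normr_ge0 s; lra.
have n1 : d q (orb (n + D%:Z)) <= r + `|s| by apply: near; lia.
have n2 : d q (orb (ix q - D%:Z)) <= r + `|s| by apply: near; lia.
have := HN (n + D%:Z) (ix q - D%:Z).
have := tri (orb (n + D%:Z)) q (orb (ix q - D%:Z)).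
have := normr_ge0 s.
rewrite (dsym _ q) => h0 h3 h4.
have : `|n + D%:Z - (ix q - D%:Z)| <= N%:Z by apply: h4; lra.
lia.
Qed.

Lemma ix_mono_ge (s : R) : exists N : nat, forall x q y (n : int), btw s x q y ->
  n <= ix x -> n <= ix y -> n - N%:Z <= ix q.
Proof.
have [D [r [r0 H]]] := orbit_between.
have [N HN] := axis_far ax (4 * r + 2 * `|s|).
exists (N + D + D + 1)%N => x q y n xqy xn yn.
rewrite leNgt; apply/negP => big.
have near m : ix q + D%:Z <= m -> m <= n - D%:Z -> d q (orb m) <= r + `|s|.
  move=> nm mq.
  have h1 : btw r q (orb m) x by apply: H; lia.
  have h2 : btw r q (orb m) y by apply: H; lia.
  move: xqy h1 h2; rewrite /btw (dsym q x) (dsym (orb m) x).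
  have := tri x (orb m) y.
  have := ler_norm s; have := normr_ge0 s; lra.
have n1 : d q (orb (n - D%:Z)) <= r + `|s| by apply: near; lia.
have n2 : d q (orb (ix q + D%:Z)) <= r + `|s| by apply: near; lia.
have := HN (n - D%:Z) (ix q + D%:Z).
have := tri (orb (n - D%:Z)) q (orb (ix q + D%:Z)).
have := normr_ge0 s.
rewrite (dsym _ q) => h0 h3 h4.
have : `|n - D%:Z - (ix q + D%:Z)| <= N%:Z by apply: h4; lra.
lia.
Qed.

Lemma orb_qconvex (s : R) m n q : btw s (orb m) q (orb n) ->
  d q (pr q) <= 16 * C + `|s|.
Proof.
have C1 := axisC ax.
have near k : d q (pr q) + d (pr q) (orb k) <= d q (orb k) + 16 * C.
  have prk : d (orb k) (pr (orb k)) <= 0.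
    by apply: le_trans (Hix (orb k) k) _; rewrite mdistxx.
  have pk := tri (pr q) (pr (orb k)) (orb k).
  have := Hix q k.
  have [|big] := leP (d (pr q) (pr (orb k))) (16 * C).
    move: pk prk; rewrite (dsym (pr (orb k))); lra.
  have := near_projection big; lra.
have := near m; have := near n; rewrite /btw.
have := tri (orb m) (pr q) (orb n).
rewrite (dsym (orb m) q) (dsym (orb m) (pr q)).
have := ler_norm s; have := normr_ge0 s; lra.
Qed.

End AxisProj.

(** * Two independent axes *)

Section TwoAxes.
Variables (R : realType) (G : groupType) (X : metricType R) (act : G -> X -> X).
Hypotheses (geoX : geodesic_space X) (isoact : isometric_action act).
Variables (f1 f2 : G) (p1 p2 : X) (C1 C2 : R).
Hypotheses (ax1 : axis act f1 p1 C1) (ax2 : axis act f2 p2 C2).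
Variables (ix1 ix2 : X -> int).
Hypothesis Hix1 : forall x, nearest_index act f1 p1 x (ix1 x).
Hypothesis Hix2 : forall x, nearest_index act f2 p2 x (ix2 x).
Hypothesis nocommon : forall m n : int, m != 0 -> zexpg f1 m <> zexpg f2 n.
Hypothesis wpd1 : WPD act f1.

Local Notation d := (@mdist R X).
Local Notation orb1 := (orb act f1 p1).
Local Notation orb2 := (orb act f2 p2).

Definition nearorb2 (r : R) (x : X) : Prop := exists b, d x (orb2 b) <= r.

Lemma finite_int_ball (N : nat) : finite_set [set s : int | `|s| <= N%:Z].
Proof.
apply: (@sub_finite_set _ _ ((fun i : nat => i%:Z - N%:Z) @` `I_(N + N).+1)).
  by move=> s /= sN; exists (absz (s + N%:Z)); lia.
exact: finite_image (finite_II _).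
Qed.

Lemma finite_int_bounded (A : set int) : finite_set A ->
  exists B : nat, forall m, A m -> `|m| <= B%:Z.
Proof.
move=> /finite_seqP[F ->]; exists (\sum_(i <- F) absz i)%N => m mF.
have : (absz m <= \sum_(i <- F) absz i)%N by rewrite (big_rem _ mF) /= leq_addr.
lia.
Qed.

(** Points of the first axis that are close to the second one at two times with
a fixed gap [L].  If [n] is such a time, [f2 ^ (- b n) * f1 ^ n] moves [p1] and
[f1 ^ L p1] close to two fixed points, so two such elements differ by an element
of a finite stabiliser; they are distinct for distinct [n] because the two
groups have no common power. *)
Lemma finite_close (r : R) : exists L : nat,
  finite_set [set n : int | nearorb2 r (orb1 n) /\ nearorb2 r (orb1 (n + L%:Z))].
Proof.
have rpos : 0 < 2 * `|r| + 1 by have := normr_ge0 r; lra.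
have [L finS] := wpd1 p1 rpos.
exists L.
have [N HN] := axis_far ax2 (2 * r + d p1 (orb1 L%:Z)).
pose Ns (s : int) : set int := [set n | exists b,
  d (orb1 n) (orb2 b) <= r /\ d (orb1 (n + L%:Z)) (orb2 (b + s)) <= r].
apply: (@sub_finite_set _ _ (\bigcup_(s in [set s : int | `|s| <= N%:Z]) Ns s)).
  move=> n /= [[b nb] [b' nb']].
  exists (b' - b) => /=.
    rewrite distrC; apply: HN.
    have := tri (orb2 b) (orb1 n) (orb2 b'); have := tri (orb1 n) (orb1 (n + L%:Z)) (orb2 b').
    rewrite (dsym (orb2 b) (orb1 n)) (dorb isoact f1 p1 n).
    have -> : n + L%:Z - n = L%:Z by lia.
    lra.
  exists b; split=> //; by have -> : b + (b' - b) = b' by lia.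
apply: bigcup_finite => [|s _]; first exact: finite_int_ball.
have [b Hb] : {b : int -> int & forall n, Ns s n ->
   d (orb1 n) (orb2 (b n)) <= r /\ d (orb1 (n + L%:Z)) (orb2 (b n + s)) <= r}.
  apply: (@choice _ _ (fun n b => Ns s n -> d (orb1 n) (orb2 b) <= r /\ d (orb1 (n + L%:Z)) (orb2 (b + s)) <= r)) => n.
  have [[c Hc]|nn] := pselect (Ns s n); first by exists c.
  by exists 0.
have [->|/set0P [n0 Hn0]] := eqVneq (Ns s) set0; first exact: finite_set0.
pose e n := (zexpg f2 (- b n) * zexpg f1 n)%g.
pose phi n := ((e n0)^-1 * e n)%g.
have phi_inj : injective phi.
  move=> n n' /mulgI; rewrite /e => h.
  have h2 : zexpg f1 (n - n') = zexpg f2 (b n - b n').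
    rewrite !zexpgD zexpgN; apply: (@mulIg _ (zexpg f1 n')); rewrite mulgVK.
    apply: (@mulgI _ (zexpg f2 (- b n))); rewrite h.
    by rewrite !mulgA -zexpgD addNr zexpg0 mul1g.
  have [/eqP|ne] := eqVneq (n - n') 0; first by rewrite subr_eq0 => /eqP.
  by have := nocommon ne h2.
apply: (@sub_finite_set _ _ (phi @^-1` (Stab act (2 * `|r| + 1) p1 (act (f1 ^+ L)%g p1)))).
  have mv n (m c : int) : d (orb1 (n + m)) (orb2 (b n + c)) <= r ->
      d (act (e n) (orb1 m)) (orb2 c) <= r.
    rewrite /e (actM isoact) -(orbD isoact) (dactV isoact) -zexpgN opprK -(orbD isoact).
    by [].
  move=> n nNs; have [h1 h2] := Hb _ nNs; have [h3 h4] := Hb _ Hn0.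
  have r0 := ler_norm r; have r1 := normr_ge0 r.
  have key (m c : int) : d (orb1 (n + m)) (orb2 (b n + c)) <= r ->
     d (orb1 (n0 + m)) (orb2 (b n0 + c)) <= r ->
     d (orb1 m) (act (phi n) (orb1 m)) <= 2 * `|r| + 1.
    move=> /mv k1 /mv k2; rewrite /phi (actM isoact) dsym (dactV isoact) invgK.
    have := tri (act (e n) (orb1 m)) (orb2 c) (act (e n0) (orb1 m)).
    rewrite (dsym (orb2 c)); lra.
  split; last by apply: (key L%:Z s).
  have := key 0 0; rewrite !addr0 /orb zexpg0 (act1 isoact); exact.
exact: finite_preimage (fun x y _ _ => @phi_inj x y) finS.
Qed.

(** If the second axis had an unbounded projection to the first one, the first
axis would stay close to the second one for a long time, against [finite_close].
*)
Lemma ix_bounded_on_orb : exists B : nat, forall n, `|ix1 (orb2 n)| <= B%:Z.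
Proof.
have [D [r [r0 pass1]]] := orbit_between geoX isoact ax1 Hix1.
have [L finF] := finite_close (16 * C2 + `|r|).
have [B0 HB0] := finite_int_bounded finF.
have near m n : btw r (orb2 0) (orb1 m) (orb2 n) ->
    nearorb2 (16 * C2 + `|r|) (orb1 m).
  move=> h; exists (ix2 (orb1 m)).
  exact: (orb_qconvex geoX ax2 Hix2 h).
pose a := ix1 (orb2 0).
exists (absz a + D + D + L + B0 + 10)%N => n.
rewrite ler_norml; apply/andP; split; rewrite leNgt; apply/negP => big.
- pose m0 : int := - (absz a + D + B0 + L + 2)%:Z.
  have : `|m0| <= B0%:Z.
    apply: HB0; split; apply: (@near _ n); apply: btw_sym; apply: pass1; rewrite -/a /m0; lia.
  rewrite /m0; lia.
- pose m0 : int := (absz a + D + B0 + 2)%:Z.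
  have : `|m0| <= B0%:Z.
    apply: HB0; split; apply: (@near _ n); apply: pass1; rewrite -/a /m0; lia.
  rewrite /m0; lia.
Qed.

End TwoAxes.

Section Align.
Variables (R : realType) (G : groupType) (X : metricType R) (act : G -> X -> X).
Hypotheses (geoX : geodesic_space X) (isoact : isometric_action act).
Variables (f1 f2 : G) (p1 p2 : X) (C1 C2 : R).
Hypotheses (ax1 : axis act f1 p1 C1) (ax2 : axis act f2 p2 C2).
Variables (ix1 ix2 : X -> int).
Hypothesis Hix1 : forall x, nearest_index act f1 p1 x (ix1 x).
Hypothesis Hix2 : forall x, nearest_index act f2 p2 x (ix2 x).
Hypotheses (wpd1 : WPD act f1) (wpd2 : WPD act f2).
Hypothesis indep : independent f1 f2.

Local Notation d := (@mdist R X).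
Local Notation orb1 := (orb act f1 p1).
Local Notation orb2 := (orb act f2 p2).

Lemma axis_infinite f p C (ax : axis act f p C) (m : int) :
  m != 0 -> zexpg f m <> 1%g.
Proof.
move=> m0 fm.
have [N HN] := axis_far ax 0.
have pw (j : nat) : zexpg f (m * j%:Z) = 1%g.
  elim: j => [|j IH]; first by rewrite mulr0.
  have -> : m * j.+1%:Z = m * j%:Z + m by lia.
  by rewrite zexpgD IH fm mulg1.
have : `|m * N.+1%:Z - 0| <= N%:Z.
  by apply: HN; rewrite /orb pw zexpg0 mdistxx.
rewrite subr0 normrM; have : 1 <= `|m| by lia.
nia.
Qed.

Lemma indep_nocommon : forall m n : int, m != 0 -> zexpg f1 m <> zexpg f2 n.
Proof.
move=> m n m0; have [->|n0] := eqVneq n 0.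
  by rewrite zexpg0; exact: (axis_infinite ax1).
by have := indep (g := 1%g) m0 n0; rewrite conjg1.
Qed.

Lemma indep_nocommon_sym : forall m n : int, m != 0 -> zexpg f2 m <> zexpg f1 n.
Proof.
move=> m n m0; have [->|n0] := eqVneq n 0.
  by rewrite zexpg0; exact: (axis_infinite ax2).
by move=> h; apply: (indep_nocommon n0 (esym h)).
Qed.

(** All points between [x] and its projection [z] to axis 2 project near [z]; if
[x] also projected far along axis 1, a geodesic from [z] to [x] would pass
points of axis 1, which have bounded projections to axis 2. *)
Lemma far_on_one_axis : exists K B : nat, forall x, K%:Z < `|ix2 x| -> `|ix1 x| <= B%:Z.
Proof.
have [B1 HB1] := ix_bounded_on_orb geoX isoact ax1 ax2 Hix1 Hix2 indep_nocommon wpd1.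
have [B2 HB2] := ix_bounded_on_orb geoX isoact ax2 ax1 Hix2 Hix1 indep_nocommon_sym wpd2.
have [D [r [r0 pass1]]] := orbit_between geoX isoact ax1 Hix1.
have C21 := axisC ax2.
have [N HN] := axis_far ax2 (16 * C2 + r).
exists (B2 + N)%N, (B1 + D + D)%N => x Kx.
have key n : btw r (orb2 (ix2 x)) (orb1 n) x -> False.
  set z := orb2 (ix2 x); set y := orb1 n; rewrite /btw => zyx.
  have xz : d x z <= d x (orb2 (ix2 y)) := Hix2 x _.
  have zz : d z (orb2 (ix2 z)) <= 0.
    by apply: le_trans (Hix2 z (ix2 x)) _; rewrite mdistxx.
  have dz : d (orb2 (ix2 y)) z <= 16 * C2 + r.
    have t1 := tri x y (orb2 (ix2 y)).
    have t2 := tri (orb2 (ix2 y)) (orb2 (ix2 z)) z.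
    move: zyx; rewrite (dsym z x) (dsym y x) (dsym z y) => zyx.
    move: zz; rewrite (dsym z) => zz.
    have [|big] := leP (d (orb2 (ix2 y)) (orb2 (ix2 z))) (16 * C2); first lra.
    have := near_projection geoX ax2 Hix2 big; lra.
  have := HN _ _ dz; have := HB2 n; rewrite -/y; lia.
rewrite ler_norml; apply/andP; split; rewrite leNgt; apply/negP => big.
- apply: (key (- (B1 + D)%N%:Z)); apply: btw_sym; apply: pass1; last by have := HB1 (ix2 x); lia.
  lia.
- by apply: (key (B1 + D)%N%:Z); apply: pass1; have := HB1 (ix2 x); lia.
Qed.

(** The translates are those of axis 2 by the sparse powers [f1 ^ (T * i)]: a
point projecting far along the [i]-th one projects to axis 1 near [T * i]. *)
Lemma align_family : exists (K : nat) (a : nat -> G), forall x i j,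
  K%:Z < `|ix2 (act (a i)^-1%g x)| -> K%:Z < `|ix2 (act (a j)^-1%g x)| -> i = j.
Proof.
have [K [B HB]] := far_on_one_axis.
have [c Hc] := ix_shift isoact ax1 Hix1.
pose T : nat := (2 * (B + c)).+1.
exists K, (fun i => zexpg f1 (T * i)%N%:Z) => x i j hi hj.
have key k : K%:Z < `|ix2 (act (zexpg f1 (T * k)%N%:Z)^-1%g x)| ->
    `|ix1 x - (T * k)%N%:Z| <= (B + c)%:Z.
  move=> /HB; rewrite -zexpgN; have := Hc x (- (T * k)%N%:Z); lia.
have := key _ hi; have := key _ hj; rewrite /T; nia.
Qed.

End Align.

(** * Chains of walls *)

Section Walls.
Variables (R : realType) (X : metricType R) (W : choiceType).
Variables (Lw Rw : W -> X -> Prop) (flip : W -> W) (mid : W -> X) (r : R).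
(* a wall has two disjoint sides, exchanged by flip, and geodesics from one to
   the other pass near its middle point; by Wquad, two walls do not cut the
   space into four nonempty regions *)
Hypothesis r0 : 0 <= r.
Hypothesis LRdisj : forall u p, Lw u p -> Rw u p -> False.
Hypothesis flipL : forall u p, Lw (flip u) p <-> Rw u p.
Hypothesis flipR : forall u p, Rw (flip u) p <-> Lw u p.
Hypothesis Wpass : forall u x y, Lw u x -> Rw u y -> btw r x (mid u) y.
Hypothesis Wsep : forall u q, Lw u q \/ Rw u q -> r + 1 < mdist (mid u) q.
Hypothesis Wquad : forall u w x y z p, Lw u x -> Lw w x -> Rw u y -> Lw w y ->
  Lw u z -> Rw w z -> Rw u p -> Rw w p -> False.

Local Notation d := (@mdist R X).

(** The wall [u] comes before the wall [w]: the left side of [w] and the right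
side of [u] cover the space. *)
Definition wlt (u w : W) : bool := `[< forall p, Rw u p \/ Lw w p >].

Lemma wltP u w p : wlt u w -> ~ Rw u p -> Lw w p.
Proof. by move=> /asboolP /(_ p) []. Qed.

Definition chain (x y : X) (s : seq W) : Prop :=
  pairwise wlt s /\ forall u, u \in s -> Lw u x /\ Rw u y.

(** A geodesic from [x] to [y] passes near the middle points of the walls in
order, and consecutive middle points contribute at least 1 to its length. *)
Lemma chain_size x y s : chain x y s -> (size s)%:R <= d x y + (r + 1).
Proof.
have main u s' : chain x y (u :: s') -> (size s')%:R <= d (mid u) y.
  elim: s' u => [|w s' IH] u [ps Hs]; first exact: dge0.
  have [Lux Ruy] := Hs u (mem_head _ _).
  have [Lwx Rwy] := Hs w (mem_behead (s := u :: w :: s') (mem_head _ _)).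
  have cw : chain x y (w :: s').
    split; first by move: ps => /= /andP[_ ->].
    by move=> v vs; apply: Hs; rewrite inE vs orbT.
  have := IH w cw; rewrite /= -[(size s').+1%:R]natr1 => h.
  have uw : wlt u w by move: ps => /= /andP[/andP[->]].
  have nR : ~ Rw u (mid u).
    move=> h1; have := Wsep (or_intror h1); rewrite mdistxx => h2; have := r0; lra.
  have Lm := wltP uw nR.
  have := Wpass Lm Rwy; rewrite /btw.
  have := Wsep (or_introl Lm); rewrite (dsym (mid w) (mid u)). lra.
case: s => [|u s] c.
  have := dge0 x y; have := r0; rewrite /=; lra.
have := main _ _ c; rewrite /= -[(size s).+1%:R]natr1.
have [Lux Ruy] := c.2 u (mem_head _ _).
have := Wpass Lux Ruy; rewrite /btw; have := dge0 x (mid u); lra.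
Qed.

Lemma exists_wall_distance : exists T : X -> X -> nat, forall x y,
  (forall s, chain x y s -> (size s <= T x y)%N) /\
  (exists2 s, chain x y s & size s = T x y).
Proof.
suff H x : exists Tx : X -> nat, forall y,
  (forall s, chain x y s -> (size s <= Tx y)%N) /\
  (exists2 s, chain x y s & size s = Tx y).
  by have [T HT] := choice_ex H; exists T => x y; apply: HT.
apply: (@choice_ex _ _ (fun y n => (forall s, chain x y s -> (size s <= n)%N) /\
  (exists2 s, chain x y s & size s = n))) => y.
have [N HN] := nat_ub (d x y + (r + 1)).
pose P n := `[< exists2 s, chain x y s & size s = n >].
have exP : exists n, P n by exists 0%N; apply/asboolP; exists [::].
have ubP n : P n -> (n <= N)%N.
  move=> /asboolP [s cs <-]; rewrite -(ler_nat R).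
  exact: le_trans (chain_size cs) HN.
case: (ex_maxnP exP ubP) => n /asboolP Pn nmax; exists n; split=> //.
by move=> s cs; apply: nmax; apply/asboolP; exists s.
Qed.

Variable T : X -> X -> nat.
Hypothesis Tub : forall x y s, chain x y s -> (size s <= T x y)%N.
Hypothesis Tex : forall x y, exists2 s, chain x y s & size s = T x y.

Lemma T_le x y : (T x y)%:R <= d x y + (r + 1).
Proof. by have [s cs <-] := Tex x y; apply: chain_size. Qed.

Lemma pairwise_filter (P : pred W) s : pairwise wlt s -> pairwise wlt (seq.filter P s).
Proof. by apply: subseq_pairwise; apply: filter_subseq. Qed.

(** At most one wall of a chain has [z] on neither side: if [u] comes before [w]
and [z] is not to the right of [u], it is to the left of [w]. *)
Lemma size_split z s : pairwise wlt s ->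
  (size s <= size [seq u <- s | `[< Rw u z >]] + size [seq u <- s | `[< Lw u z >]] + 1)%N.
Proof.
move=> ps.
have : (size [seq u <- s | ~~ `[< Rw u z >] && ~~ `[< Lw u z >]] <= 1)%N.
  have := pairwise_filter (fun u => ~~ `[< Rw u z >] && ~~ `[< Lw u z >]) ps.
  have : all (fun u => ~~ `[< Rw u z >] && ~~ `[< Lw u z >])
     [seq u <- s | ~~ `[< Rw u z >] && ~~ `[< Lw u z >]] by apply: filter_all.
  case: [seq u <- s | _] => [|u [|w s']] //=.
  move=> /andP[/andP[/asboolPn nR _] /andP[/andP[_ /asboolPn nL] _]].
  by move=> /andP[/andP[uw _] _]; have := wltP uw nR.
rewrite !size_filter.
have -> : size s = (count (fun u => `[< Rw u z >]) s + count (fun u => ~~ `[< Rw u z >]) s)%N.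
  by rewrite -(count_predC (fun u => `[< Rw u z >]) s).
have -> : count (fun u => ~~ `[< Rw u z >]) s =
    (count (fun u => ~~ `[< Rw u z >] && `[< Lw u z >]) s +
     count (fun u => ~~ `[< Rw u z >] && ~~ `[< Lw u z >]) s)%N.
  elim: s {ps} => //= u s ->; case: `[< Rw u z >]; case: `[< Lw u z >] => /=; lia.
have : (count (fun u => ~~ `[< Rw u z >] && `[< Lw u z >]) s <= count (fun u => `[< Lw u z >]) s)%N.
  by apply: sub_count => u /andP[].
lia.
Qed.

Lemma pairwise_flip s : pairwise wlt s -> pairwise wlt (rev [seq flip u | u <- s]).
Proof.
elim: s => //= u s' IH /andP[us' ps'].
rewrite rev_cons -cats1 pairwise_cat IH //= andbT allrel1r.
apply/allP => w; rewrite mem_rev => /mapP[w' ws ->]; apply/asboolP => p.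
have := allP us' _ ws => /asboolP /(_ p) [h|h]; first by right; apply/flipL.
by left; apply/flipR.
Qed.

Lemma T_sym_le x y : (T x y <= T y x)%N.
Proof.
have [s [ps Hs] <-] := Tex x y.
rewrite -(size_map flip) -size_rev; apply: Tub; split; first exact: pairwise_flip.
move=> u; rewrite mem_rev => /mapP[u' /Hs [h1 h2] ->].
by split; [apply/flipL|apply/flipR].
Qed.

(** Here [s] separates [y] from [x] and [z], and [t] separates [z] from [x] and
[y].  Reversing [s] and following it by [t] gives a chain from [y] to [z] once
the first wall of each is dropped: a point that is neither to the left of a
later wall of [s] nor to the left of a later wall of [t] would be to the right
of both first walls, the configuration excluded by [Wquad]. *)
Lemma junction x y z s t : chain x y s -> chain x z t ->
  (forall u, u \in s -> Lw u z) -> (forall w, w \in t -> Lw w y) ->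
  ((size s).-1 + (size t).-1 <= T y z)%N.
Proof.
move=> [ps Hs] [pt Ht] sz ty.
have cross u w : u \in behead s -> w \in behead t -> wlt (flip u) w.
  case: s ps Hs sz => [|u0 s] //= /andP[u0s ps] Hs sz us.
  case: t pt Ht ty => [|w0 t] //= /andP[w0t pt] Ht ty wt.
  apply/asboolP => p.
  have [Lu|nLu] := pselect (Lw u p); first by left; apply/flipR.
  have [Lwp|nLw] := pselect (Lw w p); first by right.
  exfalso.
  have Ru0 : Rw u0 p.
    apply: contrapT => nR; apply: nLu; apply: wltP nR.
    by move/allP: u0s => /(_ u us).
  have Rw0 : Rw w0 p.
    apply: contrapT => nR; apply: nLw; apply: wltP nR.
    by move/allP: w0t => /(_ w wt).
  have [L1 R1] := Hs u0 (mem_head _ _); have [L2 R2] := Ht w0 (mem_head _ _).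
  have L3 := sz u0 (mem_head _ _); have L4 := ty w0 (mem_head _ _).
  exact: (Wquad L1 L2 R1 L4 L3 R2 Ru0 Rw0).
have : (size (rev (map flip (behead s)) ++ behead t) <= T y z)%N.
  apply: Tub; split.
    rewrite pairwise_cat; apply/and3P; split.
    - apply/allrelP => u w; rewrite mem_rev => /mapP[u' us ->] wt.
      exact: cross.
    - by apply: pairwise_flip; case: s ps {Hs sz cross} => //= u s /andP[].
    - by case: t pt {Ht ty cross} => //= u t /andP[].
  move=> u; rewrite mem_cat mem_rev => /orP[/mapP[u' /mem_behead us ->]|/mem_behead ut].
    by split; [apply/flipL; have [] := Hs _ us|apply/flipR; apply: sz].
  by split; [apply: ty|have [] := Ht _ ut].
by rewrite size_cat size_rev size_map !size_behead.
Qed.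

(** The tree like inequality.  Split a maximal chain from [x] to [y] by the side
on which [z] lies, and a maximal chain from [x] to [z] by the side of [y]: the
parts separating [x] from both points are the candidates for [s], and the other
two parts form a chain from [y] to [z] by [junction]. *)
Lemma common_chain x y z : exists s, [/\ chain x y s, chain x z s &
  (T x y + T x z <= T y z + 2 * size s + 4)%N].
Proof.
have [s [ps Hs] <-] := Tex x y; have [t [pt Ht] <-] := Tex x z.
pose s1 := [seq u <- s | `[< Rw u z >]]; pose s2 := [seq u <- s | `[< Lw u z >]].
pose t1 := [seq u <- t | `[< Rw u y >]]; pose t2 := [seq u <- t | `[< Lw u y >]].
have hs : (size s <= size s1 + size s2 + 1)%N := size_split z ps.
have ht : (size t <= size t1 + size t2 + 1)%N := size_split y pt.
have j : ((size s2).-1 + (size t2).-1 <= T y z)%N.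
  apply: (@junction x).
  - split; first exact: pairwise_filter.
    by move=> u; rewrite mem_filter => /andP[_ /Hs].
  - split; first exact: pairwise_filter.
    by move=> u; rewrite mem_filter => /andP[_ /Ht].
  - by move=> u; rewrite mem_filter => /andP[/asboolP].
  - by move=> u; rewrite mem_filter => /andP[/asboolP].
have [le|lt] := leqP (size t1) (size s1).
  exists s1; split; last by lia.
    split; first exact: pairwise_filter.
    by move=> u; rewrite mem_filter => /andP[_ /Hs].
  split; first exact: pairwise_filter.
  by move=> u; rewrite mem_filter => /andP[/asboolP h /Hs []].
exists t1; split; last by lia.
  split; first exact: pairwise_filter.
  by move=> u; rewrite mem_filter => /andP[/asboolP h /Ht []].
split; first exact: pairwise_filter.
by move=> u; rewrite mem_filter => /andP[_ /Ht].
Qed.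

(** ** Walls crossed and crossed back *)

Section Low.
Variables (q : nat -> X) (b : X) (K : R) (s0 s1 D0 : nat).
Hypothesis K0 : 0 <= K.
Hypothesis s01 : (s0 <= s1)%N.
Hypothesis qK : forall t, (s0 <= t < s1)%N -> d (q t) (q t.+1) <= K.

(** At the time [t] the path is between each of its earlier points and [b], up
to the defect [D]. *)
Definition low (D : R) (t : nat) : Prop :=
  forall t', (s0 <= t' <= t)%N -> d (q t') (q t) + d (q t) b <= d (q t') b + D.

Definition lows (D : R) := [seq t <- iota s0 (s1 - s0) | `[< low D t >]].

Lemma qKn t n : (s0 <= t)%N -> (t + n <= s1)%N -> d (q t) (q (t + n)) <= n%:R * K.
Proof.
move=> ts; elim: n => [|n IH] tn; first by rewrite addn0 mdistxx mul0r.
apply: le_trans (tri _ (q (t + n)) _) _.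
rewrite addnS -natr1 mulrDl mul1r lerD ?IH //; first lia.
by apply: qK; lia.
Qed.

Variable s : seq W.
Hypotheses (cb : chain (q s0) b s) (c1 : chain (q s0) (q s1) s).

(** The first time after [s0] at which the path is to the right of [u]. *)
Definition hit (u : W) (t : nat) : Prop :=
  [/\ (s0 < t <= s1)%N, Rw u (q t) & forall t', (s0 <= t' < t)%N -> ~ Rw u (q t')].

Lemma exists_hit u : u \in s -> exists t, hit u t.
Proof.
move=> us; have [Lu _] := cb.2 u us; have [_ R1] := c1.2 u us.
have exP : exists t, (s0 <= t)%N && `[< Rw u (q t) >].
  by exists s1; rewrite s01; apply/asboolP.
case: (ex_minnP exP) => t /andP[s0t /asboolP Rt] tmin.
have t1 : (t <= s1)%N by apply: tmin; rewrite s01; apply/asboolP.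
exists t; split=> //.
  rewrite t1 andbT ltn_neqAle s0t andbT; apply/eqP => st; subst t.
  exact: (LRdisj Lu Rt).
move=> t' /andP[s0t' t't] Rt'; have := tmin t'; rewrite s0t' => /(_ (asboolT Rt')).
by rewrite leqNgt t't.
Qed.

Lemma hit_mono u w t t' : wlt u w -> hit u t -> hit w t' -> (t <= t')%N.
Proof.
move=> uw [_ _ Hu] [b' Rw' _]; rewrite leqNgt; apply/negP => lt.
apply: (LRdisj _ Rw'); apply: wltP uw _; apply: Hu; lia.
Qed.

(** Just before [u] is hit, the path has always been to the left of the later
wall [w], while [b] is to the right of [w].  All ways from the past to [b]
therefore pass near the middle point of [w], and so near the path at that time,
since [w] is hit at most [D0] steps later. *)
Lemma hit_low u w t t' : wlt u w -> u \in s -> w \in s -> hit u t -> hit w t' ->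
  (t' <= t + D0)%N -> low (3 * r + 2 * (D0.+1%:R * K)) t.-1.
Proof.
move=> uw us ws hu hw tt' t1 /andP[s0t1 t1t].
have tt := hit_mono uw hu hw.
have [bt _ Hu] := hu; have [bt' Rt' _] := hw.
have Lbefore j : (s0 <= j < t)%N -> Lw w (q j) by move=> jt; apply: wltP uw _; apply: Hu.
have L1 : Lw w (q t1) by apply: Lbefore; lia.
have Lt : Lw w (q t.-1) by apply: Lbefore; lia.
have [_ Rb] := cb.2 w ws.
have := Wpass L1 Rb; have := Wpass Lt Rt'; rewrite /btw.
have dq : d (q t.-1) (q t') <= D0.+1%:R * K.
  have -> : t' = (t.-1 + (t' - t.-1))%N by lia.
  apply: le_trans (qKn _ _) _; [lia|lia|].
  by apply: ler_wpM2r => //; rewrite ler_nat; lia.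
have := tri (q t1) (mid w) (q t.-1); have := tri (q t.-1) (mid w) b.
rewrite (dsym (mid w) (q t.-1)).
have := dge0 (mid w) (q t'); lra.
Qed.

(** One step of the path has length at most [K], so it cannot cross a long
chain. *)
Lemma hit_mult (c : nat) t s' : K + (r + 1) <= c%:R -> subseq s' s ->
  (forall u, u \in s' -> hit u t) -> (size s' <= c.+1)%N.
Proof.
move=> Kc ss Hs'.
have ps' : pairwise wlt s' by apply: subseq_pairwise ss cb.1.
case: s' ss ps' Hs' => [|u s'] //= ss /andP[us' ps'] Hs'.
rewrite ltnS -(ler_nat R); apply: le_trans Kc.
have hu := Hs' u (mem_head _ _); have [bt _ Hu] := hu.
have c' : chain (q t.-1) (q t) s'.
  split=> // w ws'; have [_ Rt _] := Hs' w (mem_behead (s := u :: s') ws').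
  split=> //; apply: (wltP (allP us' _ ws')); apply: Hu; lia.
apply: le_trans (chain_size c') _; rewrite lerD2r.
have := @qK t.-1; rewrite prednK; last lia.
apply; lia.
Qed.

(** In a chain crossed by the path and separating its start from [b], count the
walls by the time to the next hit: at most [(s1 - s0) / D0] times this time
exceeds [D0], and in the other cases there is a low position, used by a bounded
number of walls. *)
Lemma low_count (c : nat) : K + (r + 1) <= c%:R -> (0 < D0)%N ->
  (D0 * size s <= D0 * (1 + c.+1 * size (lows (3 * r + 2 * (D0.+1%:R * K)))) + (s1 - s0))%N.
Proof.
move=> Kc D00.
have [e He] : exists e : W -> nat, forall u, u \in s -> hit u (e u).
  apply: (@choice_ex _ _ (fun u t => u \in s -> hit u t)) => u.
  have [us|nus] := boolP (u \in s); last by exists 0%N.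
  by have [t ht] := exists_hit us; exists t.
set L := lows _.
(* goods: elements whose successor is hit soon after *)
pose goods := fix goods (l : seq W) : seq W :=
  if l is u :: l' then
    (if l' is w :: _ then
       if (e w <= e u + D0)%N then u :: goods l' else goods l' else [::])
  else [::].
have goods_sub l : subseq (goods l) l.
  elim: l => [|u [|w l] IH] //.
  have -> : goods [:: u, w & l] = if (e w <= e u + D0)%N then u :: goods (w :: l) else goods (w :: l) by [].
  case: ifP => _; first by move: IH; rewrite [subseq (u :: _) _]/= eqxx.
  exact: subseq_trans IH (subseq_cons _ _).
have goods_low l u : subseq l s -> u \in goods l -> (e u).-1 \in L.
  elim: l => //= v [|w l] IH // ls.
  have vs : v \in s by apply: (mem_subseq ls); rewrite mem_head.
  have ws : w \in s by apply: (mem_subseq ls); rewrite inE mem_head orbT.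
  have IH' := IH (subseq_trans (subseq_cons _ _) ls).
  case: ifP => h; last exact: IH'.
  rewrite inE => /orP[/eqP->|]; last exact: IH'.
  have hv := He _ vs; have hw := He _ ws; have [bv _ _] := hv.
  rewrite mem_filter mem_iota; apply/andP; split; last by lia.
  apply/asboolP; apply: (@hit_low v w (e v) (e w)) => //.
  have := subseq_pairwise ls cb.1 => /= /andP[/andP[]] //.
have goods_size l : subseq l s ->
    (D0 * size l <= D0 * (1 + size (goods l)) + (last s0 (map e l) - head s0 (map e l)))%N.
  elim: l => [|u [|w l] IH] ls; [by rewrite muln0|by rewrite /=; lia|].
  have := IH (subseq_trans (subseq_cons _ _) ls).
  have ps := subseq_pairwise ls cb.1.
  have us : u \in s by apply: (mem_subseq ls); rewrite mem_head.
  have ws : w \in s by apply: (mem_subseq ls); rewrite inE mem_head orbT.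
  have uw : (e u <= e w)%N.
    by apply: (hit_mono (u := u) (w := w)); [move: ps => /= /andP[/andP[]]|apply: He|apply: He].
  have wl : (e w <= last (e w) (map e l))%N.
    have : last w l \in w :: l by apply: mem_last.
    rewrite last_map inE => /orP[/eqP->//|ll].
    apply: (hit_mono (u := w) (w := last w l)); [|exact: He|].
      by move: ps => /= /andP[_ /andP[/allP /(_ _ ll)]].
    by apply: He; apply: (mem_subseq ls); rewrite !inE ll !orbT.
  rewrite /=; case: ifP => h /=; nia.
have gs : (size (goods s) <= c.+1 * size L)%N.
  have fib : forall l : seq nat, (forall u, u \in goods s -> (e u).-1 \in l) ->
     (size (goods s) <= c.+1 * size l)%N.
    move=> l Hl.
    have -> : size (goods s) = (\sum_(u <- goods s) 1)%N by rewrite sum1_size.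
    apply: leq_trans (_ : \sum_(u <- goods s) \sum_(t <- l) ((e u).-1 == t) <= _)%N.
      rewrite big_seq [X in (_ <= X)%N]big_seq; apply: leq_sum => u ug.
      by rewrite (big_rem _ (Hl u ug)) /= eqxx.
    rewrite exchange_big /=.
    apply: leq_trans (_ : \sum_(t <- l) c.+1 <= _)%N; last by rewrite big_const_seq count_predT iter_addn_0 mulnC.
    apply: leq_sum => t _.
    have -> : (\sum_(u <- goods s) ((e u).-1 == t) = size [seq u <- goods s | (e u).-1 == t])%N.
      by rewrite size_filter -sum1_count [RHS]big_mkcond; apply: eq_bigr => u _; case: eqP.
    apply: (@hit_mult _ t.+1) => //.
      exact: subseq_trans (filter_subseq _ _) (goods_sub s).
    move=> u; rewrite mem_filter => /andP[/eqP <- ug].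
    have us := mem_subseq (goods_sub s) ug.
    have hu := He _ us; have [bu _ _] := hu.
    by rewrite prednK //; lia.
  apply: fib => u; exact: goods_low.
have := goods_size s (subseq_refl s).
have : (last s0 (map e s) - head s0 (map e s) <= s1 - s0)%N.
  case: (s) He => [|u l] He' /=; first lia.
  have [bu _ _] := He' u (mem_head _ _).
  have [bl _ _] := He' _ (mem_last u l).
  move: bu bl; rewrite last_map; move: (e u) (e (last u l)) => k1 k2; lia.
move=> h1 h2; apply: leq_trans h2 _; apply: leq_add => //.
by rewrite leq_mul2l leq_add2l gs orbT.
Qed.

End Low.

End Walls.

(** * Translates of an axis *)

Section Translates.
Variables (R : realType) (G : groupType) (X : metricType R) (act : G -> X -> X).
Hypotheses (geoX : geodesic_space X) (isoact : isometric_action act).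
Variables (k : G) (o : X) (C : R) (ax : axis act k o C).
Variable ix : X -> int.
Hypothesis Hix : forall x, nearest_index act k o x (ix x).

Local Notation d := (@mdist R X).
Local Notation orb := (orb act k o).

(** The projection of [x] to the translate of the axis by [v]. *)
Definition idx (v : G) (x : X) : int := ix (act v^-1%g x).
Definition pt (v : G) (n : int) : X := act v (orb n).

Lemma idx_act g v x : idx (g * v)%g (act g x) = idx v x.
Proof. by rewrite /idx invgM (actM isoact) (actVK isoact). Qed.

Lemma dpt v m n : d (pt v m) (pt v n) = d (orb m) (orb n).
Proof. exact: dact. Qed.

Lemma btw_act s g x q y : btw s (act g x) (act g q) (act g y) <-> btw s x q y.
Proof. by rewrite /btw !(dact isoact). Qed.

Lemma btwV s v x q y : btw s x q y -> btw s (act v^-1%g x) (act v^-1%g q) (act v^-1%g y).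
Proof. by move/btw_act; apply. Qed.

Definition geod (x y : X) (gam : R -> X) := [/\ gam 0 = x, gam (d x y) = y &
  forall s t, s \in `[0, d x y] -> t \in `[0, d x y] ->
     d (gam s) (gam t) = `|s - t| ].

Lemma idx_pass : exists (D : nat) (r : R), [/\ 0 <= r,
  forall x y gam v n, geod x y gam -> idx v x + D%:Z <= n -> n <= idx v y - D%:Z ->
    exists2 t, t \in `[0, d x y] & d (gam t) (pt v n) <= r &
  forall v x y n, idx v x + D%:Z <= n -> n <= idx v y - D%:Z -> btw r x (pt v n) y].
Proof.
have [D1 [r1 [r10 H1]]] := geodesic_passes geoX isoact ax Hix.
have [D2 [r2 [r20 H2]]] := orbit_between geoX isoact ax Hix.
exists (D1 + D2)%N, (r1 + r2); split; first lra.
- move=> x y gam v n [g0 gl giso] nx ny.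
  have dv : d (act v^-1%g x) (act v^-1%g y) = d x y by rewrite (dact isoact).
  have := H1 (act v^-1%g x) (act v^-1%g y) (fun t => act v^-1%g (gam t)) n.
  rewrite dv g0 gl => /(_ erefl erefl) [|||t tin tn].
  + by move=> s t sin tin; rewrite (dact isoact) giso.
  + by rewrite -/(idx v x); lia.
  + by rewrite -/(idx v y); lia.
  exists t => //; rewrite /pt dsym (dactV isoact) dsym; lra.
- move=> v x y n nx ny.
  have : btw r2 (act v^-1%g x) (orb n) (act v^-1%g y).
    by apply: H2; rewrite -/(idx v x) -/(idx v y); lia.
  move/(btw_act r2 v); rewrite !(actKV isoact) -/(pt v n) /btw; lra.
Qed.

Lemma idx_mono : exists N : R -> nat, forall s v x q y (n : int), btw s x q y ->
  (idx v x <= n -> idx v y <= n -> idx v q <= n + (N s)%:Z) /\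
  (n <= idx v x -> n <= idx v y -> n - (N s)%:Z <= idx v q).
Proof.
apply: (@choice_ex _ _ (fun s N => forall v x q y (n : int), btw s x q y ->
  (idx v x <= n -> idx v y <= n -> idx v q <= n + N%:Z) /\
  (n <= idx v x -> n <= idx v y -> n - N%:Z <= idx v q))) => s.
have [N1 H1] := ix_mono_le geoX isoact ax Hix s.
have [N2 H2] := ix_mono_ge geoX isoact ax Hix s.
exists (N1 + N2)%N => v x q y n /(btwV v) xqy; split=> hx hy.
  by have := H1 _ _ _ _ xqy hx hy; rewrite -/(idx v q); lia.
by have := H2 _ _ _ _ xqy hx hy; rewrite -/(idx v q); lia.
Qed.

Lemma idx_lip : exists N : R -> nat, forall s v x y, d x y <= s ->
  `|idx v x - idx v y| <= (N s)%:Z.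
Proof.
apply: (@choice_ex _ _ (fun s N => forall v x y, d x y <= s ->
  `|idx v x - idx v y| <= N%:Z)) => s.
have [N HN] := ix_lip geoX ax Hix s.
by exists N => v x y xy; apply: HN; rewrite (dact isoact).
Qed.

Lemma idx_pt : exists N : nat, forall v n, `|idx v (pt v n) - n| <= N%:Z.
Proof.
have [N HN] := ix_orb ax Hix.
by exists N => v n; rewrite /idx /pt (actVK isoact).
Qed.

Section Count.
Hypothesis wpd : WPD act k.
Variables (D : nat) (r : R).
Hypothesis r0 : 0 <= r.
Hypothesis Hpass : forall x y gam v n, geod x y gam ->
  idx v x + D%:Z <= n -> n <= idx v y - D%:Z ->
    exists2 t, t \in `[0, d x y] & d (gam t) (pt v n) <= r.
Variable K : nat.
Let n0 : int := (K + D)%N%:Z.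

(** The translates in question are followed by the geodesic from [x] to [y] from
their point [n0] to their point [n0 + L], and their points [n0] are at the same
distance from [x] up to 1.  Two of them, followed in the same direction, thus
differ by an element moving [o] and [k ^ L o] by at most [8 * r + 1]; the WPD
condition bounds the number of such elements. *)
Lemma count_unit : exists H N : nat, forall x y (tt : R) (s : seq G), uniq s ->
  (forall v, v \in s -> [/\ `|idx v x| <= K%:Z, H%:Z <= idx v y &
     tt <= d x (pt v n0) <= tt + 1]) -> (size s <= N)%N.
Proof.
have rr0 : 0 < 8 * r + 1 by have := r0; lra.
have [L /finite_seqP [F HF]] := wpd o rr0.
pose n1 : int := n0 + L%:Z.
exists (K + D + L + D)%N, (2 * size F)%N => x y tt s us Hs.
have [gam gm] : exists gam, geod x y gam by have := geoX x y.
have [g0 gl giso] := gm.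
have [t1 Ht1] : exists t1 : G -> R, forall v, v \in s ->
    t1 v \in `[0, d x y] /\ d (gam (t1 v)) (pt v n0) <= r.
  apply: (@choice_ex _ _ (fun v t => v \in s -> t \in `[0, d x y] /\ d (gam t) (pt v n0) <= r)) => v.
  have [vs|nvs] := boolP (v \in s); last by exists 0.
  have [vx vy _] := Hs v vs.
  have [t tin ht] : exists2 t, t \in `[0, d x y] & d (gam t) (pt v n0) <= r.
    by apply: Hpass; rewrite // /n0; lia.
  by exists t.
have [t2 Ht2] : exists t2 : G -> R, forall v, v \in s ->
    t2 v \in `[0, d x y] /\ d (gam (t2 v)) (pt v n1) <= r.
  apply: (@choice_ex _ _ (fun v t => v \in s -> t \in `[0, d x y] /\ d (gam t) (pt v n1) <= r)) => v.
  have [vs|nvs] := boolP (v \in s); last by exists 0.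
  have [vx vy _] := Hs v vs.
  have [t tin ht] : exists2 t, t \in `[0, d x y] & d (gam t) (pt v n1) <= r.
    by apply: Hpass; rewrite // /n1 /n0; lia.
  by exists t.
set b := d (orb n0) (orb n1).
have Ht1' v : v \in s -> `|t1 v - d x (pt v n0)| <= r.
  move=> vs; have [tin ht] := Ht1 v vs.
  have : d x (gam (t1 v)) = t1 v.
    rewrite -{1}g0 giso // ?in_itv /= ?lexx ?dge0 // sub0r normrN ger0_norm //.
    by move: tin; rewrite in_itv /= => /andP[].
  have := tri x (gam (t1 v)) (pt v n0); have := tri x (pt v n0) (gam (t1 v)).
  rewrite (dsym (pt v n0)) ler_norml; lra.
have Ht12 v : v \in s -> `| `|t1 v - t2 v| - b| <= 2 * r.
  move=> vs; have [tin ht] := Ht1 v vs; have [tin2 ht2] := Ht2 v vs.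
  rewrite -(giso _ _ tin tin2) /b -(dpt v).
  have := tri (gam (t1 v)) (pt v n0) (gam (t2 v)).
  have := tri (pt v n0) (pt v n1) (gam (t2 v)).
  have := tri (pt v n0) (gam (t1 v)) (pt v n1).
  have := tri (gam (t1 v)) (gam (t2 v)) (pt v n1).
  rewrite (dsym (pt v n0) (gam (t1 v))) (dsym (pt v n1) (gam (t2 v))) ler_norml; lra.
(* if two translates are followed in the same direction, the entry times control
   the exit times, and they differ by an element of the finite list F *)
have cls (P : pred G) : (forall v v', v \in s -> v' \in s -> P v -> P v' ->
     `|t2 v - t2 v'| <= `|t1 v - t1 v'| + 4 * r) ->
   (size [seq v <- s | P v] <= size F)%N.
  move=> HP; case E : [seq v <- s | P v] => [|v0 s'] //; rewrite -E.
  have : v0 \in [seq v <- s | P v] by rewrite E mem_head.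
  rewrite mem_filter => /andP[Pv0 v0s].
  pose phi v := ((v0 * zexpg k n0)^-1 * (v * zexpg k n0))%g.
  have phi_inj : injective phi by move=> v v' /mulgI /mulIg.
  rewrite -(size_map phi); apply: uniq_leq_size.
    by rewrite (map_inj_uniq phi_inj) filter_uniq.
  move=> _ /mapP[v + ->]; rewrite mem_filter => /andP[Pv vs].
  suff : [set` F] (phi v) by [].
  rewrite -HF /=.
  have dd (m : int) : d (act (zexpg k m) o) (act (phi v) (act (zexpg k m) o)) =
        d (pt v0 (n0 + m)) (pt v (n0 + m)).
    rewrite /pt (orbD isoact) -!(actM isoact) /phi.
    by rewrite !(actM isoact) [LHS]dsym (dactV isoact) invgK [LHS]dsym !(actM isoact).
  have [tin ht] := Ht1 v vs; have [tin0 ht0] := Ht1 v0 v0s.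
  have [tinb htb] := Ht2 v vs; have [tin0b ht0b] := Ht2 v0 v0s.
  have [_ _ /andP[w1 w2]] := Hs v vs; have [_ _ /andP[w3 w4]] := Hs v0 v0s.
  have := Ht1' v vs; have := Ht1' v0 v0s; rewrite !ler_norml => /andP[u1 u2] /andP[u3 u4].
  have d1 : `|t1 v0 - t1 v| <= 2 * r + 1 by rewrite ler_norml; lra.
  have d2 := HP v0 v v0s vs Pv0 Pv.
  have e1 := giso _ _ tin0 tin; have e2 := giso _ _ tin0b tinb.
  split.
    have := dd 0; rewrite zexpg0 (act1 isoact) addr0 => ->.
    have := tri (pt v0 n0) (gam (t1 v0)) (pt v n0).
    have := tri (gam (t1 v0)) (gam (t1 v)) (pt v n0).
    rewrite (dsym (pt v0 n0) (gam (t1 v0))); lra.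
  have := dd L%:Z; rewrite /= => ->; rewrite -/n1.
  have := tri (pt v0 n1) (gam (t2 v0)) (pt v n1).
  have := tri (gam (t2 v0)) (gam (t2 v)) (pt v n1).
  rewrite (dsym (pt v0 n1) (gam (t2 v0))); lra.
have -> : size s = (size [seq v <- s | (t1 v <= t2 v)%R] + size [seq v <- s | ~~ (t1 v <= t2 v)%R])%N.
  by rewrite !size_filter; rewrite -(count_predC (fun v => (t1 v <= t2 v)%R) s).
rewrite mul2n -addnn; apply: leq_add; apply: cls => v v' vs vs'.
  move=> l1 l2; have := Ht12 v vs; have := Ht12 v' vs'.
  rewrite [`|t1 v - t2 v|]distrC [`|t1 v' - t2 v'|]distrC.
  rewrite (ger0_norm (x := t2 v - t1 v)) ?subr_ge0 // (ger0_norm (x := t2 v' - t1 v')) ?subr_ge0 //.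
  have := ler_norm (t1 v - t1 v'); have := ler_norm (t1 v' - t1 v); rewrite distrC !ler_norml; lra.
rewrite -!ltNge => l1 l2; have := Ht12 v vs; have := Ht12 v' vs'.
rewrite (gtr0_norm (x := t1 v - t2 v)) ?subr_gt0 // (gtr0_norm (x := t1 v' - t2 v')) ?subr_gt0 //.
have := ler_norm (t1 v - t1 v'); have := ler_norm (t1 v' - t1 v); rewrite distrC !ler_norml; lra.
Qed.

Lemma count_window : exists H N : nat, forall x y (m : nat) (tt : R) (s : seq G), uniq s ->
  (forall v, v \in s -> [/\ `|idx v x| <= K%:Z, H%:Z <= idx v y &
     tt <= d x (pt v n0) <= tt + m%:R]) -> (size s <= N * m.+1)%N.
Proof.
have [H [N HN]] := count_unit.
exists H, N => x y m tt; elim: m => [|m IH] s us Hs.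
  rewrite muln1; apply: (HN x y tt) => // v vs; have [h1 h2 h3] := Hs v vs; split=> //.
  lra.
have -> : size s = (size [seq v <- s | (d x (pt v n0) <= tt + m%:R)%R] +
    size [seq v <- s | ~~ (d x (pt v n0) <= tt + m%:R)%R])%N.
  by rewrite !size_filter; rewrite -(count_predC (fun v => (d x (pt v n0) <= tt + m%:R)%R) s).
rewrite [(N * _)%N]mulnS addnC; apply: leq_add.
  apply: (HN x y (tt + m%:R)); first exact: filter_uniq.
  move=> v; rewrite mem_filter -ltNge => /andP[h vs]; have [h1 h2] := Hs v vs.
  rewrite -natr1 => h3; split=> //; lra.
apply: IH; first exact: filter_uniq.
move=> v; rewrite mem_filter => /andP[h vs]; have [h1 h2] := Hs v vs.
rewrite -natr1 => h3; split=> //; lra.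
Qed.

End Count.

End Translates.

(** * Enumeration and ranking *)

Section Rank.
Variables (T : choiceType) (R : realType).

Lemma finite_enumeration (P : T -> Prop) (b : nat) :
  (forall s, uniq s -> (forall v, v \in s -> P v) -> (size s <= b)%N) ->
  exists2 s, uniq s & forall v, (v \in s) <-> P v.
Proof.
move=> Hb.
pose Q n := `[< exists s, [/\ uniq s, forall v, v \in s -> P v & size s = n] >].
have exQ : exists n, Q n by exists 0%N; apply/asboolP; exists [::].
have ubQ n : Q n -> (n <= b)%N by move=> /asboolP [s [us Hs <-]]; apply: Hb.
case: (ex_maxnP exQ ubQ) => n /asboolP [s [us Hs sn]] nmax.
exists s => // v; split=> [|Pv]; first exact: Hs.
apply: contrapT => /negP vs.
have : Q n.+1.
  apply/asboolP; exists (v :: s); rewrite /= vs us sn; split=> //.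
  by move=> u; rewrite inE => /orP[/eqP->|/Hs].
by move/nmax; rewrite ltnn.
Qed.

(** A predicate whose elements can be listed by increasing [pos], only finitely
many coming before each of them; ties are broken by the order of an arbitrary
list. *)
Lemma exists_rank (P : T -> Prop) (pos : T -> R) :
  (forall v, P v -> exists b : nat, forall s, uniq s ->
     (forall u, u \in s -> P u /\ pos u <= pos v) -> (size s <= b)%N) ->
  exists num : T -> nat,
    (forall v (b : nat), P v -> (forall s, uniq s ->
       (forall u, u \in s -> P u /\ pos u <= pos v) -> (size s <= b)%N) ->
       (num v < b)%N) /\
    (forall v v', P v -> P v' -> num v = num v' -> v = v').
Proof.
move=> Hfin.
have [L HL] : exists L : R -> seq T, forall t, (exists2 v, P v & pos v = t) ->
    uniq (L t) /\ forall u, (u \in L t) <-> (P u /\ pos u <= t).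
  apply: (@choice_ex _ _ (fun t l => (exists2 v, P v & pos v = t) ->
    uniq l /\ forall u, (u \in l) <-> (P u /\ pos u <= t))) => t.
  have [[v Pv <-]|nt] := pselect (exists2 v, P v & pos v = t); last by exists [::].
  have [b Hb] := Hfin v Pv.
  by have [l ul Hl] := finite_enumeration Hb; exists l.
pose below v := [seq u <- L (pos v) | pos u < pos v].
pose level v := [seq u <- L (pos v) | ~~ (pos u < pos v)].
pose num v := (size (below v) + index v (level v))%N.
have sz v : (size (below v) + size (level v) = size (L (pos v)))%N.
  by rewrite !size_filter; rewrite -(count_predC (fun u => (pos u < pos v)%R) (L (pos v))).
have inlevel v : P v -> v \in level v.
  move=> Pv; have [_ HLv] := HL (pos v) (ex_intro2 _ _ v Pv erefl).
  by rewrite mem_filter ltxx /=; apply/HLv.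
exists num; split.
  move=> v b Pv Hb; have [ul HLv] := HL (pos v) (ex_intro2 _ _ v Pv erefl).
  apply: leq_trans (Hb (L (pos v)) ul (fun u us => (HLv u).1 us)).
  by rewrite /num -sz ltn_add2l index_mem inlevel.
have sep v v' : P v -> P v' -> pos v < pos v' -> (num v < num v')%N.
  move=> Pv Pv' lt.
  have [ul HLv] := HL (pos v) (ex_intro2 _ _ v Pv erefl).
  have [ul' HLv'] := HL (pos v') (ex_intro2 _ _ v' Pv' erefl).
  apply: (@leq_trans (size (L (pos v)))).
    by rewrite /num -sz ltn_add2l index_mem inlevel.
  apply: leq_trans (leq_addr _ _).
  apply: uniq_leq_size => // u /HLv [Pu pu].
  rewrite mem_filter (le_lt_trans pu lt) /=; apply/HLv'; split=> //.
  exact: le_trans pu (ltW lt).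
move=> v v' Pv Pv' e.
have [lt|lt|eq] := ltgtP (pos v) (pos v').
- by have := sep _ _ Pv Pv' lt; rewrite e ltnn.
- by have := sep _ _ Pv' Pv lt; rewrite e ltnn.
move: e; rewrite /num /below /level eq => /addnI.
have h : v \in level v' by rewrite /level -eq; apply: inlevel.
move=> e; rewrite -(nth_index v h) -[RHS](nth_index v (inlevel _ Pv')).
by rewrite /level; congr nth.
Qed.

End Rank.

(** * Walls and insertions from one axis *)

Section Build.
Variables (R : realType) (G : groupType) (X : metricType R) (act : G -> X -> X).
Hypotheses (isoact : isometric_action act).
Variables (k : G) (o : X) (ix : X -> int).

Local Notation d := (@mdist R X).
Local Notation orb := (orb act k o).
Local Notation idx := (idx act ix).
Local Notation pt := (pt act k o).

(* the properties of projections to translates, the translates a of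
   align_family, and the bound of count_window *)
Variables (D : nat) (r : R).
Hypothesis r0 : 0 <= r.
Hypothesis HGP : forall v x y n, idx v x + D%:Z <= n -> n <= idx v y - D%:Z -> btw r x (pt v n) y.
Variable Nm : R -> nat.
Hypothesis Hm : forall s v x q y (n : int), btw s x q y ->
  (idx v x <= n -> idx v y <= n -> idx v q <= n + (Nm s)%:Z) /\
  (n <= idx v x -> n <= idx v y -> n - (Nm s)%:Z <= idx v q).
Variable Nl : R -> nat.
Hypothesis Hl : forall s v x y, d x y <= s -> `|idx v x - idx v y| <= (Nl s)%:Z.
Variable NI : nat.
Hypothesis HI : forall v n, `|idx v (pt v n) - n| <= NI%:Z.
Variable cs : nat.
Hypothesis Hcs : forall x m, `|ix (act (zexpg k m) x) - (m + ix x)| <= cs%:Z.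
Variables (K : nat) (a : nat -> G).
Hypothesis Hal : forall x i j,
  K%:Z < `|ix (act (a i)^-1%g x)| -> K%:Z < `|ix (act (a j)^-1%g x)| -> i = j.
Variables (H0 N : nat).
Hypothesis Hcount : forall x y (m : nat) (tt : R) (s : seq G), uniq s ->
  (forall v, v \in s -> [/\ `|idx v x| <= K%:Z, H0%:Z <= idx v y &
     tt <= d x (pt v (K + D)%N%:Z) <= tt + m%:R]) -> (size s <= N * m.+1)%N.

(* the gap between the two sides of a wall exceeds the errors in wall_sep and
   wall_quad, and far_idx leaves room behind the wall for passing and counting
   *)
Definition base_idx : int := (K + D)%N%:Z.
Definition wall_lo : int := base_idx + D%:Z.
Definition wall_margin : nat := (D + Nl (r + 1) + NI + Nm r + 1)%N.
Definition wall_mid : int := wall_lo + wall_margin%:Z.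
Definition wall_hi : int := wall_mid + wall_margin%:Z.
Definition far_idx : int := wall_hi + D%:Z + D%:Z + H0%:Z.

(** A wall is a translate together with an orientation, [true] being the
direction of increasing indices. *)
Definition Lw (u : G * bool) (p : X) : Prop :=
  if u.2 then idx u.1 p <= wall_lo else wall_hi <= idx u.1 p.
Definition Rw (u : G * bool) (p : X) : Prop :=
  if u.2 then wall_hi <= idx u.1 p else idx u.1 p <= wall_lo.
Definition wflip (u : G * bool) : G * bool := (u.1, ~~ u.2).
Definition wmid (u : G * bool) : X := pt u.1 wall_mid.

Lemma wall_disj u p : Lw u p -> Rw u p -> False.
Proof.
rewrite /Lw /Rw; case: u.2; rewrite /wall_hi /wall_mid /wall_margin; lia.
Qed.

Lemma wall_flipL u p : Lw (wflip u) p <-> Rw u p.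
Proof. by rewrite /Lw /Rw /wflip /=; case: u.2. Qed.

Lemma wall_flipR u p : Rw (wflip u) p <-> Lw u p.
Proof. by rewrite /Lw /Rw /wflip /=; case: u.2. Qed.

Lemma wall_pass u x y : Lw u x -> Rw u y -> btw r x (wmid u) y.
Proof.
rewrite /Lw /Rw /wmid; case: u => v [] /= hx hy.
  by apply: HGP; move: hx hy; rewrite /wall_hi /wall_mid /wall_margin; lia.
by apply: btw_sym; apply: HGP; move: hx hy; rewrite /wall_hi /wall_mid /wall_margin; lia.
Qed.

Lemma wall_sep u q : Lw u q \/ Rw u q -> r + 1 < d (wmid u) q.
Proof.
move=> h; rewrite ltNge; apply/negP => /Hl => /(_ u.1).
have := HI u.1 wall_mid; move: h; rewrite /Lw /Rw /wmid /wall_hi /wall_mid /wall_margin.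
case: u.2; lia.
Qed.

(** The first two pairs of points would give a geodesic crossing [u] to the left
of [w], and the last two one crossing [u] to the right of [w]; both pass the
middle point of [u], which would be on both sides of [w]. *)
Lemma wall_quad u w x y z p : Lw u x -> Lw w x -> Rw u y -> Lw w y ->
  Lw u z -> Rw w z -> Rw u p -> Rw w p -> False.
Proof.
move=> h1 h2 h3 h4 h5 h6 h7 h8.
have b1 := wall_pass h1 h3; have b2 := wall_pass h5 h7.
move: h2 h4 h6 h8; rewrite /Lw /Rw; case: w.2 => h2 h4 h6 h8.
  have [e1 _] := Hm w.1 wall_lo b1; have [_ e2] := Hm w.1 wall_hi b2.
  have := e1 h2 h4; have := e2 h6 h8; rewrite /wall_hi /wall_mid /wall_margin; lia.
have [_ e1] := Hm w.1 wall_hi b1; have [e2 _] := Hm w.1 wall_lo b2.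
have := e1 h2 h4; have := e2 h6 h8; rewrite /wall_hi /wall_mid /wall_margin; lia.
Qed.

(** The translates followed by the geodesics from [x] to [y], starting at their
origin. *)
Definition crossing (x y : X) (v : G) : Prop := `|idx v x| <= K%:Z /\ far_idx <= idx v y.

(** A point [p] that is neither to the right of [v] nor to the left of [v']
would force a geodesic from [p] to [y] to go back to [v] after passing [v']. *)
Lemma crossing_lt x y v v' : crossing x y v -> crossing x y v' ->
  d x (pt v base_idx) + d (orb base_idx) (orb (wall_hi + D%:Z)) + 2 * r < d x (pt v' base_idx) ->
  wlt Lw Rw (v, true) (v', true).
Proof.
move=> [vx vy] [vx' vy'] far; apply/asboolP => p; rewrite /Lw /Rw /=.
have [|lt1] := leP wall_hi (idx v p); first by left.
have [|lt2] := leP (idx v' p) wall_lo; first by right.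
exfalso; set z := pt v (wall_hi + D%:Z); set z' := pt v' base_idx.
have b1 : btw r p z y by apply: HGP; move: vx vy vx' vy' lt1 lt2; rewrite /far_idx; lia.
have b2 : btw r x z' p.
  by apply: HGP; move: vx vy vx' vy' lt1 lt2; rewrite /wall_lo /base_idx; lia.
have b3 : btw r x z' y.
  apply: HGP; move: vx vy vx' vy' lt1 lt2; rewrite /far_idx /wall_hi /wall_mid /wall_margin /wall_lo /base_idx; lia.
move: b1 b2 b3; rewrite /btw.
have t1 := tri p z' y; have t2 := tri x z p; have t3 := tri x z y.
have t4 := tri x (pt v base_idx) z; rewrite (dpt isoact) in t4.
move: t1 t2 t3 t4; rewrite (dsym p z') (dsym p z).
move: far; have := r0; rewrite -/z'; lra.
Qed.

(** Greedy choice: keep the crossing entered first, discard the boundedly many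
entered at about the same distance from [x], and go on; what is kept is ordered
by [crossing_lt]. *)
Lemma crossing_chain : exists c : nat, forall x y s, uniq s ->
  (forall v, v \in s -> crossing x y v) ->
  exists2 t, chain Lw Rw x y t & (size s <= c * size t)%N.
Proof.
have [m Hmm] := nat_ub (d (orb base_idx) (orb (wall_hi + D%:Z)) + 2 * r).
exists (N * m.+1)%N => x y s.
suff main : forall n s, (size s <= n)%N -> uniq s -> (forall v, v \in s -> crossing x y v) ->
    exists t : seq G, [/\ {subset t <= s}, pairwise (wlt Lw Rw) [seq (v, true) | v <- t] &
      (size s <= N * m.+1 * size t)%N].
  move=> us Hs; have [t [ts pt' st]] := main (size s) s (leqnn _) us Hs.
  exists [seq (v, true) | v <- t]; last by rewrite size_map.
  split=> // _ /mapP[v vt ->]; have [vx vy] := Hs v (ts v vt).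
  rewrite /Lw /Rw /=; move: vx vy; rewrite /far_idx /wall_hi /wall_mid /wall_lo /base_idx; lia.
move=> {s}; elim=> [|n IH] s sn us Hs.
  by exists [::]; split=> //; move: sn; case: (s).
case E : s => [|w0 s0]; first by exists [::].
have w0s : w0 \in s by rewrite E mem_head.
(* v0 is a crossing with base point nearest to x *)
have [v0 v0s v0min] : exists2 v0, v0 \in s & forall v, v \in s -> d x (pt v0 base_idx) <= d x (pt v base_idx).
  move: (s) w0s => l; elim: l w0 {E} => // u l IHl w0 _.
  case: l IHl => [_|u' l IHl].
    by exists u; rewrite ?mem_head // => v; rewrite inE => /eqP ->.
  have [v0 v0l Hv0] := IHl u' (mem_head _ _).
  have [le|lt] := leP (d x (pt u base_idx)) (d x (pt v0 base_idx)).
    exists u; first exact: mem_head.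
    move=> v; rewrite inE => /orP[/eqP-> //|/Hv0]; exact: le_trans.
  exists v0; first by rewrite inE v0l orbT.
  by move=> v; rewrite inE => /orP[/eqP->|/Hv0 //]; exact: ltW.
rewrite -E => {E}.
pose far v := d x (pt v0 base_idx) + m%:R < d x (pt v base_idx).
have v0nf : ~~ far v0 by rewrite /far -leNgt lerDl.
have sz : size s = (size [seq v <- s | far v] + size [seq v <- s | ~~ far v])%N.
  by rewrite !size_filter -(count_predC far s).
have nfar : (size [seq v <- s | ~~ far v] <= N * m.+1)%N.
  apply: (Hcount (x := x) (y := y) (tt := d x (pt v0 base_idx))); first exact: filter_uniq.
  move=> v; rewrite mem_filter => /andP[nf vs]; have [vx vy] := Hs v vs; split=> //.
    by move: vy; rewrite /far_idx /wall_hi /wall_mid /wall_lo /base_idx; lia.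
  by rewrite (v0min v vs) /=; move: nf; rewrite /far -leNgt.
have nfar0 : (0 < size [seq v <- s | ~~ far v])%N.
  have : v0 \in [seq v <- s | ~~ far v] by rewrite mem_filter v0nf.
  by case: [seq v <- s | _].
have szf : (size [seq v <- s | far v] <= n)%N.
  by move: sn; rewrite sz => h; rewrite -ltnS; apply: leq_trans h; rewrite -addn1 leq_add2l.
have Hf v : v \in [seq v <- s | far v] -> crossing x y v.
  by rewrite mem_filter => /andP[_ /Hs].
have [t [ts ptw st]] := IH _ szf (filter_uniq _ us) Hf.
exists (v0 :: t); split.
- by move=> v; rewrite inE => /orP[/eqP->//|/ts]; rewrite mem_filter => /andP[].
- rewrite /= ptw andbT; apply/allP => _ /mapP[v vt ->].
  have := ts v vt; rewrite mem_filter => /andP[fv vs].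
  apply: (crossing_lt (Hs _ v0s) (Hs _ vs)).
  by move: fv; rewrite /far; apply: le_lt_trans; rewrite -addrA lerD2l.
- by rewrite sz /= mulnS addnC; apply: leq_add.
Qed.

(** If [y] is between [x] and [x'], a translate followed on both ways to [y] has
its base point close to [y]: this point is between [x] and [y] and between [x']
and [y], so going from [x] to [x'] through [y] passes it twice. *)
Lemma crossing_backtrack : exists c : R -> nat, forall D1 x x' y s,
  btw D1 x y x' -> uniq s ->
  (forall v, v \in s -> crossing x y v /\ `|idx v x'| <= K%:Z) ->
  (size s <= c D1)%N.
Proof.
apply: (@choice_ex _ _ (fun D1 c => forall x x' y s, btw D1 x y x' -> uniq s ->
  (forall v, v \in s -> crossing x y v /\ `|idx v x'| <= K%:Z) ->
  (size s <= c)%N)) => D1.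
have [m Hmm] := nat_ub (D1 + 2 * r).
exists (N * m.+1)%N => x x' y s xyx us Hs.
apply: (Hcount (x := x) (y := y) (tt := d x y - (D1 / 2 + r))) => // v vs.
have [[vx vy] vx'] := Hs v vs; split=> //.
  by move: vy; rewrite /far_idx /wall_hi /wall_mid /wall_lo /base_idx; lia.
have b1 : btw r x (pt v base_idx) y.
  by apply: HGP; move: vx vy; rewrite /far_idx /wall_hi /wall_mid /wall_lo /base_idx; lia.
have b2 : btw r x' (pt v base_idx) y.
  by apply: HGP; move: vx' vy; rewrite /far_idx /wall_hi /wall_mid /wall_lo /base_idx; lia.
move: xyx b1 b2; rewrite /btw -/base_idx.
have := tri x (pt v base_idx) x'; have := tri x (pt v base_idx) y.
rewrite (dsym (pt v base_idx) x') (dsym y x').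
have := tri x y x'; rewrite (dsym y x').
have := dge0 (pt v base_idx) y => h0 h00 h1 h2 h3 h4 h5; apply/andP; split; lra.
Qed.

Variable Ca : R.
Hypothesis HCa : forall i, (i < 5)%N ->
  d (act (a i) (orb base_idx)) o <= Ca /\ d (act (a i) o) o <= Ca.
Variable Qn : G -> G -> nat.
Hypothesis HQ : forall h w s, uniq s ->
  (forall v, v \in s -> crossing o (act w o) v /\ `|idx v (act h^-1%g o)| <= K%:Z) ->
  (size s <= Qn h w)%N.

Definition r1 : R := r + 2 * Ca.
Definition ins_slack : int := (K + cs + Nm r1 + 1)%N%:Z.
Definition ins_power : int := far_idx + D%:Z + D%:Z + 1 + ins_slack.
(** The element inserted between two letters, a power of [k] in the translate [a
i] long enough for [good_end]. *)
Definition ins (i : nat) : G := (a i * zexpg k ins_power * (a i)^-1)%g.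

Definition ok (x : X) (i : nat) : Prop := `|ix (act (a i)^-1%g x)| <= K%:Z.

(** Each of four points is bad for at most one of five translates. *)
Lemma exists_ok (x1 x2 x3 x4 : X) :
  exists2 i, (i < 5)%N & [/\ ok x1 i, ok x2 i, ok x3 i & ok x4 i].
Proof.
apply: contrapT => none.
have bad i : (i < 5)%N -> exists j : 'I_4,
    K%:Z < `|ix (act (a i)^-1%g (nth x1 [:: x1; x2; x3; x4] j))|.
  move=> i5; apply: contrapT => nb; apply: none; exists i => //.
  have g j : (j < 4)%N -> `|ix (act (a i)^-1%g (nth x1 [:: x1; x2; x3; x4] j))| <= K%:Z.
    by move=> j4; rewrite leNgt; apply/negP => h; apply: nb; exists (Ordinal j4).
  by split; [exact: (g 0%N isT)|exact: (g 1%N isT)|exact: (g 2%N isT)|exact: (g 3%N isT)].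
have [J HJ] : exists J : 'I_5 -> 'I_4, forall i : 'I_5,
    K%:Z < `|ix (act (a i)^-1%g (nth x1 [:: x1; x2; x3; x4] (J i)))|.
  by apply: (@choice_ex _ _ (fun (i : 'I_5) (j : 'I_4) =>
    K%:Z < `|ix (act (a i)^-1%g (nth x1 [:: x1; x2; x3; x4] j))|)) => i; exact: bad.
have Jinj : injective J.
  move=> i i' e; apply: val_inj; apply: (Hal (HJ i)).
  by have := HJ i'; rewrite e.
by have := leq_card _ Jinj; rewrite !card_ord.
Qed.

(** Here [E] is the product of the letters read so far together with the
insertions, [h] the product of the letters alone, [w] the current letter and
[w'] the next one.  Seen from the end of [w], the first three points are the
origin, the origin of the list without insertions and the start of [w]; the last
one is the end of [w'], seen from the end of the insertion. *)
Definition conds (E h w w' : G) (i : nat) : Prop :=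
  (i < 5)%N /\ [/\ ok (act (E * w)^-1%g o) i, ok (act (h * w)^-1%g o) i,
    ok (act w^-1%g o) i & ok (act w' o) i].

Fixpoint good (E h : G) (ws : seq G) (is_ : seq nat) : Prop :=
  match is_, ws with
  | i :: is', w :: ((w' :: _) as ws') =>
      conds E h w w' i /\ good (E * w * ins i)%g (h * w)%g ws' is'
  | [::], [:: _] => True
  | _, _ => False
  end.

Fixpoint gprod (E : G) (ws : seq G) (is_ : seq nat) : G :=
  match is_, ws with
  | i :: is', w :: ws' => gprod (E * w * ins i)%g ws' is'
  | _, w :: _ => (E * w)%g
  | _, _ => E
  end.

Lemma goodS E h w w' ws i is_ : good E h [:: w, w' & ws] (i :: is_) =
  (conds E h w w' i /\ good (E * w * ins i)%g (h * w)%g (w' :: ws) is_).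
Proof. by []. Qed.

Lemma gprodS E w ws i is_ :
  gprod E (w :: ws) (i :: is_) = gprod (E * w * ins i)%g ws is_.
Proof. by []. Qed.

Lemma good_exists E h w ws : exists is_, good E h (w :: ws) is_.
Proof.
elim: ws E h w => [|w' ws IH] E h w; first by exists [::].
have [i i5 [h1 h2 h3 h4]] := exists_ok (act (E * w)^-1%g o) (act (h * w)^-1%g o)
   (act w^-1%g o) (act w' o).
have [is_ Hg] := IH (E * w * ins i)%g (h * w)%g w'.
by exists (i :: is_).
Qed.

Lemma good_size E h ws is_ : good E h ws is_ -> size ws = (size is_).+1.
Proof.
elim: is_ E h ws => [|i is_ IH] E h [|w [|w' ws]] //= [_ Hg].
by have /= -> := IH (E * w * ins i)%g (h * w)%g (w' :: ws) Hg.
Qed.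

Lemma idx_ins E w i y : ok y i ->
  ins_power - (K + cs)%N%:Z <= idx (E * w * a i)%g (act (E * w * ins i)%g y).
Proof.
move=> oky; rewrite /idx /ins.
have -> : act (E * w * a i)^-1%g (act (E * w * (a i * zexpg k ins_power * (a i)^-1))%g y)
   = act (zexpg k ins_power) (act (a i)^-1%g y).
  rewrite -!(actM isoact); congr act.
  by rewrite -!mulgA !invgM -!mulgA !mulKg.
have := Hcs (act (a i)^-1%g y) ins_power; move: oky; rewrite /ok; lia.
Qed.

Lemma idx_ok E w i x : idx (E * w * a i)%g x = ix (act (a i)^-1%g (act (E * w)^-1%g x)).
Proof. by rewrite /idx invgM (actM isoact). Qed.

Lemma ins_near E w i q x y : (i < 5)%N ->
  btw r x (pt (E * w * a i)%g base_idx) y -> q = act (E * w)%g o -> btw r1 x q y.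
Proof.
move=> i5 b ->; have [c1 _] := HCa i5.
have dd : d (pt (E * w * a i)%g base_idx) (act (E * w)%g o) <= Ca.
  by rewrite /pt (actM isoact) (dact isoact).
move: b; rewrite /btw /r1.
have := tri x (pt (E * w * a i)%g base_idx) (act (E * w)%g o).
have := tri (act (E * w)%g o) (pt (E * w * a i)%g base_idx) y.
rewrite (dsym (act (E * w)%g o) (pt _ _)); lra.
Qed.

(** The whole remaining product lies far along the translate of the first
insertion.  By induction from the end of the list: it lies far along the next
inserted translate, so the starting point of that translate, which is far along
the first one, is between the origin and the end of the product, and projections
are monotone by [Hm]. *)
Lemma good_end E h w w' ws i is_ :
  good E h [:: w, w' & ws] (i :: is_) ->
  far_idx + D%:Z + D%:Z + 1 <= idx (E * w * a i)%g (act (gprod E [:: w, w' & ws] (i :: is_)) o).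
Proof.
elim: ws E h w w' i is_ => [|w'' ws IH] E h w w' i is_.
  case: is_ => [|i' is_]; last by case.
  move=> [[i5 [h1 h2 h3 h4]] _].
  rewrite /= (actM isoact); have := idx_ins E w h4; rewrite /ins_power /ins_slack; lia.
case: is_ => [|i' is_]; first by case.
move=> [[i5 [h1 h2 h3 h4]] Hg]; have {IH} := IH _ _ _ _ _ _ Hg.
move: Hg => [[i5' [h1' h2' h3' h4']] _].
set E' := (E * w * ins i)%g in h1' *.
set g' := gprod E' _ _; rewrite -[gprod E _ _]/g' => IH.
have b1 : btw r o (pt (E' * w' * a i')%g base_idx) (act g' o).
  apply: HGP.
    by move: h1'; rewrite idx_ok /ok /base_idx; lia.
  by move: IH; rewrite /far_idx /wall_hi /wall_mid /wall_margin /wall_lo /base_idx; lia.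
have b2 := ins_near i5' b1 erefl.
have k1 := idx_ins E w h4.
rewrite leNgt; apply/negP => lt.
have [m1 _] := Hm (E * w * a i)%g (far_idx + D%:Z + D%:Z + 1) b2.
have : idx (E * w * a i)%g (act (E' * w')%g o) <= far_idx + D%:Z + D%:Z + 1 + (Nm r1)%:Z.
  apply: m1; last exact: ltW.
  move: h1; rewrite idx_ok /ok; rewrite /far_idx /wall_hi /wall_mid /wall_margin /wall_lo /base_idx; lia.
move: k1; rewrite -/E' (actM isoact E' w') /ins_power /ins_slack; lia.
Qed.

(** The properties of the first inserted translate that can be expressed without
the letter that precedes it: these are what the decoding knows. *)
Definition cand (E h g' v : G) : Prop :=
  [/\ `|idx v (act E o)| <= K%:Z, `|idx v (act E (act h^-1%g o))| <= K%:Z &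
     far_idx + D%:Z + D%:Z + 1 <= idx v (act g' o)].

Lemma good_cand E h w w' ws i is_ :
  good E h [:: w, w' & ws] (i :: is_) ->
  cand E h (gprod E [:: w, w' & ws] (i :: is_)) (E * w * a i)%g.
Proof.
move=> Hg; split; last exact: good_end Hg.
  move: Hg => [[_ [_ _ h3 _]] _]; rewrite idx_ok.
  by rewrite invgM (actM isoact) (actVK isoact).
move: Hg => [[_ [_ h2 _ _]] _]; rewrite idx_ok.
by rewrite invgM (actM isoact) (actVK isoact) -(actM isoact w^-1%g) -invgM.
Qed.

(** The candidates [v] entered no later than the true one.  If the end [u o] of
the current letter lies far along [v], then [v] is a translate crossed between
the two ends of this letter, and is counted by [Qn].  If not, the geodesic from
[u o] to the end still passes [v], so that [v] is entered near [u o]. *)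
Lemma cand_window : exists N0 : nat, forall E h g' w i s, (i < 5)%N ->
  cand E h g' (E * w * a i)%g -> uniq s ->
  (forall v, v \in s -> cand E h g' v /\
      d (act E o) (act v o) <= d (act E o) (act (E * w * a i)%g o)) ->
  (size s <= N0 + Qn h w)%N.
Proof.
set cM := d o (orb (far_idx + D%:Z)).
set c4 := Ca + cM + r1 + r + d (orb (far_idx + D%:Z)) (orb base_idx).
have [m Hmm] := nat_ub (2 * c4).
exists (N * m.+1)%N => E h g' w i s i5 cu us Hs.
set u := (E * w)%g in cu Hs.
pose P v := far_idx <= idx v (act u o).
have -> : size s = (size [seq v <- s | ~~ P v] + size [seq v <- s | P v])%N.
  by rewrite addnC !size_filter -(count_predC P s).
apply: leq_add; last first.
  rewrite -(size_map (fun v => E^-1 * v)%g); apply: HQ.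
    by rewrite map_inj_uniq ?filter_uniq // => v v' /mulgI.
  move=> _ /mapP[v + ->]; rewrite mem_filter => /andP[Pv vs].
  have [[c1 c2 c3] _] := Hs v vs.
  have eq x : idx (E^-1 * v)%g x = idx v (act E x).
    by rewrite -[x in LHS](actVK isoact E) (idx_act isoact).
  by split; [split|]; rewrite eq // -(actM isoact).
(* u o is close to the true insertion, hence between E o and the end g' o *)
have ub : btw r1 (act E o) (act u o) (act g' o).
  apply: (@ins_near E w i _ _ _ i5 _ erefl); apply: HGP; case: cu => c1 c2 c3.
    by move: c1; rewrite -/u /base_idx; lia.
  by move: c3; rewrite -/u /far_idx /wall_hi /wall_mid /wall_margin /wall_lo /base_idx; lia.
have uc : d (act E o) (act (u * a i)%g o) <= d (act E o) (act u o) + Ca.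
  have [_ c5] := HCa i5.
  have := tri (act E o) (act u o) (act (u * a i)%g o).
  rewrite (actM isoact u) (dsym (act u o)) (dact isoact); lra.
apply: (Hcount (x := act E o) (y := act g' o) (tt := d (act E o) (act u o) - c4)).
  exact: filter_uniq.
move=> v; rewrite mem_filter /P -ltNge => /andP[nP vs].
have [[v1 v2 v3] v4] := Hs v vs; split=> //.
  by move: v3; rewrite /far_idx /wall_hi /wall_mid /wall_lo /base_idx; lia.
set z := pt v (far_idx + D%:Z).
have b1 : btw r (act u o) z (act g' o) by apply: HGP; move: v3 nP; lia.
have dvz : d (act v o) z = cM by rewrite /z /pt (dact isoact).
have dz0 : d z (pt v base_idx) = d (orb (far_idx + D%:Z)) (orb base_idx) by rewrite (dpt isoact).
have t1 := tri (act E o) (act v o) z; have t2 := tri (act E o) z (act g' o).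
have t3 := tri (act u o) z (pt v base_idx); have t4 := tri (act E o) (act u o) (pt v base_idx).
have t5 := tri (act E o) (pt v base_idx) (act u o).
move: b1 ub v4; rewrite /btw -/base_idx -/u => b1 ub v4.
have du : d (act u o) (pt v base_idx) <= c4.
  by move: b1 ub v4 t1 t2 t3 t4 uc; rewrite dvz dz0 /c4; lra.
move: t5; rewrite (dsym (pt v base_idx) (act u o)) => t5.
apply/andP; split; lra.
Qed.

Lemma exists_num : exists N0 : nat, exists num : G -> G -> G -> G -> nat,
  (forall E h g' w i, (i < 5)%N -> cand E h g' (E * w * a i)%g ->
      (num E h g' (E * w * a i)%g < N0 + Qn h w)%N) /\
  (forall E h g' v v', cand E h g' v -> cand E h g' v' ->
      num E h g' v = num E h g' v' -> v = v').
Proof.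
have [N0 HN0] := cand_window; exists N0.
have five : (0 < 5)%N by [].
have ex (t : G * G * G) : exists num : G -> nat,
  (forall w i, (i < 5)%N -> cand t.1.1 t.1.2 t.2 (t.1.1 * w * a i)%g ->
      (num (t.1.1 * w * a i)%g < N0 + Qn t.1.2 w)%N) /\
  (forall v v', cand t.1.1 t.1.2 t.2 v -> cand t.1.1 t.1.2 t.2 v' ->
      num v = num v' -> v = v').
  case: t => [[E h] g'] /=.
  have [v cv|num [H1 H2]] := @exists_rank G R (cand E h g') (fun v => d (act E o) (act v o)).
    have ev : v = (E * (E^-1 * v * (a 0%N)^-1) * a 0%N)%g by rewrite mulgA mulgVK mulVKg.
    exists (N0 + Qn h (E^-1 * v * (a 0%N)^-1)%g)%N => s us Hs.
    by apply: (HN0 E h g' _ 0%N) => //; rewrite -ev.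
  exists num; split=> // w i i5 cw; apply: H1 => // s us Hs.
  exact: (HN0 E h g' w i).
have [num Hnum] := choice_ex ex.
exists (fun E h g' => num (E, h, g')); split.
  by move=> E h g' w i; apply: (Hnum (E, h, g')).1.
by move=> E h g' v v'; apply: (Hnum (E, h, g')).2.
Qed.

Section Codes.
Variables (N0 : nat) (num : G -> G -> G -> G -> nat).
Hypothesis num_lt : forall E h g' w i, (i < 5)%N -> cand E h g' (E * w * a i)%g ->
      (num E h g' (E * w * a i)%g < N0 + Qn h w)%N.
Hypothesis num_inj : forall E h g' v v', cand E h g' v -> cand E h g' v' ->
      num E h g' v = num E h g' v' -> v = v'.

(** The rank of the inserted translate and the label of the insertion, in one
number. *)
Fixpoint codes (E h g' : G) (ws : seq G) (is_ : seq nat) : seq nat :=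
  match is_, ws with
  | i :: is', w :: ws' => (5 * num E h g' (E * w * a i)%g + i)%N ::
      codes (E * w * ins i)%g (h * w)%g g' ws' is'
  | _, _ => [::]
  end.

Lemma codesS E h g' w ws i is_ : codes E h g' (w :: ws) (i :: is_) =
  (5 * num E h g' (E * w * a i)%g + i)%N ::
      codes (E * w * ins i)%g (h * w)%g g' ws is_.
Proof. by []. Qed.

(** Decoding from the left: [E], [h] and the product [g'] are known, so the code
gives the label [i] and the translate [E * w * a i], hence the letter [w]. *)
Lemma codes_inj ws ws' E h is_ is' :
  good E h ws is_ -> good E h ws' is' -> gprod E ws is_ = gprod E ws' is' ->
  codes E h (gprod E ws is_) ws is_ = codes E h (gprod E ws is_) ws' is' -> ws = ws'.
Proof.
elim: is_ ws ws' E h is' => [|i is_ IH] ws ws' E h is'.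
  case: ws => [|w [|w2 ws]] // _; case: is' => [|i' is']; case: ws' => [|w' [|w2' ws']] //=.
  by move=> _ /mulgI ->.
case: ws => [|w [|w2 ws]]; [by case|by case|].
case: is' ws' => [|i' is'] [|w' [|w2' ws']]; try by move=> _ [].
move=> Hg Hg' e; have c1 := good_cand Hg; have c2 := good_cand Hg'.
rewrite -e in c2.
move: Hg Hg' e c1 c2.
rewrite !goodS !gprodS !codesS.
set g' := gprod _ (w2 :: ws) is_.
move=> [[i5 _] Hg] [[i5' _] Hg'] e c1 c2 /eqP; rewrite eqseq_cons => /andP[/eqP ec /eqP er].
have en : num E h g' (E * w * a i)%g = num E h g' (E * w' * a i')%g by lia.
have ei : i = i' by lia.
have := num_inj c1 c2 en; rewrite ei => /mulIg /mulgI ew.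
rewrite ew; congr (_ :: _).
apply: (IH _ _ (E * w * ins i)%g (h * w)%g is') => //.
- by rewrite ew ei.
- by rewrite -/g' e ew ei.
- by rewrite -/g' er ew ei.
Qed.

(** Each code is below the bound given by the product of the letters before and
the current letter; the last letter has no code. *)
Fixpoint code_ok (b : G -> G -> nat) (h : G) (ws : seq G) (cs_ : seq nat) : Prop :=
  match cs_, ws with
  | c :: cs', w :: ws' => (c < b h w)%N /\ code_ok b (h * w)%g ws' cs'
  | [::], [:: _] => True
  | _, _ => False
  end.

Lemma codes_ok E h ws is_ g' : good E h ws is_ -> g' = gprod E ws is_ ->
  code_ok (fun h w => 5 * (N0 + Qn h w))%N h ws (codes E h g' ws is_).
Proof.
elim: is_ E h ws => [|i is_ IH] E h ws; first by case: ws => [|w [|w2 ws]].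
case: ws => [|w [|w2 ws]]; [by case|by case|].
move=> Hg eg; have c1 := good_cand Hg; rewrite -eg in c1.
move: Hg eg; rewrite goodS gprodS => -[[i5 _] Hg] eg.
have lt := num_lt i5 c1.
split; first by lia.
exact: IH.
Qed.

Variable len : G -> nat.
Hypothesis lenM : forall x y, (len (x * y)%g <= len x + len y)%N.

Lemma gprod_len E h ws is_ : good E h ws is_ ->
  (len (gprod E ws is_) <= len E + \sum_(w <- ws) len w +
     (\sum_(i < 5) len (ins i)) * size is_)%N.
Proof.
elim: is_ E h ws => [|i is_ IH] E h ws.
  case: ws => [|w [|w2 ws]] //= _; rewrite big_seq1 muln0 addn0; exact: lenM.
case: ws => [|w [|w2 ws]]; [by case|by case|].
rewrite goodS gprodS => -[[i5 _] Hg].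
apply: leq_trans (IH _ _ _ Hg) _.
have := lenM (E * w)%g (ins i); have := lenM E w.
have : (len (ins i) <= \sum_(i < 5) len (ins i))%N.
  by rewrite (bigD1 (Ordinal i5)) //= leq_addr.
rewrite [in X in _ -> _ -> _ -> (_ <= X)%N]big_cons [size (_ :: _)]/= mulnS.
lia.
Qed.

Lemma encoding : exists (cF : nat) (enc : seq G -> G * seq nat),
  [/\ forall ws, ws != [::] -> code_ok (fun h w => 5 * (N0 + Qn h w))%N 1%g ws (enc ws).2,
   forall ws, ws != [::] ->
     (len (enc ws).1 <= len 1%g + \sum_(w <- ws) len w + cF * size ws)%N &
   forall ws ws', ws != [::] -> ws' != [::] -> enc ws = enc ws' -> ws = ws'].
Proof.
have [is_ His] : exists is_ : seq G -> seq nat, forall ws, ws != [::] -> good 1%g 1%g ws (is_ ws).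
  apply: (@choice_ex _ _ (fun ws is_ => ws != [::] -> good 1%g 1%g ws is_)) => -[|w ws].
    by exists [::].
  by have [is_ H] := good_exists 1%g 1%g w ws; exists is_.
exists (\sum_(i < 5) len (ins i))%N, (fun ws => (gprod 1%g ws (is_ ws),
   codes 1%g 1%g (gprod 1%g ws (is_ ws)) ws (is_ ws))); split.
- move=> ws ws0; exact: codes_ok (His ws ws0) erefl.
- move=> ws ws0; apply: leq_trans (gprod_len (His ws ws0)) _.
  by rewrite leq_add2l leq_mul2l (good_size (His ws ws0)) leqnSn orbT.
- move=> ws ws' ws0 ws0' [e1 e2].
  apply: (codes_inj (His ws ws0) (His ws' ws0') e1).
  by rewrite e2 e1.
Qed.

End Codes.

End Build.

(** * The geometric input of the count *)

Section Geometry.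
Variables (R : realType) (G : groupType) (X : metricType R) (act : G -> X -> X).
Hypotheses (geoX : geodesic_space X) (isoact : isometric_action act).

Lemma axis_of f : strongly_contracting act f ->
  exists p C ix, axis act f p C /\ forall x, nearest_index act f p x (ix x).
Proof.
move=> [_ [p [qi sc]]]; have [C ax] := axis_of_contracting_orbit qi sc.
have [ix Hix] := choice_ex (fun x => exists_nearest_index x ax).
by exists p, C, ix.
Qed.

(** The positions [t] lying between the origin and each of the earlier positions
from [s0] on. *)
Definition lowpos (D : G -> R) (E : R) (p : nat -> G) (s0 s1 : nat) : seq nat :=
  [seq t <- iota s0 (s1 - s0) | `[< forall t', (s0 <= t' <= t)%N ->
     D ((p t')^-1 * p t)%g + D (p t) <= D (p t') + E >] ].

(** All that the count uses of the geometry.  [T] is the wall distance from [o],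
and [b h w] bounds the codes at the letter [w] after the prefix [h].  The
inequality on [lowpos] says that, up to a term [2 * (s1 - s0) / D0], a piece of
path increases [T] by as much as the wall length of the piece, unless it has low
positions: it combines [common_chain] and [low_count].  The elements [k ^ i * h
^ j] provide quadratically many elements of linear displacement. *)
Theorem walls_and_encoding (h k : G) :
  strongly_contracting act h -> WPD act h ->
  strongly_contracting act k -> WPD act k -> independent h k ->
  exists (o : X) (T : G -> nat) (b : G -> G -> nat), let D g := mdist o (act g o) in
  [/\ exists cT : nat, forall h w, (b h w <= cT * (1 + T w))%N,
      exists B : R -> nat, forall E h w, D w + D (h * w)%g <= D h + E -> (b h w <= B E)%N,
      exists c : R, forall w, (T w)%:R <= D w + c,
      (forall K : R, 0 <= K -> exists cK : nat, forall D0, (0 < D0)%N -> exists E : R,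
        forall (p : nat -> G) s0 s1, (s0 <= s1)%N ->
        (forall t, (s0 <= t < s1)%N -> D ((p t)^-1 * p t.+1)%g <= K) ->
        (D0 * (T (p s0) + T ((p s0)^-1 * p s1)%g) <=
         D0 * (T (p s1) + 6 + cK * size (lowpos D E p s0 s1)) + 2 * (s1 - s0))%N) &
      (forall len : G -> nat, (forall x y, (len (x * y)%g <= len x + len y)%N) ->
        exists (cF : nat) (enc : seq G -> G * seq nat),
        [/\ forall ws, ws != [::] -> code_ok b 1%g ws (enc ws).2,
         forall ws, ws != [::] ->
           (len (enc ws).1 <= len 1%g + \sum_(w <- ws) len w + cF * size ws)%N &
         forall ws ws', ws != [::] -> ws' != [::] -> enc ws = enc ws' -> ws = ws']) /\
      (exists c : R, forall t : nat, exists s : seq G,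
        [/\ uniq s, size s = (t.+1 * t.+1)%N & forall w, w \in s -> D w <= c * t.+1%:R])].
Proof.
move=> sch wpdh sck wpdk indep.
have [ph [Ch [ix1 [ax1 Hix1]]]] := axis_of sch.
have [ o [C [ix [ax Hix]]]] := axis_of sck.
have [K [a Hal]] := align_family geoX isoact ax1 ax Hix1 Hix wpdh wpdk indep.
have [D [r [r0 Hpass HGP]]] := idx_pass geoX isoact ax Hix.
have [Nm Hm] := idx_mono geoX isoact ax Hix.
have [Nl Hl] := idx_lip geoX isoact ax Hix.
have [NI HI] := idx_pt isoact ax Hix.
have [cs Hcs] := ix_shift isoact ax Hix.
have [H0 [N Hcount]] := count_window geoX isoact wpdk r0 Hpass K.
pose LW := Lw act ix D r Nm Nl NI K.
pose RW := Rw act ix D r Nm Nl NI K.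
pose MID := wmid act k o D r Nm Nl NI K.
have Wdisj : forall u p, LW u p -> RW u p -> False.
  by move=> u p h1 h2; exact: (wall_disj r0 h1 h2).
have WfL : forall u p, LW (wflip u) p <-> RW u p by move=> u p; apply: wall_flipL.
have WfR : forall u p, RW (wflip u) p <-> LW u p by move=> u p; apply: wall_flipR.
have Wp : forall u x y, LW u x -> RW u y -> btw r x (MID u) y.
  by move=> u x y h1 h2; exact: (wall_pass r0 HGP h1 h2).
have Ws : forall u q, LW u q \/ RW u q -> r + 1 < mdist (MID u) q.
  by move=> u q h1; exact: (wall_sep r0 Hl HI h1).
have Wq : forall u w x y z p, LW u x -> LW w x -> RW u y -> LW w y ->
  LW u z -> RW w z -> RW u p -> RW w p -> False.
  by move=> u w x y z p h1 h2 h3 h4 h5 h6 h7 h8; exact: (wall_quad r0 HGP Hm h1 h2 h3 h4 h5 h6 h7 h8).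
have [TX HTX] := exists_wall_distance r0 Wp Ws.
have Tub x y s : chain LW RW x y s -> (size s <= TX x y)%N by apply: (HTX x y).1.
have Tex x y : exists2 s, chain LW RW x y s & size s = TX x y by apply: (HTX x y).2.
pose T g := TX o (act g o).
(* translating walls by g does not change the length of chains; one inequality
   is enough below *)
have Tact g z : (TX o (act g^-1%g z) <= TX (act g o) z)%N.
  have [s [ps Hs] <-] := Tex o (act g^-1%g z).
  have LWg u p : LW (g * u.1, u.2)%g p <-> LW u (act g^-1%g p).
    by rewrite /LW /Lw /= -{1 2}(actKV isoact g p) !(idx_act isoact).
  have RWg u p : RW (g * u.1, u.2)%g p <-> RW u (act g^-1%g p).
    by rewrite /RW /Rw /= -{1 2}(actKV isoact g p) !(idx_act isoact).
  rewrite -(size_map (fun u => (g * u.1, u.2)%g)); apply: Tub; split.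
    rewrite pairwise_map; apply: sub_pairwise ps => u w /asboolP uw.
    apply/asboolP => p; have [h1|h1] := uw (act g^-1%g p).
      by left; apply/RWg.
    by right; apply/LWg.
  move=> _ /mapP[u /Hs [h1 h2] ->]; split; last by apply/RWg.
  by apply/LWg; rewrite (actVK isoact).
have [cQ HcQ] := crossing_chain isoact r0 HGP Nm Nl NI Hcount.
have [cC HcC] := crossing_backtrack r0 HGP Nm Nl NI Hcount.
pose Qset hh w v := crossing act ix D r Nm Nl NI K H0 o (act w o) v /\ `|idx act ix v (act hh^-1%g o)| <= K%:Z.
have Qb hh w s : uniq s -> (forall v, v \in s -> Qset hh w v) -> (size s <= cQ * T w)%N.
  move=> us Hs; have [t ct st] := HcQ o (act w o) s us (fun v vs => (Hs v vs).1).
  by apply: leq_trans st _; rewrite leq_mul2l Tub ?orbT.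
have [Qn HQn] : exists Qn : G * G -> nat, forall hw,
    (forall s, uniq s -> (forall v, v \in s -> Qset hw.1 hw.2 v) -> (size s <= Qn hw)%N) /\
    (exists s, [/\ uniq s, forall v, v \in s -> Qset hw.1 hw.2 v & size s = Qn hw]).
  apply: (@choice_ex _ _ (fun hw n =>
    (forall s, uniq s -> (forall v, v \in s -> Qset hw.1 hw.2 v) -> (size s <= n)%N) /\
    (exists s, [/\ uniq s, forall v, v \in s -> Qset hw.1 hw.2 v & size s = n]))) => -[hh w] /=.
  have [s us Hs] := finite_enumeration (Qb hh w).
  exists (size s); split.
    by move=> s' us' Hs'; apply: uniq_leq_size => // v /Hs' /Hs.
  by exists s; split=> // v /Hs.
have [Ca HCa] : exists Ca : R, forall i, (i < 5)%N ->
    mdist (act (a i) (orb act k o (base_idx D K))) o <= Ca /\ mdist (act (a i) o) o <= Ca.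
  exists (\sum_(i < 5) (mdist (act (a i) (orb act k o (base_idx D K))) o + mdist (act (a i) o) o)) => i i5.
  rewrite (bigD1 (Ordinal i5)) //=; set rest := \sum_(i < _ | _) _.
  have rest0 : 0 <= rest by apply: sumr_ge0 => j _; rewrite addr_ge0 ?dge0.
  have := dge0 (act (a i) (orb act k o (base_idx D K))) o; have := dge0 (act (a i) o) o.
  move: rest0; move: rest => rest; lra.
have HQ hh w s : uniq s -> (forall v, v \in s -> Qset hh w v) -> (size s <= Qn (hh, w))%N.
  exact: (HQn (hh, w)).1.
have [N0 [num [num_lt num_inj]]] := exists_num isoact r0 HGP Hcount HCa HQ.
exists o, T, (fun hh w => 5 * (N0 + Qn (hh, w)))%N => Dg.
have C1 := axisC ax.
have tri3 g g' : Dg (g * g')%g <= Dg g + Dg g'.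
  rewrite /Dg; have := tri o (act g o) (act (g * g')%g o).
  by rewrite (actM isoact) (dact isoact).
split.
- exists (5 * (N0 + cQ))%N => hh w.
  have [s [us Hs <-]] := (HQn (hh, w)).2.
  have := Qb hh w s us Hs; nia.
- exists (fun E => 5 * (N0 + cC E))%N => E hh w le.
  have [s [us Hs <-]] := (HQn (hh, w)).2.
  have : (size s <= cC E)%N.
    apply: (HcC E o (act hh^-1%g o) (act w o)) => //.
    move: le; rewrite /btw /Dg (dsym (act w o)) (dactV isoact) invgK -(actM isoact).
    by rewrite -(dactV isoact hh o o) (dsym (act hh o)).
  lia.
- exists (r + 1) => w; exact: (T_le r0 Wp Ws Tex).
- move=> KK KK0; have [c Hc] := nat_ub (KK + (r + 1)).
  exists (2 * c.+1)%N => D0 D00; exists (3 * r + 2 * (D0.+1%:R * KK)) => p s0 s1 s01 pK.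
  pose q t := act (p t) o.
  have qd t t' : mdist (q t) (q t') = Dg ((p t)^-1 * p t')%g.
    by rewrite /q /Dg (actM isoact) (dactV isoact).
  have qo t : mdist (q t) o = Dg (p t) by rewrite dsym.
  have [s [cb c1 cT]] := common_chain r0 WfL WfR Wq Tub Tex (q s0) o (q s1).
  have qK t : (s0 <= t < s1)%N -> mdist (q t) (q t.+1) <= KK.
    by move=> ht; rewrite qd; apply: pK.
  have := low_count r0 Wdisj Wp Ws KK0 s01 qK cb c1 Hc D00.
  have -> : lows q o s0 s1 (3 * r + 2 * (D0.+1%:R * KK)) =
      lowpos Dg (3 * r + 2 * (D0.+1%:R * KK)) p s0 s1.
    apply: eq_filter => t; apply/asbool_equiv_eq; split=> H t' ht'.
      by have := H t' ht'; rewrite qd !qo.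
    by have := H t' ht'; rewrite qd !qo.
  set L := size _.
  have e1 : (T (p s0) <= TX (q s0) o)%N by apply: (T_sym_le WfL WfR Tub Tex).
  have e2 : (T ((p s0)^-1 * p s1)%g <= TX (q s0) (q s1))%N.
    by rewrite /T (actM isoact); apply: Tact.
  have e3 : TX o (q s1) = T (p s1) by [].
  move: cT; rewrite e3 => cT lc.
  have := leq_mul (leqnn D0) (leq_trans (leq_add e1 e2) cT); nia.
- split.
    move=> len lenM.
    have [cF [enc [E1 E2 E3]]] := encoding isoact r0 HGP Hm Hcs Hal HCa num_lt num_inj lenM.
    by exists cF, enc.
  exists (Dg k + Dg h) => t.
  have Dpow g (i : nat) : Dg (g ^+ i)%g <= i%:R * Dg g.
    elim: i => [|i IH]; first by rewrite expg0 mul0r /Dg (act1 isoact) mdistxx.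
    by rewrite expgSr -natr1 mulrDl mul1r; apply: le_trans (tri3 _ _) _; rewrite lerD2r.
  exists [seq (k ^+ i * h ^+ j)%g | i <- iota 0 t.+1, j <- iota 0 t.+1]; split.
  - apply: allpairs_uniq; rewrite ?iota_uniq // => -[i j] [i' j'] _ _ /= e.
    have e2 : zexpg k (i%:Z - i'%:Z) = zexpg h (j'%:Z - j%:Z).
      rewrite (addrC i%:Z) !zexpgD !zexpgN /=.
      apply: (@mulgI _ (k ^+ i')%g); rewrite mulVKg.
      apply: (@mulIg _ (h ^+ j)%g); by rewrite mulgA !mulgVK.
    have i0 : i%:Z - i'%:Z = 0.
      apply/eqP; apply: contrapT => /negP ne.
      exact: (indep_nocommon_sym ax1 ax indep ne e2).
    have j0 : j'%:Z - j%:Z = 0.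
      apply/eqP; apply: contrapT => /negP ne.
      by apply: (indep_nocommon ax1 indep (n := 0) ne); rewrite -e2 i0.
    by congr (_, _); lia.
  - by rewrite size_allpairs !size_iota.
  - move=> _ /allpairsP[[i j] [it jt ->]].
    move: it jt; rewrite !mem_iota [(i, j).1]/= [(i, j).2]/= => it jt.
    apply: le_trans (tri3 _ _) _; rewrite mulrDl; apply: lerD.
      apply: le_trans (Dpow _ _) _; rewrite mulrC ler_wpM2l ?dge0 // ler_nat; lia.
    apply: le_trans (Dpow _ _) _; rewrite mulrC ler_wpM2l ?dge0 // ler_nat; lia.
Qed.

End Geometry.

(** * Words over a finite alphabet *)

Section Words.
Variable R : realType.

Fixpoint words (A : Type) (l : seq A) (q : nat) : seq (seq A) :=
  if q is q'.+1 then [seq c :: cs | c <- l, cs <- words l q'] else [:: [::]].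

Lemma mem_words (A : eqType) (l : seq A) q cs :
  (cs \in words l q) = (size cs == q) && all (mem l) cs.
Proof.
elim: q cs => [|q IH] [|c cs] //=.
  by apply/allpairsP => -[[? ?] [_ _]].
rewrite eqSS; apply/allpairsP/idP => [[[c' cs'] /= [cl]]|/and3P[sz cl csl]].
  by rewrite IH => /andP[sz csl] [-> ->]; rewrite sz cl csl.
by exists (c, cs); split=> //; rewrite IH sz csl.
Qed.

Lemma size_words (A : Type) (l : seq A) q : size (words l q) = (size l ^ q)%N.
Proof. by elim: q => //= q IH; rewrite size_allpairs IH expnS. Qed.

Lemma words_uniq (A : eqType) (l : seq A) q : uniq l -> uniq (words l q).
Proof.
move=> ul; elim: q => //= q IH; apply: allpairs_uniq => // -[c cs] [c' cs'] _ _ /=.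
by case=> -> ->.
Qed.

Lemma sum_words (l : seq nat) q (theta : nat -> R) :
  \sum_(cs <- words l q) \prod_(c <- cs) theta c = (\sum_(c <- l) theta c) ^+ q.
Proof.
elim: q => [|q IH] /=; first by rewrite big_seq1 big_nil expr0.
rewrite big_allpairs_dep exprS big_distrl /=; apply: eq_bigr => c _.
rewrite -IH big_distrr /=; apply: eq_bigr => cs _; by rewrite big_cons.
Qed.

Lemma sum_sub (A : eqType) (s1 s2 : seq A) (F : A -> R) :
  uniq s1 -> {subset s1 <= s2} -> (forall x, 0 <= F x) ->
  \sum_(x <- s1) F x <= \sum_(x <- s2) F x.
Proof.
move=> + + F0; elim: s1 s2 => [|x s1 IH] s2 /=.
  by move=> _ _; rewrite big_nil; apply: sumr_ge0.
move=> /andP[xs1 us1] sub; have xs2 : x \in s2 by apply: sub; rewrite mem_head.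
rewrite big_cons (big_rem _ xs2) /= lerD2l; apply: IH => // y ys1.
have : y \in s2 by apply: sub; rewrite inE ys1 orbT.
rewrite (perm_mem (perm_to_rem xs2)) inE => /orP[/eqP yx|//].
by move: xs1; rewrite -yx ys1.
Qed.

End Words.

(** * The word metric *)

Section WordMetric.
Variables (G : groupType) (S : set G).
Hypotheses (finS : finite_set S) (symS : symmetric_set S) (genS : generates S).

Local Notation len := (word_length S).

Lemma word_exists g : exists n, is_word_length S g n.
Proof.
pose H : set G := [set g | exists n, is_word_length S g n].
suff HT : H = setT by have : H g by rewrite HT.
apply: genS.
  split.
  - by exists 0%N, [::]; rewrite big_nil.
  - move=> x y [_ [wx [_ Hx ->]]] [_ [wy [_ Hy ->]]].
    exists (size (wx ++ wy)), (wx ++ wy); split=> //; last by rewrite big_cat.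
    by move=> s; rewrite mem_cat => /orP[/Hx|/Hy].
  - move=> x [_ [wx [_ Hx ->]]].
    exists (size (rev [seq s^-1%g | s <- wx])), (rev [seq s^-1%g | s <- wx]); split=> //.
      by move=> s; rewrite mem_rev => /mapP[s' /Hx Ss' ->]; apply: symS.
    elim: wx {Hx} => [|a wx IH]; first by rewrite !big_nil invg1.
    by rewrite big_cons invgM IH /= rev_cons -cats1 big_cat big_seq1.
move=> s Ss; exists 1%N, [:: s]; split=> //; last by rewrite big_seq1.
by move=> s'; rewrite inE => /eqP->.
Qed.

Lemma len_spec g : is_word_length S g (len g) /\
  forall n, is_word_length S g n -> (len g <= n)%N.
Proof.
rewrite /word_length; case: pselect => [ex|nex].
  case: ex_minnP => n /asboolP Hn nmin; split=> // m Hm.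
  by apply: nmin; apply/asboolP.
by exfalso; apply: nex; have [n Hn] := word_exists g; exists n; apply/asboolP.
Qed.

Lemma len_word (w : seq G) : (forall s, s \in w -> S s) ->
  (len (\prod_(s <- w) s)%g <= size w)%N.
Proof. by move=> Hw; apply: (len_spec _).2; exists w. Qed.

Lemma len1 : len 1%g = 0%N.
Proof.
by apply/eqP; rewrite -leqn0; have := @len_word [::]; rewrite big_nil; apply.
Qed.

Lemma lenM x y : (len (x * y)%g <= len x + len y)%N.
Proof.
have [[wx [sx Hx ex]] _] := len_spec x; have [[wy [sy Hy ey]] _] := len_spec y.
rewrite -sx -sy -size_cat {1}ex {1}ey -big_cat; apply: len_word.
by move=> s; rewrite mem_cat => /orP[/Hx|/Hy].
Qed.

Lemma geodesic_word g : exists p : nat -> G,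
  [/\ p 0%N = 1%g, p (len g) = g,
   forall t, (t < len g)%N -> S ((p t)^-1 * p t.+1)%g &
   forall s t, (s <= t <= len g)%N -> len ((p s)^-1 * p t)%g = (t - s)%N].
Proof.
have [[w [sw Hw eg]] _] := len_spec g.
pose p t := (\prod_(s <- take t w) s)%g.
have pD s t : (s <= t)%N -> ((p s)^-1 * p t = \prod_(x <- drop s (take t w)) x)%g.
  move=> st; have -> : p t = (p s * \prod_(x <- drop s (take t w)) x)%g.
    by rewrite /p -{1}(cat_take_drop s (take t w)) big_cat take_takel.
  by rewrite mulKg.
have lenp s t : (s <= t <= len g)%N -> (len ((p s)^-1 * p t)%g <= t - s)%N.
  move=> /andP[st tl]; rewrite pD //.
  apply: leq_trans (len_word _) _.
    by move=> x /mem_drop /mem_take /Hw.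
  by rewrite size_drop size_take -sw in tl *; case: ifP; lia.
have p0 : p 0%N = 1%g by rewrite /p take0 big_nil.
have pl : p (len g) = g by rewrite /p -sw take_size -eg.
exists p; split=> //.
- move=> t tl; rewrite pD //.
  rewrite (take_nth 1%g) ?sw // drop_rcons ?drop_oversize ?size_take ?sw ?tl //.
  by rewrite big_seq1; apply: Hw; apply: mem_nth; rewrite sw.
- move=> s t st; apply/eqP; rewrite eqn_leq lenp //=.
  have h1 := lenp 0%N s; have h2 := lenp t (len g).
  rewrite p0 invg1 mul1g in h1; rewrite pl in h2.
  have : (len g <= len (p s) + len ((p s)^-1 * p t)%g + len ((p t)^-1 * g)%g)%N.
    apply: leq_trans (leq_add (lenM _ _) (leqnn _)).
    by apply: leq_trans (lenM _ _); rewrite mulVKg mulVKg.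
  have := h1 ltac:(lia); have := h2 ltac:(lia); lia.
Qed.

Lemma ball_finite n : exists2 B : seq G, uniq B & forall g, (g \in B) = (len g <= n)%N.
Proof.
have /finite_seqP [F HF] := finS.
pose W := flatten [seq words F i | i <- iota 0 n.+1].
exists [seq g <- undup [seq (\prod_(s <- w) s)%g | w <- W] | (len g <= n)%N].
  by rewrite filter_uniq ?undup_uniq.
move=> g; rewrite mem_filter mem_undup; have [gn|//] := leqP (len g) n.
have [[w [sw Hw eg]] _] := len_spec g.
apply: (introT mapP); exists w => //; apply/flattenP; exists (words F (len g)).
  by apply/mapP; exists (len g) => //; rewrite mem_iota.
rewrite mem_words sw eqxx; apply/allP => s /Hw; by rewrite HF.
Qed.

End WordMetric.

(** * Cutting a geodesic word *)

Section Cutting.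
Variables (G : groupType) (len : G -> nat).

(** The letters obtained from the path [p] of [g] by cutting it at [s] and at
the times [ts]. *)
Fixpoint pieces (p : nat -> G) (g : G) (s : nat) (ts : seq nat) : seq G :=
  if ts is t :: ts' then ((p s)^-1 * p t)%g :: pieces p g t ts'
  else [:: ((p s)^-1 * g)%g].

Definition geodpath (g : G) (p : nat -> G) : Prop :=
  [/\ p 0%N = 1%g, p (len g) = g &
   forall s t, (s <= t <= len g)%N -> len ((p s)^-1 * p t)%g = (t - s)%N].

Lemma pieces_size p g s ts : size (pieces p g s ts) = (size ts).+1.
Proof. by elim: ts s => //= t ts IH s; rewrite IH. Qed.

Lemma pieces_neq0 p g s ts : pieces p g s ts != [::].
Proof. by rewrite -size_eq0 pieces_size. Qed.

Lemma pieces_prod p g s ts : (p s * \prod_(w <- pieces p g s ts) w)%g = g.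
Proof.
elim: ts s => [|t ts IH] s /=; first by rewrite big_seq1 mulVKg.
by rewrite big_cons mulgA mulVKg IH.
Qed.

Lemma pieces_len p g s ts : geodpath g p -> path leq s ts -> all (fun t => t <= len g)%N (s :: ts) ->
  (\sum_(w <- pieces p g s ts) len w = len g - s)%N.
Proof.
move=> [p0 pl pd]; elim: ts s => [|t ts IH] s /=.
  by move=> _ /andP[sl _]; rewrite big_seq1 -{1}pl pd // sl leqnn.
move=> /andP[st pt'] /and3P[sl tl al]; rewrite big_cons IH //= ?tl // pd ?st ?tl //.
lia.
Qed.

Lemma pieces_inj p g s ts ts' : geodpath g p -> path leq s ts -> path leq s ts' ->
  all (fun t => t <= len g)%N ts -> all (fun t => t <= len g)%N ts' ->
  size ts = size ts' -> pieces p g s ts = pieces p g s ts' -> ts = ts'.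
Proof.
move=> [p0 pl pd]; elim: ts s ts' => [|t ts IH] s [|t' ts'] //=.
move=> /andP[st pt1] /andP[st' pt2] /andP[tl al] /andP[tl' al'] [sz] [e1 e2].
have e : t = t'.
  by have := congr1 len e1; rewrite !pd ?st ?st' ?tl ?tl' //; lia.
by subst t'; rewrite (IH t ts').
Qed.

Variable b : G -> G -> nat.

(** Bounds the weight of a code from below by a product over the pieces; [F s t]
is a lower bound for the weights of all codes that the piece from [s] to [t] may
receive. *)
Lemma code_pieces (R : realType) (theta : nat -> R) (F : nat -> nat -> R) p g s ts cs :
  (forall s t, 0 <= F s t) ->
  path (fun s t => `[< forall c, (c < b (p s) ((p s)^-1 * p t)%g)%N -> F s t <= theta c >]) s ts ->
  code_ok b (p s) (pieces p g s ts) cs ->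
  size cs = size ts /\
  \prod_(x <- pairmap F s ts) x <= \prod_(c <- cs) theta c.
Proof.
move=> F0; elim: ts s cs => [|t ts IH] s [|c cs] //=.
- by move=> _ _; rewrite !big_nil.
- by move=> _ [_]; case: cs.
- by move=> _; case: (pieces _ _ _ _) (pieces_neq0 p g t ts).
move=> /andP[/asboolP st pt'] [cb]; rewrite mulVKg => ok'.
have [-> le] := IH t cs pt' ok'; split=> //.
have prod0 u l : 0 <= \prod_(x <- pairmap F u l) x.
  by elim: l u => [|v l IHl] u /=; rewrite ?big_nil ?ler01 // big_cons mulr_ge0.
by rewrite !big_cons; apply: ler_pM => //; apply: st.
Qed.

End Cutting.

(** * Weighted counting *)

Section Balls.
Variables (R : realType) (G : groupType) (len : G -> nat).
Hypothesis len1 : len 1%g = 0%N.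
Variable pth : G -> nat -> G.
Hypothesis Hpth : forall g, geodpath len g (pth g).
Variable Bl : nat -> seq G.
Hypothesis Bl_uniq : forall n, uniq (Bl n).
Hypothesis mem_Bl : forall n g, (g \in Bl n) = (len g <= n)%N.

Local Notation bn n := (size (Bl n)).

Lemma ball_ge1 n : (0 < bn n)%N.
Proof.
have : 1%g \in Bl n by rewrite mem_Bl len1.
by case: (Bl n).
Qed.

Lemma ball_mono m n : (m <= n)%N -> (bn m <= bn n)%N.
Proof.
by move=> mn; apply: uniq_leq_size => // g; rewrite !mem_Bl => /leq_trans; apply.
Qed.

Lemma ball_add n c : (bn (n + c) <= bn n * bn c)%N.
Proof.
rewrite -(size_allpairs (fun x y => (x * y)%g) (Bl n) (Bl c)).
apply: uniq_leq_size => // g; rewrite mem_Bl => gl.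
have [p0 pl pd] := Hpth g.
apply/allpairsP; exists (pth g (minn n (len g)), ((pth g (minn n (len g)))^-1 * g)%g); split => /=.
- have := pd 0%N (minn n (len g)); rewrite p0 invg1 mul1g mem_Bl => ->; lia.
- have := pd (minn n (len g)) (len g); rewrite pl mem_Bl => ->; lia.
- by rewrite mulVKg.
Qed.

Lemma ball_mul n c q : (bn (n + c * q) <= bn n * bn c ^ q)%N.
Proof.
elim: q => [|q IH]; first by rewrite muln0 addn0 expn0 muln1.
rewrite mulnS (addnC c) addnA expnSr mulnA.
by apply: leq_trans (ball_add _ _) _; rewrite leq_mul2r IH orbT.
Qed.

Variables (b : G -> G -> nat) (cF : nat) (enc : seq G -> G * seq nat).
Hypothesis enc_ok : forall ws, ws != [::] -> code_ok b 1%g ws (enc ws).2.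
Hypothesis enc_len : forall ws, ws != [::] ->
  (len (enc ws).1 <= len 1%g + \sum_(w <- ws) len w + cF * size ws)%N.
Hypothesis enc_inj : forall ws ws', ws != [::] -> ws' != [::] -> enc ws = enc ws' -> ws = ws'.

Lemma code_ok_size h ws cs : code_ok b h ws cs -> size ws = (size cs).+1.
Proof.
elim: cs h ws => [|c cs IH] h [|w ws] //=; first by case: ws.
by move=> [_ /IH ->].
Qed.

(** By injectivity of the encoding, the total weight of the codes of [P] is at
most that of all pairs of a ball element and a list of [q] codes, which
factorises. *)
Lemma weighted_count (theta : nat -> R) (beta W : R) (q n : nat) (P : seq (seq G)) :
  (forall c, 0 <= theta c) ->
  (forall B, \sum_(c <- iota 0 B) theta c <= W) ->
  uniq P ->
  (forall ws, ws \in P -> [/\ size ws = q.+1, (\sum_(w <- ws) len w <= n)%N &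
      beta <= \prod_(c <- (enc ws).2) theta c]) ->
  (size P)%:R * beta <= (bn (n + cF * q.+1))%:R * W ^+ q.
Proof.
move=> th0 HW uP HP.
have ws0 ws : ws \in P -> ws != [::].
  by move=> /HP [sz _ _]; rewrite -size_eq0 sz.
pose B := (\max_(ws <- P) \max_(c <- (enc ws).2) c).+1.
have cB ws c : ws \in P -> c \in (enc ws).2 -> (c < B)%N.
  move=> wsP cw; rewrite ltnS (big_rem _ wsP) /=; apply: leq_trans (leq_maxl _ _).
  by rewrite (big_rem _ cw) /= leq_maxl.
pose target := [seq (g, cs) | g <- Bl (n + cF * q.+1), cs <- words (iota 0 B) q].
have prod0 (cs : seq nat) : 0 <= \prod_(c <- cs) theta c.
  by elim: cs => [|c cs IH]; rewrite ?big_nil ?ler01 // big_cons mulr_ge0.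
apply: (@le_trans _ _ (\sum_(e <- map enc P) \prod_(c <- e.2) theta c)).
  have -> : (size P)%:R * beta = \sum_(ws <- P) beta.
    by rewrite big_const_seq count_predT iter_addr_0 mulr_natl.
  rewrite big_map.
  rewrite big_seq [X in _ <= X]big_seq; apply: ler_sum => ws /HP [].
  by [].
apply: (@le_trans _ _ (\sum_(e <- target) \prod_(c <- e.2) theta c)).
  apply: sum_sub.
  - rewrite map_inj_in_uniq // => ws ws' wP wP'; apply: enc_inj; exact: ws0.
  - move=> _ /mapP[ws wP ->]; have [sz sl _] := HP ws wP.
    apply/allpairsP; exists (enc ws); split; last by case: (enc ws).
      rewrite mem_Bl; apply: leq_trans (enc_len (ws0 _ wP)) _.
      by rewrite len1 add0n sz leq_add2r.
    rewrite mem_words; apply/andP; split.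
      by have := code_ok_size (enc_ok (ws0 _ wP)); rewrite sz => -[->].
    apply/allP => c /(cB _ _ wP) cltB.
    by have : c \in iota 0 B by rewrite mem_iota.
  - by move=> e; apply: prod0.
rewrite big_allpairs_dep /= big_const_seq count_predT iter_addr_0.
rewrite sum_words -[X in X <= _]mulr_natl; apply: ler_wpM2l; first exact: ler0n.
apply: lerXn2r; last exact: (HW B).
  rewrite nnegrE.
  by apply: sumr_ge0.
by rewrite nnegrE; apply: le_trans (HW 0%N); rewrite big_nil.
Qed.

(** The weighted count for the lists obtained by cutting the geodesic words of
the elements of [Al] in at least [Z] ways each.  Different cuts give different
lists, since the lengths of the pieces are the gaps between the cuts. *)
Lemma family_count (I : finType) (Al : seq G) (Ig : G -> {set I}) (tsf : G -> I -> seq nat)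
    (F : G -> nat -> nat -> R) (theta : nat -> R) (beta W : R) (q n Z : nat) :
  (forall c, 0 <= theta c) -> 0 <= beta ->
  (forall B, \sum_(c <- iota 0 B) theta c <= W) ->
  (forall g s t, 0 <= F g s t) ->
  uniq Al -> (forall g, g \in Al -> len g = n /\ (Z <= #|Ig g|)%N) ->
  (forall g i, g \in Al -> i \in Ig g ->
     [/\ path leq 0%N (tsf g i), all (fun t => t <= n)%N (tsf g i), size (tsf g i) = q,
      path (fun s t => `[< forall c, (c < b (pth g s) ((pth g s)^-1 * pth g t)%g)%N ->
          F g s t <= theta c >]) 0%N (tsf g i) &
      beta <= \prod_(x <- pairmap (F g) 0%N (tsf g i)) x]) ->
  (forall g i i', g \in Al -> i \in Ig g -> i' \in Ig g -> tsf g i = tsf g i' -> i = i') ->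
  (size Al)%:R * Z%:R * beta <= (bn (n + cF * q.+1))%:R * W ^+ q.
Proof.
move=> th0 b0 HW F0 uA HA Hts tinj.
pose P := [seq pieces (pth g) g 0 (tsf g i) | g <- Al, i <- enum (Ig g)].
have p1 g : pth g 0%N = 1%g by have [] := Hpth g.
have szP : (size Al * Z <= size P)%N.
  rewrite size_allpairs_dep sumnE big_map.
  have -> : (size Al * Z = \sum_(g <- Al) Z)%N by rewrite big_const_seq count_predT iter_addn_0 mulnC.
  rewrite big_seq [X in (_ <= X)%N]big_seq; apply: leq_sum => g /HA [_].
  by rewrite cardE.
have uP : uniq P.
  apply: allpairs_uniq_dep => //; first by move=> g _; apply: enum_uniq.
  move=> [g i] [g' i'] /allpairsPdep [g1 [i1 [g1A + e1]]] /allpairsPdep [g2 [i2 [g2A + e2]]].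
  rewrite !mem_enum => i1I i2I /= e.
  have [eg ei] : g = g1 /\ i = i1 by case: e1.
  have [eg' ei'] : g' = g2 /\ i' = i2 by case: e2.
  subst g g' i i'.
  have gg : g1 = g2.
    have := congr1 (fun ws => \prod_(w <- ws) w)%g e => /= h.
    have pr g ts : (\prod_(w <- pieces (pth g) g 0 ts) w)%g = g.
      by have := pieces_prod (pth g) g 0 ts; rewrite p1 mul1g.
    by move: h; rewrite !pr.
  subst g2; have [h1 h2 h3 _ _] := Hts _ _ g1A i1I; have [h1' h2' h3' _ _] := Hts _ _ g1A i2I.
  have [ln _] := HA g1 g1A.
  suff -> : i1 = i2 by [].
  apply: (tinj g1) => //; apply: (pieces_inj (Hpth g1) h1 h1') e; rewrite ?ln ?h3 ?h3' //.
apply: le_trans (weighted_count (q := q) (n := n) (P := P) (beta := beta) (W := W) th0 HW uP _).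
  by apply: ler_wpM2r => //; rewrite -natrM ler_nat.
move=> _ /allpairsPdep [g [i [gA + ->]]]; rewrite mem_enum => iI.
have [h1 h2 h3 h4 h5] := Hts _ _ gA iI; have [ln _] := HA g gA.
split.
- by rewrite pieces_size h3.
- by rewrite (pieces_len (Hpth g)) ?ln ?subn0 //= h2.
- have := enc_ok (pieces_neq0 (pth g) g 0 (tsf g i)).
  rewrite -[X in code_ok _ X](p1 g) => /(code_pieces (F0 g) h4) [_].
  exact: le_trans.
Qed.

End Balls.

(** * The two cases *)

Lemma bin_lower k N : (k <= N)%N -> (N ^ k <= k ^ k * 'C(N, k))%N.
Proof.
move=> kN.
rewrite -(leq_pmul2r (fact_gt0 k)) -mulnA bin_ffact -(ffactnn k) !ffact_prod.
rewrite -[k in (N ^ k)%N]card_ord -[k in (k ^ k)%N]card_ord -!prod_nat_const -!big_split /=.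
rewrite !card_ord; apply: leq_prod => i _; have := ltn_ord i; nia.
Qed.

(** One cut in each of [m] consecutive intervals of length [l]. *)
Definition cuts (m l : nat) (x : {ffun 'I_m -> 'I_l}) : seq nat :=
  [seq (j * l + x j)%N | j : 'I_m <- enum 'I_m].

Lemma cuts_sorted m l (x : {ffun 'I_m -> 'I_l}) : path leq 0%N (cuts x).
Proof.
rewrite path_min_sorted; last by apply/allP.
rewrite sorted_map; apply: (@sub_sorted _ (relpre val ltn)).
  by move=> i j /= ij; have := ltn_ord (x i); nia.
by rewrite -sorted_map val_enum_ord iota_ltn_sorted.
Qed.

Lemma cuts_le m l n (x : {ffun 'I_m -> 'I_l}) : (m * l <= n)%N ->
  all (fun t => t <= n)%N (cuts x).
Proof.
move=> ml; apply/allP => _ /mapP[j _ ->].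
by have := ltn_ord (x j); have := ltn_ord j; nia.
Qed.

Lemma size_cuts m l (x : {ffun 'I_m -> 'I_l}) : size (cuts x) = m.
Proof. by rewrite size_map size_enum_ord. Qed.

Lemma cuts_gap m l (x : {ffun 'I_m -> 'I_l}) :
  path (fun s t => t <= s + 2 * l)%N 0%N (cuts x).
Proof.
have srt : sorted (fun i j : 'I_m => val j == (val i).+1) (enum 'I_m).
  have -> : sorted (fun i j : 'I_m => val j == (val i).+1) (enum 'I_m) =
     sorted (fun i j : nat => j == i.+1) (map val (enum 'I_m)) by rewrite sorted_map.
  rewrite val_enum_ord.
  have H k a : path (fun i j => j == i.+1) a (iota a.+1 k).
    by elim: k a => //= k IH a; rewrite eqxx IH.
  by case: (m) => //= k; apply: H.
have {}srt : sorted (fun s t => t <= s + 2 * l)%N (cuts x).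
  rewrite sorted_map; apply: sub_sorted srt => i j /= /eqP ->.
  by have := ltn_ord (x j); nia.
case: m x srt => [|m] x srt; first by rewrite /cuts (size0nil (size_enum_ord 0)).
move: srt; rewrite /cuts enum_ordSl /= => ->; rewrite andbT.
by have := ltn_ord (x ord0); lia.
Qed.

Lemma bernoulli (R : realType) (y : R) n : 0 <= y <= 1 -> 1 - n%:R * y <= (1 - y) ^+ n.
Proof.
move=> /andP[y0 y1]; elim: n => [|n IH]; first by rewrite mul0r subr0 expr0.
rewrite exprS; apply: le_trans (_ : (1 - y) * (1 - n%:R * y) <= _); last by rewrite ler_wpM2l // subr_ge0.
rewrite -natr1; have : 0 <= n%:R * (y * y) by rewrite !mulr_ge0.
lra.
Qed.

Lemma geometric_sum (R : realType) (x : R) B : 0 <= x < 1 -> \sum_(c <- iota 0 B) x ^+ c <= (1 - x)^-1.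
Proof.
move=> /andP[x0 x1].
have e : \sum_(c <- iota 0 B) x ^+ c = (1 - x ^+ B) * (1 - x)^-1.
  have x1' : 1 - x != 0 by rewrite subr_eq0 gt_eqF.
  elim: B => [|B IH]; first by rewrite big_nil expr0 subrr mul0r.
  rewrite -addn1 iotaD big_cat /= big_seq1 IH add0n addn1 exprS.
  apply: (mulIf x1'); rewrite mulrDl !mulfVK //; ring.
rewrite e -[leRHS]mul1r; apply: ler_wpM2r; first by rewrite invr_ge0 subr_ge0 ltW.
by rewrite gerBl exprn_ge0.
Qed.

Lemma prod_pairmap_exp (R : realType) (x : R) (f : nat -> nat -> nat) s ts :
  \prod_(y <- pairmap (fun s t => x ^+ f s t) s ts) y = x ^+ sumn (pairmap f s ts).
Proof.
elim: ts s => [|t ts IH] s /=; first by rewrite big_nil expr0.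
by rewrite big_cons IH exprD.
Qed.

Lemma sumn_pairmap_lin (f : nat -> nat -> nat) c s ts :
  sumn (pairmap (fun s t => c * (1 + f s t))%N s ts) =
  (c * (size ts + sumn (pairmap f s ts)))%N.
Proof. by elim: ts s => [|t ts IH] s /=; [rewrite muln0|rewrite IH; nia]. Qed.

Lemma path_mem (A : eqType) (e1 e2 : rel A) s (l : seq A) :
  (forall x y, y \in l -> e1 x y -> e2 x y) -> path e1 s l -> path e2 s l.
Proof.
elim: l s => //= y l IH s H /andP[sy pl].
rewrite H ?mem_head // IH // => x z zl; apply: H.
by rewrite inE zl orbT.
Qed.

Lemma path_and (A : Type) (e1 e2 : rel A) s (l : seq A) :
  path e1 s l -> path e2 s l -> path (fun x y => e1 x y && e2 x y) s l.
Proof.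
by elim: l s => //= y l IH s /andP[h1 p1] /andP[h2 p2]; rewrite h1 h2 IH.
Qed.

Lemma pairmap_snd (A B : Type) (f : A -> B) s (l : seq A) :
  pairmap (fun _ t => f t) s l = [seq f t | t <- l].
Proof. by elim: l s => //= t l IH s; rewrite IH. Qed.

Lemma sum_indicator (B N' : nat) : (\sum_(c <- iota 0 N') (c < B)%N <= B)%N.
Proof.
have -> : (\sum_(c <- iota 0 N') (c < B)%N = count (fun c => c < B)%N (iota 0 N'))%N.
  by rewrite -sum1_count [RHS]big_mkcond; apply: eq_bigr => c _; case: ltnP.
rewrite -size_filter -[X in (_ <= X)%N](size_iota 0); apply: uniq_leq_size.
  by rewrite filter_uniq ?iota_uniq.
by move=> c; rewrite mem_filter mem_iota => /andP[cB _]; rewrite mem_iota.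
Qed.

(** Weight about 1 for codes below [B2] and [1 / B1] for those below [B1]: cheap
for small codes, and still of bounded total weight. *)
Lemma sum_two_level_weight (R : realType) (B1 B2 B : nat) : (0 < B1)%N ->
  \sum_(c <- iota 0 B) ((c < B2)%N%:R + (c < B1)%N%:R * (B1%:R)^-1) <= B2.+1%:R :> R.
Proof.
move=> B10; rewrite big_split /= -mulr_suml -!natr_sum -natr1.
apply: lerD; first by rewrite ler_nat sum_indicator.
apply: le_trans (_ : B1%:R * B1%:R^-1 <= _).
  by apply: ler_wpM2r; [rewrite invr_ge0 ler0n|rewrite ler_nat sum_indicator].
by rewrite mulfV // gt_eqF // ltr0n.
Qed.

Section Cases.
Variables (R : realType) (G : groupType) (len : G -> nat).
Hypothesis len1 : len 1%g = 0%N.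
Variable pth : G -> nat -> G.
Hypothesis Hpth : forall g, geodpath len g (pth g).
Variable Bl : nat -> seq G.
Hypothesis mem_Bl : forall n g, (g \in Bl n) = (len g <= n)%N.
Local Notation bn n := (size (Bl n)).
Variables (b : G -> G -> nat) (cF : nat) (enc : seq G -> G * seq nat).
Hypothesis enc_ok : forall ws, ws != [::] -> code_ok b 1%g ws (enc ws).2.
Hypothesis enc_len : forall ws, ws != [::] ->
  (len (enc ws).1 <= len 1%g + \sum_(w <- ws) len w + cF * size ws)%N.
Hypothesis enc_inj : forall ws ws', ws != [::] -> ws' != [::] -> enc ws = enc ws' -> ws = ws'.
Variable T : G -> nat.

Definition Tpair (g : G) (s t : nat) : nat := T ((pth g s)^-1 * pth g t)%g.

(** With [z = cT * (1 + rho)], the codes of such a list add up to at most [z *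
m]. The weights [x ^ c] with [x = 1 - 1 / (2 * z)] have sum [2 * z], and the
code of the list has weight at least [x ^ (z * m) >= 2 ^- m]. *)
Lemma case1_count (cT m l rho n : nat) (Al : seq G) :
  (0 < cT)%N -> (forall h w, (b h w <= cT * (1 + T w))%N) ->
  (m * l <= n)%N -> uniq Al ->
  (forall g, g \in Al -> len g = n /\
     forall x : {ffun 'I_m -> 'I_l}, (sumn (pairmap (Tpair g) 0%N (cuts x)) <= rho * m)%N) ->
  (size Al)%:R * (l ^ m)%:R * (2^-1) ^+ m <=
    (bn (n + cF * m.+1))%:R * (2 * (cT * (1 + rho))%:R) ^+ m :> R.
Proof.
move=> cT0 b_le ml uA HA; set z := (cT * (1 + rho))%N.
have z0 : (0 < z)%N by rewrite muln_gt0 cT0.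
have z1 : (1 : R) <= z%:R by rewrite ler1n.
pose y : R := (2 * z%:R)^-1.
have y01 : 0 <= y <= 1.
  rewrite invr_ge0 mulr_ge0 ?ler0n //= invf_le1; lra.
have zy : z%:R * y = 2^-1 by rewrite /y; field; rewrite pnatr_eq0 -lt0n.
pose x := 1 - y.
have y0 : 0 < y by rewrite invr_gt0; lra.
have x0 : 0 <= x by rewrite subr_ge0; case/andP: y01.
have x1 : x < 1 by rewrite /x; lra.
apply: (@family_count R G len len1 pth Hpth Bl mem_Bl b cF enc enc_ok enc_len enc_inj
  {ffun 'I_m -> 'I_l} Al (fun _ => [set: {ffun 'I_m -> 'I_l}]%SET) (fun _ => @cuts m l)
  (fun g s t => x ^+ (cT * (1 + Tpair g s t))) (fun c => x ^+ c)
  ((2^-1) ^+ m) (2 * z%:R) m n (l ^ m)%N) => //.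
- by move=> c; apply: exprn_ge0.
- by move=> B; apply: le_trans (geometric_sum B _) _; rewrite ?x0 //= /x opprB addrC subrK invrK.
- by move=> g s t; apply: exprn_ge0.
- by move=> g /HA [-> _]; split=> //; rewrite cardsT card_ffun !card_ord.
- move=> g i /HA [_ Hg] _; split.
  + exact: cuts_sorted.
  + exact: cuts_le.
  + exact: size_cuts.
  + have : path (fun _ _ => true) 0%N (cuts i) by elim: (cuts i) 0%N => //=.
    apply: sub_path => s t _; apply/asboolP => c cb.
    apply: ler_wiXn2l => //; first exact: ltW.
    by apply: leq_trans (ltnW cb) (b_le _ _).
  + rewrite (prod_pairmap_exp x (fun s t => cT * (1 + Tpair g s t))%N) sumn_pairmap_lin size_cuts.
    apply: (@le_trans _ _ (x ^+ (z * m))).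
      rewrite exprM; apply: lerXn2r; rewrite ?nnegrE ?exprn_ge0 //.
      by apply: le_trans (bernoulli z y01); rewrite zy; lra.
    apply: ler_wiXn2l => //; first exact: ltW.
    by have := Hg i; rewrite /z; nia.
- move=> g i i' _ _ _ e; apply/ffunP => j; apply: val_inj.
  have /eq_in_map/(_ j) := e; rewrite mem_enum => /(_ isT) h.
  by apply/eqP; rewrite -(eqn_add2l (j * l)); apply/eqP.
Qed.

Variable D : G -> R.
Variables (E : R) (D0 cK : nat).
Hypothesis Hlow : forall g s0 s1, (s0 <= s1 <= len g)%N ->
  (D0 * (T (pth g s0) + Tpair g s0 s1) <=
   D0 * (T (pth g s1) + 6 + cK * size (lowpos D E (pth g) s0 s1)) + 2 * (s1 - s0))%N.

Section OneElement.
Variable g : G.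
Local Notation p := (pth g).

(** Low positions other than the first one, so that they differ from the cuts.
*)
Definition inner (s t : nat) : seq nat := [seq i <- lowpos D E p s t | (s < i)%N].
Definition inners (s : nat) (cs : seq nat) : seq nat := flatten (pairmap inner s cs).
(** The cuts [cs] together with the low positions in [A]. *)
Definition merged (A : pred nat) (s : nat) (cs : seq nat) : seq nat :=
  flatten (pairmap (fun s t => rcons [seq i <- inner s t | A i] t) s cs).

Lemma mem_inner s t i : i \in inner s t -> (s < i < t)%N.
Proof.
rewrite mem_filter mem_filter mem_iota => /and3P[si _ /andP[_ it]].
rewrite si /=; lia.
Qed.

Lemma inners_spec s cs : path leq s cs ->
  [/\ uniq (inners s cs), forall i, i \in inners s cs -> (s < i)%N &
      forall i, i \in inners s cs -> i \notin cs].
Proof.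
rewrite /inners; elim: cs s => [|t cs IH] s //= /andP[st pt'].
have [u1 g1 n1] := IH t pt'.
have tcs : forall i, i \in cs -> (t <= i)%N.
  by move=> i ics; have := order_path_min leq_trans pt' => /allP /(_ i ics).
split.
- rewrite cat_uniq u1 andbT filter_uniq ?filter_uniq ?iota_uniq //=.
  apply/hasPn => i /g1 ti; apply/negP => /mem_inner; lia.
- move=> i; rewrite mem_cat => /orP[/mem_inner|/g1]; lia.
- move=> i; rewrite mem_cat inE negb_or => /orP[/mem_inner h|ii].
    apply/andP; split; first by apply/eqP; lia.
    by apply/negP => /tcs; lia.
  by rewrite n1 // andbT; apply/eqP; have := g1 i ii; lia.
Qed.

Lemma size_inner s t : (size (lowpos D E p s t) <= (size (inner s t)).+1)%N.
Proof.
rewrite /inner [X in (_ <= X.+1)%N]size_filter -(count_predC (fun i => s < i)%N (lowpos D E p s t)) -[X in (_ <= X)%N]addn1.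
rewrite leq_add2l.
have u : uniq (lowpos D E p s t) by rewrite filter_uniq ?iota_uniq.
rewrite -size_filter; apply: (@uniq_leq_size _ _ [:: s]); first exact: filter_uniq.
move=> i; rewrite !mem_filter mem_iota /= => /and3P[nsi _ /andP[si _]].
by rewrite mem_seq1 eqn_leq si leqNgt andbT.
Qed.

Lemma size_inners s cs :
  (sumn (pairmap (fun s t => size (lowpos D E p s t)) s cs) <= size (inners s cs) + size cs)%N.
Proof.
rewrite /inners; elim: cs s => [|t cs IH] s //=.
by have := IH t; have := size_inner s t; rewrite size_cat; lia.
Qed.

Lemma low_sum s cs : path leq s cs -> all (fun t => t <= len g)%N (s :: cs) ->
  (D0 * (T (p s) + sumn (pairmap (Tpair g) s cs)) <=
   D0 * (T (p (last s cs)) + 6 * size cs +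
         cK * sumn (pairmap (fun s t => size (lowpos D E p s t)) s cs)) +
   2 * (last s cs - s))%N.
Proof.
elim: cs s => [|t cs IH] s /=; first by rewrite subnn muln0 !addn0 muln0 !addn0.
move=> /andP[st pt'] /and3P[sl tl al].
have := IH t pt'; rewrite /= tl al => /(_ isT) h.
have h2 : (s <= t <= len g)%N by rewrite st tl.
have := Hlow h2.
have : (t <= last t cs)%N.
  have := order_path_min leq_trans pt' => /allP ha.
  have := mem_last t cs; rewrite inE => /orP[/eqP->//|]; exact: ha.
move: h; set a1 := T (p t); set a2 := sumn _; set a3 := last t cs; set a4 := size cs.
set a5 := sumn _; set a6 := size _; set a7 := T (p a3).
rewrite !mulnDr; nia.
Qed.

Lemma merged_cons A s t cs :
  merged A s (t :: cs) = rcons [seq i <- inner s t | A i] t ++ merged A t cs.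
Proof. by []. Qed.

Lemma mem_merged A s cs i : (i \in merged A s cs) = (i \in cs) || (A i && (i \in inners s cs)).
Proof.
elim: cs s => [|t cs IH] s; first by rewrite andbF.
rewrite merged_cons mem_cat mem_rcons IH !inE mem_filter /inners /= mem_cat.
by case: (i == t); case: (A i); case: (i \in inner s t); case: (i \in cs).
Qed.

Lemma size_merged A s cs :
  size (merged A s cs) = (size cs + size [seq i <- inners s cs | A i])%N.
Proof.
elim: cs s => [|t cs IH] s //.
by rewrite merged_cons size_cat size_rcons IH /inners /= filter_cat size_cat; lia.
Qed.

Lemma merged_path A s cs : path leq s cs -> path leq s (merged A s cs).
Proof.
elim: cs s => [|t cs IH] s // /andP[st pt'].
rewrite merged_cons cat_path last_rcons IH // andbT rcons_path.
have u : path leq s [seq i <- inner s t | A i].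
  rewrite path_min_sorted; last first.
    by apply/allP => i; rewrite mem_filter => /andP[_ /mem_inner]; lia.
  apply: sorted_filter; first exact: leq_trans.
  apply: sorted_filter; first exact: leq_trans.
  apply: sorted_filter; first exact: leq_trans.
  exact: iota_sorted.
rewrite u /=.
have := mem_last s [seq i <- inner s t | A i]; rewrite inE => /orP[/eqP->//|].
by rewrite mem_filter => /andP[_ /mem_inner /andP[_ /ltnW]].
Qed.

Lemma merged_le A s cs n : all (fun t => t <= n)%N cs ->
  all (fun t => t <= n)%N (merged A s cs).
Proof.
elim: cs s => [|t cs IH] s // /andP[tn al].
rewrite merged_cons all_cat IH // andbT all_rcons tn /=.
by apply/allP => i; rewrite mem_filter => /andP[_ /mem_inner]; lia.
Qed.

(** In the refined cutting, the gap ending at a low position of a piece starts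
in that piece, and the gap ending at an old cut is shorter than the old one. *)
Lemma merged_rel (e : rel nat) A s cs : path leq s cs ->
  path (fun s t => `[< forall i, (s <= i <= t)%N -> e i t >]) s cs ->
  (forall s t i j, j \in inner s t -> (s <= i <= j)%N -> e i j) ->
  path e s (merged A s cs).
Proof.
move=> + + He; elim: cs s => [|t cs IH] s // /andP[st pt'] /andP[/asboolP et pe].
rewrite merged_cons cat_path last_rcons IH // andbT.
have gen l s' : (s <= s')%N -> path leq s' (rcons l t) ->
    all (fun j => j \in inner s t) l -> path e s' (rcons l t).
  elim: l s' => [|j l IHl] s' /= ss'.
    by rewrite !andbT => s't _; apply: et; rewrite ss' s't.
  move=> /andP[s'j pj] /andP[jin al].
  apply/andP; split; last by apply: IHl => //; apply: leq_trans s'j.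
  by apply: (He s t) => //; rewrite ss' s'j.
apply: gen => //.
  have := @merged_path A s [:: t]; rewrite merged_cons cats0 /= andbT; exact.
by apply/allP => j; rewrite mem_filter => /andP[].
Qed.

End OneElement.

Lemma prod_merged g A s cs (f : nat -> R) beta :
  (forall i, i \in cs -> f i = beta) -> (forall i, i \in inners g s cs -> f i = 1) ->
  \prod_(i <- merged g A s cs) f i = beta ^+ size cs.
Proof.
elim: cs s => [|t cs IH] s Hc Hi; first by rewrite big_nil expr0.
rewrite merged_cons big_cat /= big_rcons /= IH; last 2 first.
- by move=> i ic; apply: Hc; rewrite inE ic orbT.
- by move=> i ii; apply: Hi; rewrite /inners /= mem_cat orbC [i \in flatten _]ii.
rewrite (Hc t) ?mem_head // exprS; congr (_ * _).
rewrite big_seq big1 ?mulr1 ?mul1r // => i; rewrite mem_filter => /andP[_ ii].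
by apply: Hi; rewrite /inners /= mem_cat ii.
Qed.

(** Summed over the pieces, the hypothesis on [lowpos] says that 16 times the
total wall length, more than [16 * rho * m], is paid by the value at the end, at
most [2 * rho * m], by the constants, at most [2 * rho * m] as [48 <= rho], by
the total length, at most [4 * rho * m], and by low positions. *)
Lemma many_inners g cs (lam rho rho' m n : nat) :
  len g = n -> path leq 0%N cs -> all (fun t => t <= n)%N cs -> size cs = m ->
  (0 < lam)%N -> D0 = (16 * lam)%N -> rho = (4 * cK * rho')%N -> (48 <= rho)%N ->
  (n <= 2 * (m * (lam * rho)))%N ->
  (rho * m < sumn (pairmap (Tpair g) 0%N cs))%N ->
  (8 * T (pth g (last 0%N cs)) <= rho * m)%N ->
  (rho' * m <= size (inners g 0%N cs))%N.
Proof.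
move=> lg cpath cle csz lam0 eD0 erho rho48 nml.
have := @low_sum g 0%N cs cpath; rewrite /= lg cle => /(_ isT).
have := size_inners g 0%N cs; rewrite csz.
have : (last 0 cs <= n)%N.
  have := mem_last 0%N cs; rewrite inE => /orP[/eqP->//|].
  by move/allP: cle; apply.
move: (size (inners g 0%N cs)) => I.
move: (sumn (pairmap (fun s t => size _) _ _)) (last _ _) => L la.
move: (sumn _) (T (pth g la)) (T (pth g 0)) => Sg Tl T0.
rewrite subn0 eD0 {lg cpath cle csz eD0}.
move=> lan h2 h4 h1 h3.
have h5 : (16 * lam * (rho * m) <= 16 * lam * (Tl + 6 * m + cK * L) + 2 * n)%N.
  apply: leq_trans (leq_trans h4 _); last by rewrite leq_add2l leq_mul2l lan orbT.
  rewrite leq_mul2l; apply/orP; right; clear -h1; lia.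
have h6 : (16 * (rho * m) <= 16 * (Tl + 6 * m + cK * L) + 4 * (rho * m))%N.
  rewrite -(leq_pmul2l lam0); apply: leq_trans (_ : 16 * lam * (Tl + 6 * m + cK * L) + 2 * n <= _)%N.
    by clear -h5; lia.
  by clear -nml; set Y := (Tl + _ + _)%N; nia.
have h7 : (rho * m <= 2 * (cK * L))%N by clear -h6 h3 rho48; nia.
have cK0 : (0 < cK)%N by clear -rho48 erho; rewrite erho in rho48; nia.
have h8 : (2 * (rho' * m) <= L)%N.
  by rewrite -(leq_pmul2l cK0); move: h7; rewrite erho; clear; nia.
have r0 : (0 < rho')%N by clear -rho48 erho; rewrite erho in rho48; nia.
by clear -h8 h2 r0; nia.
Qed.

(** Besides the [m] cuts of a list with large wall length, cut at any [k] of its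
low positions.  The codes at low positions are below [B2], since these positions
lie between the origin and the previous cut; those at the [m] original cuts are
below [B1], as the pieces have length at most [2 * l].  This gives weight [B1 ^-
m]. *)
Lemma case2_count (m l rho rho' lam n k B1 B2 : nat) (Al : seq G) :
  (m * l <= n)%N -> (n <= 2 * (m * l))%N -> uniq Al ->
  (0 < lam)%N -> (0 < rho')%N -> D0 = (16 * lam)%N -> l = (lam * rho)%N ->
  rho = (4 * cK * rho')%N -> (48 <= rho)%N -> (0 < B1)%N ->
  (forall h w, D w + D (h * w)%g <= D h + E -> (b h w <= B2)%N) ->
  (forall h w, (len w <= 2 * l)%N -> (b h w <= B1)%N) ->
  (forall g, g \in Al -> len g = n /\
     exists x : {ffun 'I_m -> 'I_l}, (rho * m < sumn (pairmap (Tpair g) 0%N (cuts x)))%N /\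
        (8 * T (pth g (last 0%N (cuts x))) <= rho * m)%N) ->
  (size Al)%:R * ('C(rho' * m, k))%:R * (B1%:R^-1) ^+ m <=
    (bn (n + cF * (m + k).+1))%:R * (B2.+1)%:R ^+ (m + k) :> R.
Proof.
move=> ml nml uA lam0 rho0 eD0 el erho rho48 B10 HB2 HB1 HA.
have [->|Al0] := eqVneq Al [::].
  by rewrite !mul0r mulr_ge0 // exprn_ge0.
have [xg Hxg] : exists xg : G -> {ffun 'I_m -> 'I_l}, forall g, g \in Al ->
    (rho * m < sumn (pairmap (Tpair g) 0%N (cuts (xg g))))%N /\
    (8 * T (pth g (last 0%N (cuts (xg g)))) <= rho * m)%N.
  have [x0 _] : exists x : {ffun 'I_m -> 'I_l}, True.
    by case: Al HA Al0 {uA} => // g Al HA _; have [_ [x _]] := HA g (mem_head _ _); exists x.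
  apply: (@choice_ex _ _ (fun g x => g \in Al ->
    (rho * m < sumn (pairmap (Tpair g) 0%N (cuts x)))%N /\
    (8 * T (pth g (last 0%N (cuts x))) <= rho * m)%N)) => g.
  have [/HA [_ [x Hx]]|] := boolP (g \in Al); first by exists x.
  by exists x0.
have lenA g : g \in Al -> len g = n by move=> /HA [].
pose cg g := cuts (xg g).
have cle g : all (fun t => t <= n)%N (cg g) by apply: cuts_le.
have cpath g : path leq 0%N (cg g) by apply: cuts_sorted.
have csize g : size (cg g) = m by apply: size_cuts.
pose ing g := inners g 0%N (cg g).
have ing_u g : uniq (ing g) by have [] := inners_spec g (cpath g).
have ing_c g i : i \in ing g -> i \notin cg g by have [_ _] := inners_spec g (cpath g); apply.
have ing_le g i : i \in ing g -> (i <= n)%N.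
  move=> ii.
  have : i \in merged g predT 0%N (cg g) by rewrite mem_merged ii orbT.
  by move/allP: (merged_le g predT 0 (cle g)) => /(_ i).
have ing_size g : g \in Al -> (rho' * m <= size (ing g))%N.
  move=> gA; have [h1 h2] := Hxg g gA.
  apply: (many_inners (lenA g gA) (cpath g) (cle g) (csize g) lam0 eD0 erho rho48 _ h1 h2).
  by rewrite -el.
pose Gam g : {set 'I_n.+1} := [set i | val i \in ing g]%SET.
have cardset g (A : {set 'I_n.+1}) : A \subset Gam g ->
    size [seq i <- ing g | i \in [seq val a | a <- enum A]] = #|A|.
  move=> AG; rewrite cardE -(size_map val); apply: perm_size; apply: uniq_perm.
  - exact: filter_uniq.
  - by rewrite (map_inj_uniq val_inj) enum_uniq.
  - move=> i; rewrite mem_filter; apply: andb_idr => /mapP[a + ->].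
    by rewrite mem_enum => /(fintype.subsetP AG); rewrite inE.
have cardG g : #|Gam g| = size (ing g).
  rewrite -(cardset g (Gam g)) //; congr size; apply/all_filterP/allP => i ii.
  have il : (i < n.+1)%N by rewrite ltnS (ing_le g).
  by apply/mapP; exists (Ordinal il) => //; rewrite mem_enum inE.
pose theta (c : nat) : R := (c < B2)%N%:R + (c < B1)%N%:R * (B1%:R)^-1.
have B1R : (1 : R) <= B1%:R by rewrite ler1n.
have B1V0 : (0 : R) <= B1%:R^-1 by rewrite invr_ge0 ler0n.
have B1V1 : (B1%:R^-1 : R) <= 1 by rewrite invf_le1 // ltr0n.
apply: (@family_count R G len len1 pth Hpth Bl mem_Bl b cF enc enc_ok enc_len enc_inj
  {set 'I_n.+1} Al (fun g => [set A : {set 'I_n.+1} | (A \subset Gam g) && (#|A| == k)]%SET)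
  (fun g A => merged g (fun i => i \in [seq val a | a <- enum A]) 0%N (cg g))
  (fun g s t => if t \in ing g then 1 else B1%:R^-1) theta
  ((B1%:R^-1) ^+ m) (B2.+1)%:R (m + k)%N n 'C(rho' * m, k)) => //.
- by move=> c; rewrite addr_ge0 ?ler0n // mulr_ge0.
- by move=> B; apply: sum_two_level_weight.
- by move=> g s t; case: ifP.
- move=> g gA; split; first exact: lenA.
  by rewrite cards_draws cardG; apply: leq_bin2l; apply: ing_size.
- move=> g A gA; rewrite inE => /andP[AG /eqP Ak]; have lg := lenA g gA; split.
  + exact: merged_path.
  + exact: merged_le.
  + by rewrite size_merged csize cardset // Ak.
  + apply: merged_rel => //.
      have mm : path (fun s t => (s <= t) && (t <= s + 2 * l))%N 0%N (cg g).
        exact: path_and (cpath g) (cuts_gap (xg g)).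
      apply: path_mem mm => s t tc /andP[st tl]; apply/asboolP => i /andP[si it].
      apply/asboolP => c cb.
      have -> : (t \in ing g) = false by apply/negP => /ing_c; rewrite tc.
      have tn : (t <= n)%N by move/allP: (cle g); apply.
      have : (c < B1)%N.
        apply: leq_trans cb _; apply: HB1.
        have [_ _ pd] := Hpth g; rewrite pd ?lg ?it ?tn //; lia.
      by rewrite /theta => ->; rewrite mul1r lerDr ler0n.
    move=> s t i j jin sij; apply/asboolP => c cb.
    have : (c < B2)%N.
      apply: leq_trans cb _; apply: HB2; rewrite mulVKg.
      move: jin; rewrite mem_filter mem_filter => /and3P[_ /asboolP hl _].
      exact: hl.
    rewrite /theta => ->; apply: (@le_trans _ _ 1); first by case: ifP.
    by rewrite lerDl mulr_ge0.
  + rewrite (pairmap_snd (fun t => if t \in ing g then 1 else (B1%:R^-1 : R))).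
    rewrite big_map (@prod_merged g _ 0%N (cg g) _ (B1%:R^-1)) ?csize // => i ii.
      by have -> : (i \in ing g) = false by apply/negP => /ing_c; rewrite ii.
    by rewrite ii.
- move=> g A A' gA; rewrite !inE => /andP[AG _] /andP[AG' _] e.
  have key (A1 A2 : {set 'I_n.+1}) : A1 \subset Gam g ->
    merged g (fun i => i \in [seq val a | a <- enum A1]) 0%N (cg g) =
    merged g (fun i => i \in [seq val a | a <- enum A2]) 0%N (cg g) ->
    A1 \subset A2.
    move=> AG1 e'; apply/fintype.subsetP => a aA.
    have ai : val a \in ing g by have := fintype.subsetP AG1 a aA; rewrite inE.
    have : val a \in merged g (fun i => i \in [seq val a | a <- enum A1]) 0%N (cg g).
      by rewrite mem_merged ai andbT (mem_map val_inj) mem_enum aA orbT.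
    rewrite e' mem_merged (negbTE (ing_c _ _ ai)) /= => /andP[+ _].
    by rewrite (mem_map val_inj) mem_enum.
  by apply/eqP; rewrite finset.eqEsubset (key A A' AG e) (key A' A AG' (esym e)).
Qed.

End Cases.

(** * Comparing growth rates *)

Section Limsup.
Variable R : realType.

Lemma limn_esup_ub (u : nat -> \bar R) (x : \bar R) N :
  (forall n, (N <= n)%N -> (u n <= x)%E) -> (limn_esup u <= x)%E.
Proof.
move=> H; rewrite /limn_esup limf_esupE.
apply: le_trans (_ : ereal_sup (u @` [set n | (N <= n)%N]) <= x)%E.
  by apply: ereal_inf_lbound; exists [set n | (N <= n)%N] => //; exact: nbhs_infty_ge.
by apply: ge_ereal_sup => _ [n Nn <-]; apply: H.
Qed.

Lemma limn_esup_lt (u : nat -> \bar R) (x : \bar R) :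
  (limn_esup u < x)%E -> exists N, forall n, (N <= n)%N -> (u n <= x)%E.
Proof.
rewrite /limn_esup limf_esupE => /ereal_inf_lt [_ [V [N _ NV] <-]] lt.
exists N => n Nn; apply: le_trans (ltW lt); apply: ereal_sup_ubound.
by exists n => //; apply: NV.
Qed.

Lemma limn_esup_lb (u : nat -> \bar R) (x : \bar R) :
  (forall N, exists2 n, (N <= n)%N & (x <= u n)%E) -> (x <= limn_esup u)%E.
Proof.
move=> H; rewrite /limn_esup limf_esupE; apply: le_ereal_inf_tmp => _ [V [N _ NV] <-].
have [n Nn xn] := H N; apply: le_trans xn _; apply: ereal_sup_ubound.
by exists n => //; apply: NV.
Qed.

Lemma ln_small (de : R) : 0 < de -> exists N : nat, forall n, (N <= n)%N -> (0 < n)%N ->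
  ln (n%:R : R) <= de * n%:R.
Proof.
move=> de0; have [N HN] := nat_ub (2 * ln (2 / de) / de).
exists N => n Nn n0.
have n0' : (0 : R) < n%:R by rewrite ltr0n.
have d2 : 0 < de / 2 * n%:R by rewrite mulr_gt0 // divr_gt0.
have -> : (n%:R : R) = (2 / de) * (de / 2 * n%:R) by field; rewrite gt_eqF.
rewrite lnM ?posrE ?divr_gt0 //.
have h1 : ln (de / 2 * n%:R) <= de / 2 * n%:R by apply: ltW; apply: ln_sublinear.
have h2 : 2 * ln (2 / de) / de <= n%:R by apply: le_trans HN _; rewrite ler_nat.
rewrite ler_pdivrMr // in h2.
have -> : de * (2 / de * (de / 2 * n%:R)) = de * n%:R by field; rewrite gt_eqF.
lra.
Qed.

Definition rate (a : nat -> nat) : \bar R :=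
  limn_esup (fun n => (lne (a n)%:R%:E * (n%:R^-1)%:E)%E).

Lemma rate_term (a : nat) (n : nat) : (0 < a)%N ->
  (lne a%:R%:E * (n%:R^-1)%:E)%E = (ln a%:R / n%:R : R)%:E.
Proof. by move=> a0; rewrite lne_EFin ?ltr0n // -EFinM. Qed.

(** The sum on the right is at most twice its larger term.  The first term grows
at half the rate [w] of [b], and the second one at most at the rate [w - ln 2 /
(2 * l)]; both are below [w], which is positive by the lower bound on [b] and
finite by the upper one. *)
Lemma rate_gap (a b : nat -> nat) (L l C N0 Q0 Q : nat) :
  (forall n, 0 < a n)%N -> (forall n, 0 < b n)%N -> (0 < L)%N -> (0 < l)%N ->
  (forall n, b n <= Q0 * Q ^ n)%N ->
  (forall q, 2 ^ q <= b (L * q.+1))%N ->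
  (forall n, (N0 <= n)%N ->
     (a n)%:R <= (b (n./2))%:R + (n * C * b n)%:R * (2^-1) ^+ (n./2 %/ l) :> R) ->
  (rate a < rate b)%E.
Proof.
move=> a0 b0 L0 l0 bQ bL ab.
have ln2 : (0 : R) < ln 2 by rewrite ln_gt0 // ltr1n.
have L0' : (0 : R) < L%:R by rewrite ltr0n.
have l0' : (0 : R) < l%:R by rewrite ltr0n.
have Q0p : (0 < Q0)%N.
  by have := leq_trans (b0 0%N) (bQ 0%N); rewrite expn0 muln1.
have Qp : (0 < Q)%N.
  by have := leq_trans (b0 1%N) (bQ 1%N); rewrite expn1 muln_gt0 => /andP[].
(* the rate of b is finite and positive *)
have lo : ((ln 2 / (2 * L%:R))%:E <= rate b)%E.
  apply: limn_esup_lb => N; exists (L * N.+2)%N; first by nia.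
  rewrite rate_term // lee_fin.
  have h1 : (2 : R) ^+ N.+1 <= (b (L * N.+2))%:R by rewrite -natrX ler_nat bL.
  have h2 : N.+1%:R * ln 2 <= ln (b (L * N.+2))%:R :> R.
    by rewrite mulr_natl -lnXn // ler_ln // posrE ?exprn_gt0 ?ltr0n.
  have n0 : (0 : R) < (L * N.+2)%:R by rewrite ltr0n muln_gt0 L0.
  rewrite ler_pdivlMr //; apply: le_trans h2.
  rewrite natrM; have -> : ln 2 / (2 * L%:R) * (L%:R * N.+2%:R) = ln 2 * (N.+2%:R / 2) :> R.
    by field; rewrite gt_eqF.
  rewrite mulrC; apply: ler_wpM2r; first exact: ltW.
  have h3 : (1 : R) <= N.+1%:R by rewrite ler1n.
  by rewrite -[N.+2%:R]natr1; lra.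
have hi : (rate b <= (ln Q0%:R + ln Q%:R : R)%:E)%E.
  apply: (@limn_esup_ub _ _ 1%N) => n n0; rewrite rate_term // lee_fin.
  have n0' : (1 : R) <= n%:R by rewrite ler1n.
  rewrite ler_pdivrMr; last lra.
  have h : ln (b n)%:R <= ln Q0%:R + n%:R * ln Q%:R :> R.
    apply: le_trans (_ : ln ((Q0 * Q ^ n)%:R) <= _); first by rewrite ler_ln ?posrE ?ltr0n ?ler_nat ?muln_gt0 ?Q0p ?expn_gt0 ?Qp.
    by rewrite natrM lnM ?posrE ?ltr0n ?expn_gt0 ?Qp // natrX lnXn ?ltr0n // mulr_natl.
  have q0 : (0 : R) <= ln Q0%:R by rewrite ln_ge0 // ler1n.
  have : 0 <= ln Q0%:R * (n%:R - 1) :> R by rewrite mulr_ge0 //; lra.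
  lra.
have [w ew] : exists w : R, rate b = w%:E.
  by move: lo hi; case: (rate b) => [w| |] //; exists w.
rewrite ew in lo *; rewrite lee_fin in lo.
have w0 : 0 < w by apply: lt_le_trans lo; rewrite divr_gt0 // mulr_gt0.
pose ka : R := ln 2 / (2 * l%:R).
have ka0 : 0 < ka by rewrite divr_gt0 // mulr_gt0.
pose de : R := Num.min w ka / 16.
have de0 : 0 < de by rewrite divr_gt0 // lt_min w0 ka0.
have dew : 16 * de <= w by rewrite /de mulrC divfK // ge_min lexx.
have deka : 16 * de <= ka by rewrite /de mulrC divfK // ge_min lexx orbT.
have [N1 HN1] : exists N, forall n, (N <= n)%N -> (0 < n)%N -> ln (b n)%:R <= (w + de) * n%:R :> R.
  have [|N HN] := @limn_esup_lt (fun n => (lne (b n)%:R%:E * (n%:R^-1)%:E)%E) (w + de)%:E.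
    by have -> : limn_esup _ = w%:E := ew; rewrite lte_fin; lra.
  exists N => n Nn n0; have := HN n Nn; rewrite rate_term // lee_fin.
  by rewrite ler_pdivrMr // ltr0n.
have [N2 HN2] := ln_small de0.
have [N3 HN3] := nat_ub ((5 * ln 2 + ln C.+1%:R) / de).
apply: (@le_lt_trans _ _ (w - de)%:E); last by rewrite lte_fin; lra.
apply: (@limn_esup_ub _ _ (N0 + 2 * N1 + N2 + N3 + 2)%N) => n Hn.
rewrite rate_term // lee_fin.
have [n0 nN0 nN1 nN2 nN3] : [/\ 0 < n, N0 <= n, 2 * N1 + 2 <= n, N2 <= n & N3 <= n]%N.
  by clear -Hn; split; lia.
have n0' : (0 : R) < n%:R by rewrite ltr0n.
rewrite ler_pdivrMr //.
have small : 5 * ln 2 + ln C.+1%:R <= de * n%:R :> R.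
  rewrite [de * _]mulrC -ler_pdivrMr //; apply: le_trans HN3 _; by rewrite ler_nat.
have C0 : (0 : R) <= ln C.+1%:R by rewrite ln_ge0 // ler1n.
have lnn : ln n%:R <= de * n%:R by apply: HN2.
set h := n./2 in ab *.
have hn : (h + h <= n)%N by rewrite /h addnn -{2}(odd_double_half n) leq_addl.
have hn2 : (n <= h + h + 1)%N by rewrite /h addnn -{1}(odd_double_half n) addnC leq_add2l; case: odd.
have hnR : (h%:R + h%:R : R) <= n%:R by rewrite -natrD ler_nat.
have [hN1 h0 nN1'] : [/\ N1 <= h, 0 < h & N1 <= n]%N by clear -hn hn2 nN1; split; lia.
have bh : ln (b h)%:R <= (w + de) * h%:R :> R by apply: HN1.
have bnn : ln (b n)%:R <= (w + de) * n%:R :> R by apply: HN1.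
set k := (h %/ l)%N in ab *.
have kR : n%:R <= 2 * l%:R * (k%:R + 2) :> R.
  rewrite -[2]/(2%:R) -natrD -!natrM ler_nat.
  by have := ltn_ceil h l0; rewrite -/k; clear -hn2; nia.
set X := (b h)%:R : R; set Y := (n * C.+1 * b n)%:R * (2^-1) ^+ k : R.
have X0 : 0 < X by rewrite ltr0n.
have Y0 : 0 < Y by rewrite mulr_gt0 ?exprn_gt0 // ltr0n !muln_gt0 n0 b0.
have aXY : (a n)%:R <= X + Y.
  have := ab n nN0; rewrite -/h -/k -/X => H; apply: le_trans H _.
  rewrite lerD2l /Y; apply: ler_wpM2r; first by rewrite exprn_ge0.
  by rewrite ler_nat leq_mul2r leq_mul2l leqnSn !orbT.
have lnY : ln Y = ln n%:R + ln C.+1%:R + ln (b n)%:R - k%:R * ln 2.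
  rewrite /Y lnM ?posrE ?exprn_gt0 // ?ltr0n ?muln_gt0 ?n0 ?b0 //.
  rewrite !natrM !lnM ?posrE ?mulr_gt0 ?ltr0n //.
  by rewrite lnXn // lnV ?posrE // mulr_natl mulNrn.
have kln : ka * n%:R <= (k%:R + 2) * ln 2.
  rewrite /ka mulrAC ler_pdivrMr; last by rewrite mulr_gt0.
  have := ler_wpM2r (ltW ln2) kR; lra.
have dn : 0 <= de * n%:R by rewrite mulr_ge0 // ltW.
have dekn : 16 * (de * n%:R) <= ka * n%:R by rewrite mulrA; apply: ler_wpM2r => //; exact: ltW.
have dewn : 16 * (de * n%:R) <= w * n%:R by rewrite mulrA; apply: ler_wpM2r => //; exact: ltW.
have wh : (w + de) * h%:R * 2 <= (w + de) * n%:R.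
  rewrite -mulrA; apply: ler_wpM2l; [lra|lra].
have lndbl z : 0 < z -> (a n)%:R <= 2 * z -> ln (a n)%:R <= ln 2 + ln z.
  move=> z0 az; rewrite -lnM ?posrE // ler_ln ?posrE ?ltr0n //.
  exact: mulr_gt0.
have [XY|YX] := leP Y X.
  have : ln (a n)%:R <= ln 2 + ln X by apply: lndbl => //; lra.
  by move: hnR bh small lnn bnn dn dewn wh C0 ln2 w0 de0; clear; lra.
have : ln (a n)%:R <= ln 2 + ln Y by apply: lndbl => //; lra.
by rewrite lnY; move: bnn kln small lnn dekn dn ln2 C0; clear; lra.
Qed.

End Limsup.

(** * Slow elements are exponentially rare *)

Section Assembly.
Variables (R : realType) (G : groupType) (len : G -> nat).
Hypothesis len1 : len 1%g = 0%N.
Variable pth : G -> nat -> G.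
Hypothesis Hpth : forall g, geodpath len g (pth g).
Variable Bl : nat -> seq G.
Hypothesis Bl_uniq : forall n, uniq (Bl n).
Hypothesis mem_Bl : forall n g, (g \in Bl n) = (len g <= n)%N.
Local Notation bn n := (size (Bl n)).
Variables (b : G -> G -> nat) (cF : nat) (enc : seq G -> G * seq nat).
Hypothesis enc_ok : forall ws, ws != [::] -> code_ok b 1%g ws (enc ws).2.
Hypothesis enc_len : forall ws, ws != [::] ->
  (len (enc ws).1 <= len 1%g + \sum_(w <- ws) len w + cF * size ws)%N.
Hypothesis enc_inj : forall ws ws', ws != [::] -> ws' != [::] -> enc ws = enc ws' -> ws = ws'.

Lemma code_bounded B h ws v cs : (forall h w, w \in ws -> (b h w <= B)%N) ->
  code_ok b h (rcons ws v) cs -> all (fun c => c < B)%N cs.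
Proof.
elim: ws h cs => [|w ws IH] h [|c cs] //= HB; first by case: cs => [|??] [].
move=> [cb ok']; rewrite (leq_trans cb (HB _ _ (mem_head _ _))) /=.
by apply: IH ok' => h' w' w'ws; apply: HB; rewrite inE w'ws orbT.
Qed.

(** Lists over an alphabet of [t ^ 2] letters, closed by a trivial letter since
the last letter has no code, have codes bounded by [c * t]; so there are at
least [(t ^ 2 / (c * t)) ^ q] elements in a ball of radius linear in [q].  Take
[t = 2 * c]. *)
Lemma exponential_growth (c : nat) : (0 < c)%N ->
  (forall t, exists s : seq G, [/\ uniq s, size s = (t.+1 * t.+1)%N &
     forall h w, w \in s -> (b h w <= c * t.+1)%N]) ->
  exists2 L, (0 < L)%N & forall q, (2 ^ q <= bn (L * q.+1))%N.
Proof.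
move=> c0 Hfam; have [s [us sz bs]] := Hfam (2 * c).-1.
rewrite prednK ?muln_gt0 // in sz bs.
pose M := (\max_(w <- s) len w)%N.
have lM w : w \in s -> (len w <= M)%N.
  by move=> ws; rewrite /M (big_rem _ ws) /= leq_maxl.
exists (M + cF).+1 => // q.
pose B := (c * (2 * c))%N.
have B0 : (0 < B)%N by rewrite !muln_gt0 c0.
pose P := [seq rcons ws 1%g | ws <- words s q].
have indR : forall N, \sum_(i <- iota 0 N) ((i < B)%N%:R : R) <= B%:R.
  by move=> N; rewrite -natr_sum ler_nat sum_indicator.
have key : (size P)%:R * 1 <= (bn (q * M + cF * q.+1))%:R * B%:R ^+ q :> R.
  apply: (weighted_count (R := R) len1 mem_Bl enc_ok enc_len enc_inj (theta := fun i => (i < B)%N%:R)) indR _ _.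
  - by move=> i; apply: ler0n.
  - by rewrite map_inj_uniq ?words_uniq //; apply: rcons_injl.
  move=> _ /mapP[ws + ->]; rewrite mem_words => /andP[/eqP sw /allP sub].
  have n0 : rcons ws 1%g != [::] by rewrite -size_eq0 size_rcons.
  split; first by rewrite size_rcons sw.
    rewrite -cats1 big_cat /= big_seq1 len1 addn0 -sw.
    elim: ws sub {sw n0} => [|w ws IHw] sub /=; first by rewrite big_nil.
    rewrite big_cons mulSn; apply: leq_add; first by apply: lM; apply: sub; exact: mem_head.
    by apply: IHw => w' w'ws; apply: sub; rewrite inE w'ws orbT.
  have /allP al := code_bounded (fun h w wws => bs h w (sub w wws)) (enc_ok n0).
  rewrite big_seq big1 // => i /al ib.
  by rewrite -/B ib.
move: key; rewrite mulr1 size_map size_words sz -natrX -natrM ler_nat.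
have -> : ((2 * c * (2 * c)) ^ q = 2 ^ q * B ^ q)%N by rewrite -expnMn /B; congr (_ ^ _)%N; lia.
rewrite leq_pmul2r ?expn_gt0 ?B0 // => /leq_trans; apply.
by apply: (ball_mono Bl_uniq mem_Bl); nia.
Qed.

Lemma case1_ball cT T m l lam rho n (Al : seq G) : (0 < cT)%N ->
  (forall h w, (b h w <= cT * (1 + T w))%N) ->
  lam = (16 * cT * bn cF)%N -> l = (lam * rho)%N -> (0 < rho)%N ->
  (m * l <= n)%N -> uniq Al ->
  (forall g, g \in Al -> len g = n /\
     forall x : {ffun 'I_m -> 'I_l},
       (sumn (pairmap (Tpair pth T g) 0%N (cuts x)) <= rho * m)%N) ->
  (size Al)%:R <= (bn cF * bn n)%:R * (2^-1) ^+ m :> R.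
Proof.
move=> cT0 b_le elam el rho0 ml uA HA.
have := case1_count R len1 Hpth mem_Bl enc_ok enc_len enc_inj cT0 b_le ml uA HA.
have bF0 := ball_ge1 len1 mem_Bl cF.
have l0 : (0 < l)%N by rewrite el elam !muln_gt0 cT0 bF0 rho0.
have h1 : ((bn (n + cF * m.+1)) <= bn n * bn cF * bn cF ^ m)%N.
  by apply: leq_trans (ball_mul len1 Hpth Bl_uniq mem_Bl _ _ _) _; rewrite expnS mulnA.
have h2 : (bn cF ^ m * (2 * (cT * (1 + rho))) ^ m * 4 ^ m <= l ^ m)%N.
  rewrite -!expnMn; have [->|m0] := posnP m; first by rewrite !expn0.
  rewrite leq_exp2r // el elam.
  have : (1 + rho <= 2 * rho)%N by lia.
  move: (bn cF) => F; clear; move=> h; rewrite -(@leq_pmul2l 1) // !mul1n.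
  apply: leq_trans (_ : F * (2 * (cT * (2 * rho))) * 4 <= _)%N; last by rewrite leq_eqVlt; apply/orP; left; apply/eqP; ring.
  by rewrite leq_mul2r leq_mul2l leq_mul2l leq_mul2l h !orbT.
move=> key.
have q4 : (4 : R) ^+ m = 2 ^+ m * 2 ^+ m by rewrite -exprMn; congr (_ ^+ _); lra.
have h1R : (bn (n + cF * m.+1))%:R <= (bn cF * bn n)%:R * (bn cF)%:R ^+ m :> R.
  by rewrite -natrX -natrM ler_nat (mulnC (bn cF)).
have h2R : (bn cF)%:R ^+ m * (2 * (cT * (1 + rho))%:R) ^+ m * 4 ^+ m <= (l ^ m)%:R :> R.
  by rewrite -natrM -!natrX -!natrM ler_nat.
have p2 : (0 : R) < 2 ^+ m by rewrite exprn_gt0.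
have lm0 : (0 : R) < (l ^ m)%:R by rewrite ltr0n expn_gt0 l0.
have z0 : (0 : R) <= (2 * (cT * (1 + rho))%:R) ^+ m by rewrite exprn_ge0 // -natrM ler0n.
rewrite exprVn ler_pdivlMr // in key *.
rewrite -(ler_pM2r lm0).
have := ler_wpM2r z0 h1R => h3.
have k2 := le_trans key h3.
rewrite ler_pdivrMr // in k2.
have h4 := ler_wpM2l (ler0n R (bn cF * bn n)) h2R.
rewrite q4 in h4.
move: k2 h4; set S := (size Al)%:R; set U := (bn cF * bn n)%:R; set F := (bn cF)%:R ^+ m.
set Z := (2 * _) ^+ m; set Lm := (l ^ m)%:R; set p := 2 ^+ m => k2 h4.
have := ler_wpM2r (ltW p2) k2; rewrite -/p => k3.
apply: le_trans (_ : S * Lm * p <= _); first by rewrite mulrAC.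
apply: le_trans k3 _; apply: le_trans h4; rewrite le_eqVlt; apply/orP; left; apply/eqP; ring.
Qed.

(** With [k = bb * m], the [C(4 * H * k, k) >= (4 * H) ^ k] choices of low
positions outweigh the factors [H ^ (m + k)] and [B1 ^ m] as soon as [2 * H * B1
<= 4 ^ bb]. *)
Lemma case2_ball (T : G -> nat) (D : G -> R) (E : R) (D0 cK m l rho lam n bb B1 B2 : nat)
    (Al : seq G) (H := (bn cF * B2.+1)%N) :
  (forall g s0 s1, (s0 <= s1 <= len g)%N ->
    (D0 * (T (pth g s0) + Tpair pth T g s0 s1) <=
     D0 * (T (pth g s1) + 6 + cK * size (lowpos D E (pth g) s0 s1)) + 2 * (s1 - s0))%N) ->
  (m * l <= n)%N -> (n <= 2 * (m * l))%N -> uniq Al ->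
  (0 < lam)%N -> (0 < bb)%N -> D0 = (16 * lam)%N -> l = (lam * rho)%N ->
  rho = (4 * cK * (bb * (4 * H)))%N -> (48 <= rho)%N -> (0 < B1)%N ->
  (forall h w, D w + D (h * w)%g <= D h + E -> (b h w <= B2)%N) ->
  (forall h w, (len w <= 2 * l)%N -> (b h w <= B1)%N) ->
  (2 * (H * B1) <= 4 ^ bb)%N ->
  (forall g, g \in Al -> len g = n /\
     exists x : {ffun 'I_m -> 'I_l},
       (rho * m < sumn (pairmap (Tpair pth T g) 0%N (cuts x)))%N /\
       (8 * T (pth g (last 0%N (cuts x))) <= rho * m)%N) ->
  (size Al)%:R <= (bn cF * bn n)%:R * (2^-1) ^+ m :> R.
Proof.
move=> Hlow ml nml uA lam0 bb0 eD0 el erho rho48 B10 HB2 HB1 HH HA.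
have bF0 := ball_ge1 len1 mem_Bl cF.
have H0 : (0 < H)%N by rewrite muln_gt0 bF0.
have rho'0 : (0 < bb * (4 * H))%N by rewrite muln_gt0 bb0 muln_gt0 H0.
have := case2_count len1 Hpth mem_Bl enc_ok enc_len enc_inj Hlow (bb * m)%N ml nml uA
  lam0 rho'0 eD0 el erho rho48 B10 HB2 HB1 HA.
have h1 : ((bn (n + cF * (m + bb * m).+1)) * B2.+1 ^ (m + bb * m)
    <= bn cF * bn n * (H ^ m * H ^ (bb * m)))%N.
  rewrite -expnD (mulnC (bn cF)) /H (expnMn (bn cF)) mulnA leq_pmul2r ?expn_gt0 //.
  by apply: leq_trans (ball_mul len1 Hpth Bl_uniq mem_Bl _ _ _) _; rewrite expnS mulnA.
have h2 : ((4 ^ bb) ^ m * H ^ (bb * m) <= 'C(bb * (4 * H) * m, bb * m))%N.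
  rewrite -expnM -expnMn.
  have [k0|k0] := posnP (bb * m)%N; first by rewrite k0 expn0 bin0.
  have /bin_lower : (bb * m <= bb * (4 * H) * m)%N by nia.
  have -> : (bb * (4 * H) * m = (bb * m) * (4 * H))%N by lia.
  by rewrite expnMn leq_pmul2l // expn_gt0 k0.
have h3 : (2 ^ m * (H ^ m * B1 ^ m) <= (4 ^ bb) ^ m)%N.
  rewrite -!expnMn; have [->|m0] := posnP m; first by rewrite !expn0.
  by rewrite leq_exp2r.
move=> key.
have Hm0 : (0 < H ^ (bb * m))%N by rewrite expn_gt0 H0.
have HmB0 : (0 < H ^ m * B1 ^ m)%N by rewrite muln_gt0 !expn_gt0 H0 B10.
have k1 : (size Al * 'C(bb * (4 * H) * m, bb * m) <=
    bn cF * bn n * (H ^ m * H ^ (bb * m)) * B1 ^ m)%N.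
  rewrite -(ler_nat R) natrM [leRHS]natrM natrX -ler_pdivrMr ?exprn_gt0 ?ltr0n //.
  apply: le_trans (_ : _ <= (bn (n + cF * (m + bb * m).+1) * B2.+1 ^ (m + bb * m))%:R) _.
    by rewrite -exprVn natrM natrX.
  by rewrite ler_nat.
have k2 : (size Al * 2 ^ m <= bn cF * bn n)%N.
  move: h2 h3 Hm0 HmB0 k1; move: ('C(_, _)) (H ^ (bb * m))%N (H ^ m)%N (B1 ^ m)%N ((4 ^ bb) ^ m)%N.
  move: (size Al) (bn cF * bn n)%N (2 ^ m)%N => s u p c h hm bm f; clear; move=> h2 h3 h0 hb0 k1.
  have h4 : (s * (p * (hm * bm) * h) <= u * (hm * h) * bm)%N.
    apply: leq_trans k1; rewrite leq_mul2l; apply/orP; right.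
    by apply: leq_trans h2; rewrite leq_mul2r h3 orbT.
  have : (s * p * ((hm * bm) * h) <= u * ((hm * bm) * h))%N.
    by move: h4; congr (_ <= _)%N; ring.
  by rewrite leq_pmul2r // muln_gt0 hb0.
by rewrite exprVn ler_pdivlMr ?exprn_gt0 // -natrX -natrM ler_nat.
Qed.

Lemma last_cuts m l (x : {ffun 'I_m.+1 -> 'I_l}) : (m * l <= last 0 (cuts x))%N.
Proof. by rewrite /cuts enum_ordSr map_rcons last_rcons /= leq_addr. Qed.

(** Slow elements of length [n] have [T] small at the last cut, so those not
covered by [case1_ball] are covered by [case2_ball]. *)
Lemma slow_sphere (D : G -> R) (T : G -> nat) (Kn cT : nat) (c : R) (B : R -> nat) (cK : nat) :
  (forall x y, D (x * y)%g <= D x + D y) -> (forall x, D (x^-1)%g = D x) ->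
  (forall x, D x <= (Kn * len x)%:R) ->
  (forall h w, (b h w <= cT * (1 + T w))%N) ->
  (forall E h w, D w + D (h * w)%g <= D h + E -> (b h w <= B E)%N) ->
  (forall w, (T w)%:R <= D w + c) ->
  (forall D0, (0 < D0)%N -> exists E, forall g s0 s1, (s0 <= s1 <= len g)%N ->
    (D0 * (T (pth g s0) + Tpair pth T g s0 s1) <=
     D0 * (T (pth g s1) + 6 + cK * size (lowpos D E (pth g) s0 s1)) + 2 * (s1 - s0))%N) ->
  exists2 eps : R, 0 < eps & exists2 l, (0 < l)%N & forall c0 : R, exists N0, forall n Al,
    (N0 <= n)%N -> uniq Al -> (forall g, g \in Al -> len g = n /\ D g <= eps * n%:R + c0) ->
    (size Al)%:R <= (2 * bn cF * bn n)%:R * (2^-1) ^+ (n %/ l) :> R.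
Proof.
move=> DM DV Dlen b_le0 HB HT Hlow0.
have posM x y : (0 < x)%N -> (0 < y)%N -> (0 < x * y)%N by rewrite muln_gt0 => -> ->.
have bF0 := ball_ge1 len1 mem_Bl cF.
have [cc Hcc] := nat_ub c.
pose F := bn cF; pose cT' := cT.+1; pose cK' := cK.+1.
have b_le h w : (b h w <= cT' * (1 + T w))%N.
  by apply: leq_trans (b_le0 h w) _; rewrite leq_mul2r leqnSn orbT.
(* l is lam * rho, and lam beats the constants of the first case: 4 * (bn cF) *
   2 * cT' * (1 + rho) <= l *)
have [lam elam] : exists x, x = (16 * cT' * F)%N by eexists.
have lam0 : (0 < lam)%N by rewrite elam; apply: posM => //; apply: posM.
have [|E HE] := Hlow0 (16 * lam)%N; first exact: posM.
have [H eH] : exists x, x = (F * (B E).+1)%N by eexists.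
have H0 : (0 < H)%N by rewrite eH; apply: posM.
(* codes of pieces of length at most 2 * l are below c1 * l, and l turns out to
   be c3 * bb, so bb is taken with 2 * H * c1 * c3 * bb <= 4 ^ bb *)
have [c1 ec1] : exists x, x = (cT' * (1 + 2 * Kn + cc))%N by eexists.
have c10 : (0 < c1)%N by rewrite ec1; apply: posM.
have [c3 ec3] : exists x, x = (lam * (4 * cK' * (4 * H)))%N by eexists.
have h2 : (0 < 4 * H)%N by exact: posM.
have c30 : (0 < c3)%N by rewrite ec3; exact: (posM _ _ lam0 (posM _ _ (isT : (0 < 4 * cK')%N) h2)).
have [bb ebb] : exists x, x = (2 * (c1 * c3 * H) + 12)%N by eexists.
have [rho erho] : exists x, x = (4 * cK' * (bb * (4 * H)))%N by eexists.
have rho48 : (48 <= rho)%N.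
  have h1 : (12 <= bb)%N by rewrite ebb leq_addl.
  rewrite erho -[48%N]/(4 * 1 * (12 * 1))%N; apply: leq_mul; first by rewrite leq_mul2l.
  exact: leq_mul.
have [l el] : exists x, x = (lam * rho)%N by eexists.
have l0 : (0 < l)%N by rewrite el; apply: posM => //; apply: leq_trans rho48.
have lc3 : l = (c3 * bb)%N by rewrite el erho ec3; ring.
pose eps : R := (32 * lam%:R)^-1.
have lamR : (0 : R) < lam%:R by rewrite ltr0n.
have eps0 : 0 < eps by rewrite invr_gt0 mulr_gt0.
exists eps => //; exists l => // c0.
have [N1 HN1] := nat_ub (16 * (c0 + (Kn * (2 * l))%:R + c)).
exists (l * N1.+1)%N => n Al Nn uA HA.
have [m em] : exists x, x = (n %/ l)%N by eexists.
have mN : (N1 < m)%N by rewrite em leq_divRL // mulnC.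
have ml : (m * l <= n)%N by rewrite em; apply: leq_trunc_div.
have nml1 : (n < m.+1 * l)%N by rewrite em; apply: ltn_ceil.
have nml : (n <= 2 * (m * l))%N
  by apply: leq_trans (ltnW nml1) _; rewrite mulnA leq_mul2r; apply/orP; right; clear -mN; lia.
have B10 : (0 < c1 * l)%N by apply: posM.
have HB1 h w : (len w <= 2 * l)%N -> (b h w <= c1 * l)%N.
  move=> lw; apply: leq_trans (b_le h w) _; rewrite ec1 -mulnA leq_mul2l; apply/orP; right.
  have : (T w <= 2 * Kn * l + cc)%N.
    rewrite -(ler_nat R) natrD; apply: le_trans (HT w) _; apply: lerD => //.
    by apply: le_trans (Dlen w) _; rewrite ler_nat (mulnC 2%N) -mulnA leq_mul2l lw orbT.
  by move: l0; clear; nia.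
have HH : (2 * (H * (c1 * l)) <= 4 ^ bb)%N.
  have -> : (2 * (H * (c1 * l)) = (2 * (c1 * c3 * H)) * bb)%N by rewrite lc3; ring.
  rewrite -[4%N]/(2 ^ 2)%N -expnM (mul2n bb) -addnn expnD; apply: leq_mul.
    by apply: leq_trans (ltnW (ltn_expl bb (ltnSn 1))); rewrite ebb leq_addr.
  exact: ltnW (ltn_expl bb (ltnSn 1)).
have Tlast g (x : {ffun 'I_m -> 'I_l}) : g \in Al ->
    (8 * T (pth g (last 0%N (cuts x))) <= rho * m)%N.
  move=> /HA [lg Dg].
  have [_ pl pd] := Hpth g.
  set s := last _ _.
  have sn : (s <= n)%N.
    have := mem_last 0%N (cuts x); rewrite inE -/s => /orP[/eqP->//|].
    by have /allP := cuts_le x ml; apply.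
  have ns : (n - s <= 2 * l)%N.
    have : (m.-1 * l <= s)%N.
      by rewrite /s; clear; case: (m) (x) => // m' x'; apply: last_cuts.
    by move: nml1 mN; clear; case: (m) => // m'; rewrite /=; nia.
  have Ds : D (pth g s) <= D g + (Kn * (2 * l))%:R.
    have -> : pth g s = (g * ((pth g s)^-1 * g)^-1)%g by rewrite invgM invgK mulVKg.
    apply: le_trans (DM _ _) _; rewrite lerD2l DV; apply: le_trans (Dlen _) _.
    rewrite ler_nat leq_mul2l; apply/orP; right.
    have := pd s (len g); rewrite pl => ->; first by rewrite lg.
    by rewrite lg sn leqnn.
  have en : eps * n%:R <= (rho * m)%:R / 16.
    have : n%:R <= (2 * (m * l))%:R :> R by rewrite ler_nat.
    move=> /(ler_wpM2l (ltW eps0)) /le_trans; apply.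
    rewrite /eps el !natrM; rewrite le_eqVlt; apply/orP; left; apply/eqP; field.
    by rewrite gt_eqF.
  have mR : 16 * (c0 + (Kn * (2 * l))%:R + c) <= (rho * m)%:R.
    apply: le_trans HN1 _; rewrite ler_nat; apply: leq_trans (ltnW mN) _.
    by rewrite leq_pmull // (leq_trans _ rho48).
  rewrite -(ler_nat R) natrM; have := HT (pth g s); move: Ds Dg en mR; clear; lra.
(* the two cases: every way of cutting has small wall length, or some has not *)
pose low1 g := `[< forall x : {ffun 'I_m -> 'I_l},
    (sumn (pairmap (Tpair pth T g) 0%N (cuts x)) <= rho * m)%N >].
rewrite -em; have -> : (2 * bn cF * bn n)%:R = (bn cF * bn n)%:R + (bn cF * bn n)%:R :> R.
  by rewrite -natrD; congr (_%:R); ring.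
rewrite -(count_predC low1 Al) -!size_filter natrD mulrDl; apply: lerD.
  apply: (case1_ball (cT := cT') (T := T) (l := l) (lam := lam) (rho := rho)) => //.
  - by apply: leq_trans rho48.
  - by rewrite filter_uniq.
  move=> g; rewrite mem_filter => /andP[/asboolP h gA]; split=> //.
  by have [] := HA g gA.
apply: (case2_ball (T := T) (D := D) (E := E) (D0 := (16 * lam)%N) (cK := cK') (l := l)
  (rho := rho) (lam := lam) (bb := bb) (B1 := (c1 * l)%N) (B2 := B E)) => //.
- move=> g s0 s1 s01; apply: leq_trans (HE g s0 s1 s01) _.
  by rewrite leq_add2r leq_mul2l leq_add2l leq_mul2r leqnSn !orbT.
- by rewrite filter_uniq.
- by rewrite ebb addn_gt0 orbT.
- by rewrite erho eH.
- exact: HB.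
- by rewrite -eH.
move=> g; rewrite mem_filter => /andP[/= /asboolPn h gA]; split; first by have [] := HA g gA.
have [x Hx] : exists x : {ffun 'I_m -> 'I_l}, ~ (sumn (pairmap (Tpair pth T g) 0%N (cuts x)) <= rho * m)%N.
  apply: contrapT => H1; apply: h => x; apply: contrapT => Hx; apply: H1; by exists x.
exists x; split; last exact: Tlast.
by rewrite ltnNge; apply/negP.
Qed.

Lemma sumn_bound (js : seq nat) (f : nat -> nat) (x : R) :
  (forall j, j \in js -> (f j)%:R <= x) -> (sumn [seq f j | j <- js])%:R <= (size js)%:R * x.
Proof.
elim: js => [|j js IH] /= H; first by rewrite mul0r.
rewrite natrD -[(size js).+1%:R]natr1 mulrDl mul1r addrC lerD //; last by apply: H; exact: mem_head.
by apply: IH => i ij; apply: H; rewrite inE ij orbT.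
Qed.

(** Elements of length at most [n / 2] are bounded by a ball of half the radius;
the others lie in at most [n] spheres, where slow elements are rare. *)
Lemma gap_of_spheres (A : set G) (L l C N0 : nat) :
  A 1%g -> (0 < L)%N -> (0 < l)%N -> (forall q, (2 ^ q <= bn (L * q.+1))%N) ->
  (forall n Al, (N0 <= n)%N -> uniq Al -> (forall g, g \in Al -> len g = n /\ A g) ->
    (size Al)%:R <= (C * bn n)%:R * (2^-1) ^+ (n %/ l) :> R) ->
  (rate R (fun n => size [seq g <- Bl n | `[< A g >]]) < rate R (fun n => bn n))%E.
Proof.
move=> A1 L0 l0 HL HA; set a := fun n => size _.
have a0 n : (0 < a n)%N.
  have : 1%g \in [seq g <- Bl n | `[< A g >]] by rewrite mem_filter mem_Bl len1 andbT; apply/asboolP.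
  by rewrite /a; case: (X in size X).
apply: (@rate_gap R a (fun n => bn n) L l C (2 * N0) (bn 0) (bn 1)) => //.
- by move=> n; exact: (ball_ge1 len1 mem_Bl n).
- by move=> n; have := ball_mul len1 Hpth Bl_uniq mem_Bl 0 1 n; rewrite add0n mul1n.
move=> n Nn; set s := [seq g <- Bl n | `[< A g >]]; set h := n./2.
have us : uniq s by apply: filter_uniq.
have hn : (h <= n)%N by rewrite /h; clear; lia.
have hN : (N0 <= h)%N by rewrite /h -[N0]doubleK -mul2n half_leq.
rewrite /a -/s -(count_predC (fun g => len g <= h)%N s) -!size_filter natrD; apply: lerD.
  rewrite ler_nat; apply: uniq_leq_size; first exact: filter_uniq.
  by move=> g; rewrite mem_filter mem_Bl => /andP[].
pose js := iota h.+1 (n - h).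
pose f j := size [seq g <- s | len g == j].
apply: le_trans (_ : (sumn [seq f j | j <- js])%:R <= _).
  rewrite ler_nat.
  have -> : sumn [seq f j | j <- js] = size (flatten [seq [seq g <- s | len g == j] | j <- js]).
    by rewrite size_flatten /shape -map_comp.
  apply: uniq_leq_size; first exact: filter_uniq.
  move=> g; rewrite mem_filter /= -ltnNge => /andP[hg gs]; apply/flatten_mapP.
  exists (len g); last by rewrite mem_filter eqxx.
  have gn : (len g <= n)%N by move: gs; rewrite mem_filter mem_Bl => /andP[].
  by rewrite mem_iota hg addSn ltnS subnKC.
apply: le_trans (sumn_bound (x := (C * bn n)%:R * (2^-1) ^+ (h %/ l)) _) _.
  move=> j; rewrite mem_iota => /andP[hj jn].
  have {}jn : (j <= n)%N by move: jn; rewrite addSn ltnS subnKC.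
  apply: le_trans (HA j _ _ _ _) _.
  - by apply: leq_trans hN (ltnW hj).
  - exact: filter_uniq.
  - by move=> g; rewrite !mem_filter => /andP[/eqP-> /andP[/asboolP Ag _]].
  apply: ler_pM; [exact: ler0n|by rewrite exprn_ge0| |].
    by rewrite ler_nat leq_mul2l (ball_mono Bl_uniq mem_Bl jn) orbT.
  apply: ler_wiXn2l; [by rewrite invr_ge0|lra|].
  by apply: leq_div2r; apply: ltnW.
rewrite mulrA -natrM; apply: ler_wpM2r; first by rewrite exprn_ge0.
by rewrite ler_nat size_iota -mulnA leq_mul2r leq_subr orbT.
Qed.

End Assembly.

Lemma card_fset_set_seq (G : groupType) (P : set G) (s : seq G) :
  uniq s -> (forall g, (g \in s) <-> P g) -> size (finmap.enum_fset (fset_set P)) = size s.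
Proof.
move=> us Ps; have finP : finite_set P.
  by apply/finite_seqP; exists s; apply/seteqP; split=> g /=; rewrite Ps.
apply: perm_size; apply: uniq_perm => //.
move=> g; rewrite in_fset_set //; apply/idP/idP; first by move/set_mem/Ps.
by move/Ps => ?; apply/mem_set.
Qed.

(** * The growth gap *)

Theorem mainTheorem6 (R : realType) (G : groupType) (X : metricType R)
    (act : G -> X -> X) (o : X)
    (fgG : finitely_generated G)
    (geoX : geodesic_space X)
    (isoact : isometric_action act)
    (indep_pair : exists h k : G,
      [/\ strongly_contracting act h /\ WPD act h,
          strongly_contracting act k /\ WPD act k
        & independent h k]) :
  forall S : set G, finite_set S -> symmetric_set S -> generates S ->
    exists2 eps : R, 0 < eps &
      (growth_rate R S
         [set g | (mdist o (act g o) <= eps * (word_metric S 1%g g)%:R)%R]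
       < growth_rate R S setT)%E.
Proof.
move=> S finS symS genS; have [h [k [[sch wpdh] [sck wpdk] indep]]] := indep_pair.
pose len := word_length S.
have len1 : len 1%g = 0%N by apply: len1.
have lenM x y : (len (x * y)%g <= len x + len y)%N by apply: lenM.
have wmE g : word_metric S 1%g g = len g by rewrite /word_metric invg1 mul1g.
have [pth Hp] := choice_ex (geodesic_word symS genS).
have Hpth g : geodpath len g (pth g) by have [] := Hp g.
have [Bl HBl] := choice_ex (fun n => let: ex_intro2 B u m := ball_finite finS symS genS n in
  ex_intro (fun B => uniq B /\ forall g, (g \in B) = (len g <= n)%N) B (conj u m)).
have Bl_uniq n : uniq (Bl n) by have [] := HBl n.
have mem_Bl n g : (g \in Bl n) = (len g <= n)%N by have [_ ->] := HBl n.
have [ o1 [T [b [[cT HcT] [B HB] [c Hc] Hlow [Henc [c2 Hfam]]]]]] :=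
  walls_and_encoding geoX isoact sch wpdh sck wpdk indep.
have [cF [enc [enc_ok enc_len enc_inj]]] := Henc len lenM.
pose D g := mdist o1 (act g o1).
have DM x y : D (x * y)%g <= D x + D y.
  rewrite /D (actM isoact); apply: le_trans (tri _ (act x o1) _) _.
  by rewrite lerD2l (act_isometry isoact).
have DV x : D (x^-1)%g = D x by rewrite /D -(dactV isoact) dsym.
have D1 : D 1%g = 0 by rewrite /D (act1 isoact) mdistxx.
have [Kn HK] : exists Kn : nat, forall s, S s -> D s <= Kn%:R.
  have /finite_seqP [F HF] := finS.
  suff [Kn H] : exists Kn : nat, forall s, s \in F -> D s <= Kn%:R.
    by exists Kn => s; rewrite HF; apply: H.
  elim: (F) => [|s F' [Kn H]]; first by exists 0%N.
  have [N HN] := nat_ub (D s); exists (N + Kn)%N => s'.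
  rewrite inE natrD => /orP[/eqP->|/H].
    by have : (0 : R) <= Kn%:R := ler0n _ _; lra.
  by have : (0 : R) <= N%:R := ler0n _ _; lra.
have Dlen x : D x <= (Kn * len x)%:R.
  have [[w [sw Hw ex]] _] := len_spec symS genS x.
  rewrite /len -sw ex.
  elim: w Hw {sw ex} => [|s w IH] Hw; first by rewrite big_nil D1 muln0.
  rewrite big_cons mulnS natrD; apply: le_trans (DM _ _) _; apply: lerD.
    by apply: HK; apply: Hw; exact: mem_head.
  by apply: IH => s' s'w; apply: Hw; rewrite inE s'w orbT.
have [cK HcK] := Hlow Kn%:R (ler0n _ _).
have [c4 Hc4] := nat_ub c2.
have [c3 Hc3] := nat_ub c.
have [|eps eps0 [l l0 Hl]] := slow_sphere len1 Hpth Bl_uniq mem_Bl enc_ok enc_len enc_inj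
  (cK := cK) DM DV Dlen HcT HB Hc.
- move=> D0 D00; have [E HE] := HcK D0 D00; exists E => g s0 s1 /andP[s01 s1l].
  apply: HE => // t /andP[_ ts1]; have [_ _ HS _] := Hp g.
  by apply/HK/HS; apply: leq_trans s1l.
have [N0 HN0] := Hl (2 * mdist o o1).
have [L L0 HL] : exists2 L, (0 < L)%N & forall q, (2 ^ q <= size (Bl (L * q.+1)))%N.
  have eg := exponential_growth R len1 Bl_uniq mem_Bl enc_ok enc_len enc_inj
    (c := (cT.+1 * (1 + c4 + c3))%N).
  apply: eg; first exact: muln_gt0.
  move=> t; have [s [us sz Ds]] := Hfam t; exists s; split=> // h' w ws.
  apply: leq_trans (HcT h' w) _; rewrite -mulnA; apply: leq_mul => //.
  suff : (T w <= (c4 + c3) * t.+1)%N by clear; nia.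
  rewrite -(ler_nat R); apply: le_trans (Hc w) _.
  have h1 := Ds w ws.
  have t1 : (1 : R) <= t.+1%:R by rewrite ler1n.
  have c40 : (0 : R) <= c4%:R := ler0n _ _.
  have c30 : (0 : R) <= c3%:R := ler0n _ _.
  rewrite natrM natrD mulrDl; apply: lerD.
    by apply: le_trans h1 _; apply: ler_wpM2r.
  by apply: le_trans Hc3 _; rewrite -[leLHS]mulr1; apply: ler_wpM2l.
exists eps => //.
set A := [set g | _].
have A1 : A 1%g by rewrite /A /= (act1 isoact) mdistxx wmE len1 mulr0.
have key := gap_of_spheres (R := R) (A := A) (N0 := N0) (C := 2 * size (Bl cF)) len1 Hpth Bl_uniq mem_Bl A1 L0 l0 HL.
have rE (P : set G) : growth_rate R S P = rate R (fun n => size [seq g <- Bl n | `[< P g >]]).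
  rewrite /growth_rate /rate; congr limn_esup; apply/funext => n; congr ((lne _%:E * _)%E); congr (_%:R).
  apply: card_fset_set_seq; first exact: filter_uniq.
  move=> g; rewrite mem_filter mem_Bl; split; first by move=> /andP[/asboolP Pg gn]; split=> //; rewrite /word_ball /= wmE.
  by move=> [Pg gn]; apply/andP; split; [exact/asboolP|rewrite -wmE].
rewrite !rE.
have -> : rate R (fun n => size [seq g <- Bl n | `[< [set: G] g >]]) = rate R (fun n => size (Bl n)).
  congr rate; apply/funext => n; congr size; apply/all_filterP/allP => g _; exact/asboolP.
apply: key => n Al Nn uA HA; apply: HN0 => // g /HA [gl Ag]; split=> //.
have Dg : D g <= mdist o (act g o) + 2 * mdist o o1.
  rewrite /D; apply: le_trans (tri _ o _) _; rewrite dsym.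
  have := tri o (act g o) (act g o1); rewrite (act_isometry isoact); lra.
by apply: le_trans Dg _; rewrite lerD2r -gl -wmE.
Qed.
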